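(* Let $0<d<\pi/2$, $\mathscr{D}_d=\{\zeta\in\mathbb{C}:|\Im\zeta|<d\}$, and $\psi(t)=e^{(\pi/2)\sinh t}$. Assume $f$ is analytic on $\psi(\mathscr{D}_d)$ and there are constants $K,\alpha,\beta>0$ with $|f(z)|\le K\left|\frac{z^{\alpha-1}}{(1+z^2)^{(\alpha+\beta)/2}}\right|$ for all $z\in\psi(\mathscr{D}_d)$. Let $\mu=\min\{\alpha,\beta\}$, $\nu=\max\{\alpha,\beta\}$, let $n$ be a positive integer, $h=\log(4dn/\mu)/n$, and let $M=n$, $N=n-\lfloor\log(\beta/\alpha)/h\rfloor$ if $\mu=\alpha$, and $N=n$, $M=n-\lfloor\log(\alpha/\beta)/h\rfloor$ if $\mu=\beta$. Suppose $n\ge\nu e/(4d)$, $Mh\ge x_{\alpha/2}$, $Nh\ge x_{\beta/2}$. Then \[ \sup_{\tau\in(0,\infty)}\left|\int_{0}^{\tau}f(t)\,dt-\sum_{k=-M}^{N}f(\psi(kh))\psi'(kh)J(k,h)(\psi^{-1}(\tau))\right|\le C_2\,\frac{e^{-\pi dn/\log(4dn/\mu)}\log(4dn/\mu)}{n}, \] with $C_2=\frac{2K}{\mu d}\left\{\frac{1}{(1-e^{-\pi\mu e/2})\{\cos(\frac\pi2\sin d)\}^{(\alpha+\beta)/2}\cos d}+e^{\pi(\alpha+\beta)/4}\right\}$.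
   Context: $J(k,h)(x)=h\left\{\frac12+\frac1\pi\operatorname{Si}[\pi(x/h-k)]\right\}$ with $\operatorname{Si}(x)=\int_0^x\frac{\sin\sigma}{\sigma}d\sigma$. For $\gamma>0$, $x_\gamma=\operatorname{arcsinh}\!\left(\frac{\sqrt{1+\sqrt{1-(2\pi\gamma)^2}}}{2\pi\gamma}\right)$ if $0<\gamma<1/(2\pi)$, and $x_\gamma=\operatorname{arcsinh}(1)$ if $\gamma\ge1/(2\pi)$. Complex powers use principal branches. *)

(* Defs.v *)
From Stdlib Require Import Reals ZArith List.
From Coquelicot Require Import Coquelicot.
Open Scope R_scope.

Definition Cexp (z : C) : C :=
  (exp (Re z) * cos (Im z), exp (Re z) * sin (Im z)).
Definition Csinh (z : C) : C := ((Cexp z - Cexp (- z)) / 2)%C.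

Definition psi (t : R) : R := exp (PI / 2 * sinh t).
Definition Cpsi (z : C) : C := Cexp (RtoC (PI / 2) * Csinh z)%C.
Definition psi_inv (x : R) : R := arcsinh (2 / PI * ln x).

Definition strip (d : R) (z : C) : Prop := Rabs (Im z) < d.
Definition psi_strip (d : R) (z : C) : Prop :=
  exists w : C, strip d w /\ Cpsi w = z.

Definition Si (x : R) : R := RInt (fun s => sin s / s) 0 x.

Definition J (k : Z) (h : R) (x : R) : R :=
  h * (1 / 2 + Si (PI * (x / h - IZR k)) / PI).

Definition x_gamma (g : R) : R :=
  if Rlt_dec g (1 / (2 * PI)) then
    arcsinh (sqrt (1 + sqrt (1 - (2 * PI * g) ^ 2)) / (2 * PI * g))
  else arcsinh 1.

(* sum_{k=a}^{b} g k  (empty if b < a) *)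
Definition sumZ (a b : Z) (g : Z -> C) : C :=
  fold_right Cplus (RtoC 0)
    (map (fun j => g (a + Z.of_nat j)%Z) (seq 0 (Z.to_nat (b - a + 1)))).

(* Modulus of a principal complex power with a real exponent:
   |w^s| = |w|^s for real s and w <> 0. *)
Definition abs_cpow (w : C) (s : R) : R := Rpower (Cmod w) s.

Definition floorZ (x : R) : Z := Int_part x.

(* Main.v *)
Require Import Defs.
From Stdlib Require Import Reals ZArith List Lra Lia Psatz FinFun IndefiniteDescription.
From Coquelicot Require Import Coquelicot.
Open Scope R_scope.

(** Put [F = (f o psi) psi'], so that the integral over [(0, tau)] becomes the integral of [F] over
    [(-oo, xi)] with [xi = psi_inv tau].  For real [x], residue calculus on a rectangle with half-integer
    vertical sides expresses the error of Sinc interpolation as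
    [sin (pi x / h) / (2 pi i)] times the contour integral of [F z / ((z - x) sin (pi z / h))].
    Integrating this in [x] and exchanging the integrals leaves, on the horizontal sides, the oscillatory
    integral of [sin (pi x / h) / (z - x)], which integration by parts bounds by [h / |Im z|]; together
    with [|sin (pi z / h)| >= sinh (pi |Im z| / h)] this is the discretization error.
    The integral of [|F|] along the sides is controlled by
    [|1 + exp (pi sinh (x + i y))| >= (1 + exp (pi sinh x cos y)) cos (pi / 2 sin y)].

    For the truncation error, [cosh x exp (- c sinh x)] need not be decreasing for [x >= x_gamma], but there
    [2 c sinh x >= 1], so it decreases up to a factor [sqrt 2], and the sum telescopes by the mean value
    theorem.  The slack in [C2] absorbs this factor. *)

(** * Continuity and complex derivatives *)

(** All estimates are made with a finite lower limit [xi0], a height [y < d] and [2 * m + 1] nodes.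
    Then [m] grows, which removes the vertical sides; [y] tends to [d], because [F] is holomorphic
    in the open strip only; at last [xi0] tends to minus infinity. This is why
    [J k h xi - J k h xi0] stands in the error bounds where the theorem has [J k h xi]; the bounds
    are uniform in [xi0]. Why [x_gamma] does not give monotonicity: put [c = PI * g]. Then
    [cosh x * exp (- c * sinh x)] decreases once [sinh x] exceeds the larger root
    [(1 + sqrt (1 - 4 * c ^ 2)) / (2 * c)] of [c * s ^ 2 - s + c], whereas [sinh (x_gamma g)] has
    the smaller numerator [sqrt (1 + sqrt (1 - 4 * c ^ 2))]. The slack has two sources. The
    discretization error comes with [1 / PI] where [C2] grants [1 / 2]. The truncation error comes
    with [2 * sqrt 2], and comparing [exp (- PI * d * n)] with [exp (- PI * d / h) * h / d] gains a
    factor [PI]. *)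

Section Continuity.
Context {U : UniformSpace}.
Implicit Types (f g : U -> C) (u : U).

(** The domain is any uniform space, so that the same rules serve functions on [C], integrands along
    a segment and kernels of two real variables. *)
Lemma continuous_Cpair (p q : U -> R) u :
  continuous p u -> continuous q u ->
  continuous (fun v => (p v, q v) : C) u.
Proof.
  intros Hp Hq.
  apply (continuous_comp_2 (V := R_UniformSpace) (W := R_UniformSpace)
           (X := C_UniformSpace) p q (fun a b => (a, b)) u Hp Hq).
  simpl.
  intros P [e HP]. exists e. intros [y1 y2] Hy. apply HP. exact Hy.
Qed.

Lemma continuous_Re f u : continuous f u -> continuous (fun v => Re (f v)) u.
Proof.
  intros H. apply (continuous_comp (V := C_UniformSpace) f Re u H).
  intros P [e HP]. exists e. intros y Hy. apply HP. apply Hy.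
Qed.

Lemma continuous_Im f u : continuous f u -> continuous (fun v => Im (f v)) u.
Proof.
  intros H. apply (continuous_comp (V := C_UniformSpace) f Im u H).
  intros P [e HP]. exists e. intros y Hy. apply HP. apply Hy.
Qed.

Lemma continuous_Cplus f g u :
  continuous f u -> continuous g u -> continuous (fun v => f v + g v)%C u.
Proof.
  intros Hf Hg. apply continuous_Cpair.
  - apply (continuous_plus (V := R_NormedModule) (fun v => Re (f v)) (fun v => Re (g v)));
      now apply continuous_Re.
  - apply (continuous_plus (V := R_NormedModule) (fun v => Im (f v)) (fun v => Im (g v)));
      now apply continuous_Im.
Qed.

Lemma continuous_Copp f u : continuous f u -> continuous (fun v => - f v)%C u.
Proof.
  intros Hf. apply continuous_Cpair.
  - apply (continuous_opp (V := R_NormedModule) (fun v => Re (f v))); now apply continuous_Re.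
  - apply (continuous_opp (V := R_NormedModule) (fun v => Im (f v))); now apply continuous_Im.
Qed.

Lemma continuous_Cminus f g u :
  continuous f u -> continuous g u -> continuous (fun v => f v - g v)%C u.
Proof. intros Hf Hg. apply continuous_Cplus; [exact Hf|now apply continuous_Copp]. Qed.

Lemma continuous_Rmult (p q : U -> R) u :
  continuous p u -> continuous q u -> continuous (fun v => p v * q v) u.
Proof. intros Hp Hq. now apply (continuous_mult (K := R_AbsRing) p q u). Qed.

Lemma continuous_Rplus (p q : U -> R) u :
  continuous p u -> continuous q u -> continuous (fun v => p v + q v) u.
Proof. intros Hp Hq. now apply (continuous_plus (V := R_NormedModule) p q u). Qed.

Lemma continuous_Rminus (p q : U -> R) u :
  continuous p u -> continuous q u -> continuous (fun v => p v - q v) u.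
Proof. intros Hp Hq. now apply (continuous_minus (V := R_NormedModule) p q u). Qed.

Lemma continuous_Cmult f g u :
  continuous f u -> continuous g u -> continuous (fun v => f v * g v)%C u.
Proof.
  intros Hf Hg.
  pose proof (continuous_Re f u Hf); pose proof (continuous_Im f u Hf).
  pose proof (continuous_Re g u Hg); pose proof (continuous_Im g u Hg).
  apply continuous_Cpair.
  - apply (continuous_Rminus (fun v => Re (f v) * Re (g v)) (fun v => Im (f v) * Im (g v)));
      now apply continuous_Rmult.
  - apply (continuous_Rplus (fun v => Re (f v) * Im (g v)) (fun v => Im (f v) * Re (g v)));
      now apply continuous_Rmult.
Qed.

Lemma continuous_Rinv_fun (p : U -> R) u :
  continuous p u -> p u <> 0 -> continuous (fun v => / p v) u.
Proof.
  intros Hp H0. apply (continuous_comp p Rinv u Hp).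
  apply continuity_pt_filterlim.
  apply (continuity_pt_inv (fun x => x)); [apply derivable_continuous_pt, derivable_pt_id|exact H0].
Qed.

Lemma continuous_Cinv f u :
  continuous f u -> f u <> 0%C -> continuous (fun v => / f v)%C u.
Proof.
  intros Hf H0.
  pose proof (continuous_Re f u Hf) as HR; pose proof (continuous_Im f u Hf) as HI.
  assert (HN : continuous (fun v => / (Re (f v) ^ 2 + Im (f v) ^ 2)) u).
  { apply (continuous_Rinv_fun (fun v => Re (f v) ^ 2 + Im (f v) ^ 2)).
    - apply (continuous_Rplus (fun v => Re (f v) ^ 2) (fun v => Im (f v) ^ 2)).
      + apply (continuous_ext (fun v => Re (f v) * Re (f v))); [intros; simpl; ring|].
        now apply continuous_Rmult.
      + apply (continuous_ext (fun v => Im (f v) * Im (f v))); [intros; simpl; ring|].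
        now apply continuous_Rmult.
    - intros E. apply H0. destruct (f u) as [x y]; simpl in *.
      assert (x = 0) by nra. assert (y = 0) by nra. now subst. }
  apply continuous_Cpair.
  - now apply (continuous_Rmult (fun v => Re (f v))).
  - apply (continuous_Rmult (fun v => - Im (f v))); [|exact HN].
    now apply (continuous_opp (V := R_NormedModule) (fun v => Im (f v))).
Qed.

Lemma continuous_Cdiv f g u :
  continuous f u -> continuous g u -> g u <> 0%C -> continuous (fun v => f v / g v)%C u.
Proof. intros Hf Hg H0. apply continuous_Cmult; [exact Hf|now apply continuous_Cinv]. Qed.

Lemma continuous_Cconst (c : C) u : continuous (fun _ : U => c) u.
Proof. apply continuous_const. Qed.

Lemma continuous_RtoC (p : U -> R) u : continuous p u -> continuous (fun v => RtoC (p v)) u.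
Proof. intros H. apply continuous_Cpair; [exact H|apply continuous_const]. Qed.

Lemma continuous_Cmod f u : continuous f u -> continuous (fun v => Cmod (f v)) u.
Proof.
  intros H.
  apply (continuous_comp (V := C_UniformSpace) f (fun z => Cmod z) u H).
  apply (continuous_ext (fun z : C => sqrt (fst z * fst z + snd z * snd z))).
  { intros [x y]. unfold Cmod; simpl. f_equal. ring. }
  assert (I : continuous (fun z : C_UniformSpace => z) (f u)) by apply continuous_id.
  apply (continuous_comp (fun z : C_UniformSpace => fst z * fst z + snd z * snd z) sqrt).
  - apply (continuous_plus (V := R_NormedModule) (fun z : C_UniformSpace => fst z * fst z) (fun z => snd z * snd z)).
    + apply (continuous_mult (K := R_AbsRing) (fun z : C_UniformSpace => fst z) (fun z => fst z)); intros P [e HP]; exists e; intros y Hy; apply HP, Hy.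
    + apply (continuous_mult (K := R_AbsRing) (fun z : C_UniformSpace => snd z) (fun z => snd z)); intros P [e HP]; exists e; intros y Hy; apply HP, Hy.
  - apply continuous_sqrt.
Qed.

End Continuity.

Lemma continuous_Cid (z : C) : continuous (fun w : C => w) z.
Proof. apply continuous_id. Qed.

Lemma sqrt2_le_2 : sqrt 2 <= 2.
Proof. rewrite <- (sqrt_Rsqr 2) at 2 by lra. apply sqrt_le_1_alt. unfold Rsqr; lra. Qed.

Lemma Rmin_lt_l x a b : x < Rmin a b -> x < a.
Proof. intros H. eapply Rlt_le_trans; [exact H|apply Rmin_l]. Qed.

Lemma Rmin_lt_r x a b : x < Rmin a b -> x < b.
Proof. intros H. eapply Rlt_le_trans; [exact H|apply Rmin_r]. Qed.

(** The balls of [C] are boxes, so passing from a ball to the modulus costs a factor [sqrt 2];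
    halving the radius pays for it. *)
Lemma continuous_C_eps (f : C -> C) (z : C) :
  continuous f z <->
  forall eps, 0 < eps -> exists delta, 0 < delta /\
    forall w, Cmod (w - z) < delta -> Cmod (f w - f z) < eps.
Proof.
  split.
  - intros H eps He.
    assert (He2 : 0 < eps / 2) by lra.
    destruct (H (ball (f z) (mkposreal _ He2))) as [dl Hd].
    { now exists (mkposreal _ He2). }
    exists dl; split; [apply cond_pos|]. intros w Hw.
    assert (B : ball (f z) (mkposreal _ He2) (f w)).
    { apply Hd. apply C_NormedModule_mixin_compat1. exact Hw. }
    eapply Rlt_le_trans; [apply (C_NormedModule_mixin_compat2 _ _ _ B)|].
    simpl. pose proof sqrt2_le_2.
    nra.
  - intros H P [e HP].
    destruct (H e (cond_pos e)) as [dl [Hd Hw]].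
    assert (Hd2 : 0 < dl / 2) by lra.
    exists (mkposreal _ Hd2). intros w Bw. apply HP.
    apply C_NormedModule_mixin_compat1. apply Hw.
    eapply Rlt_le_trans; [apply (C_NormedModule_mixin_compat2 _ _ _ Bw)|].
    simpl. pose proof sqrt2_le_2.
    nra.
Qed.

(* Caratheodory's form of [f'(z) = l]; it turns the rules of differentiation into continuity statements. *)
Definition Cder (f : C -> C) (z l : C) : Prop :=
  exists phi : C -> C, continuous phi z /\ phi z = l /\
    exists delta, 0 < delta /\
      forall w, Cmod (w - z) < delta -> f w = (f z + phi w * (w - z))%C.

Lemma Cmod_small_locally (z : C) (delta : R) :
  0 < delta -> locally z (fun w : C => Cmod (w - z) < delta).
Proof.
  intros Hd. assert (Hd2 : 0 < delta / 2) by lra.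
  exists (mkposreal _ Hd2). intros w Bw.
  eapply Rlt_le_trans; [apply (C_NormedModule_mixin_compat2 _ _ _ Bw)|].
  simpl. pose proof sqrt2_le_2.
  nra.
Qed.

Lemma Cder_continuous f z l : Cder f z l -> continuous f z.
Proof.
  intros (phi & Hc & _ & dl & Hd & Hf).
  apply (continuous_ext_loc (T := C_UniformSpace) (U := C_UniformSpace) f (fun w => f z + phi w * (w - z))%C z).
  - generalize (Cmod_small_locally z dl Hd). apply filter_imp. intros w Hw. symmetry. now apply Hf.
  - apply continuous_Cplus; [apply continuous_Cconst|].
    apply continuous_Cmult; [exact Hc|].
    apply continuous_Cminus; [apply continuous_Cid|apply continuous_Cconst].
Qed.

Lemma Cder_const c z : Cder (fun _ => c) z 0.
Proof.
  exists (fun _ => RtoC 0). split; [apply continuous_Cconst|]. split; [easy|].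
  exists 1; split; [lra|]. intros w _. ring.
Qed.

Lemma Cder_id z : Cder (fun w => w) z 1.
Proof.
  exists (fun _ => RtoC 1). split; [apply continuous_Cconst|]. split; [easy|].
  exists 1; split; [lra|]. intros w _. ring.
Qed.

Lemma Cder_plus f g z l m :
  Cder f z l -> Cder g z m -> Cder (fun w => f w + g w)%C z (l + m).
Proof.
  intros (p & Hp & <- & d1 & Hd1 & Hf) (q & Hq & <- & d2 & Hd2 & Hg).
  exists (fun w => p w + q w)%C. split; [now apply continuous_Cplus|]. split; [easy|].
  exists (Rmin d1 d2). split; [now apply Rmin_pos|]. intros w Hw.
  rewrite (Hf w (Rmin_lt_l _ _ _ Hw)), (Hg w (Rmin_lt_r _ _ _ Hw)). ring.
Qed.

Lemma Cder_mult f g z l m :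
  Cder f z l -> Cder g z m -> Cder (fun w => f w * g w)%C z (l * g z + f z * m).
Proof.
  intros Df Dg. pose proof (Cder_continuous _ _ _ Dg) as Cg. revert Df Dg.
  intros (p & Hp & <- & d1 & Hd1 & Hf) (q & Hq & <- & d2 & Hd2 & Hg).
  exists (fun w => p w * g w + f z * q w)%C. split.
  { apply continuous_Cplus; apply continuous_Cmult; trivial. apply continuous_Cconst. }
  split; [easy|].
  exists (Rmin d1 d2). split; [now apply Rmin_pos|]. intros w Hw.
  assert (w1 : Cmod (w - z) < d1) by (exact (Rmin_lt_l _ _ _ Hw)).
  assert (w2 : Cmod (w - z) < d2) by (exact (Rmin_lt_r _ _ _ Hw)).
  rewrite (Hf w w1), (Hg w w2). ring.
Qed.

Lemma Cder_opp f z l : Cder f z l -> Cder (fun w => - f w)%C z (- l).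
Proof.
  intros (p & Hp & <- & d1 & Hd1 & Hf).
  exists (fun w => - p w)%C. split; [now apply continuous_Copp|]. split; [easy|].
  exists d1. split; [easy|]. intros w Hw. rewrite (Hf w Hw). ring.
Qed.

Lemma Cder_minus f g z l m :
  Cder f z l -> Cder g z m -> Cder (fun w => f w - g w)%C z (l - m).
Proof. intros Hf Hg. apply Cder_plus; [exact Hf|now apply Cder_opp]. Qed.

Lemma Cder_comp f g z l m :
  Cder f (g z) l -> Cder g z m -> Cder (fun w => f (g w)) z (l * m).
Proof.
  intros Df Dg. pose proof (Cder_continuous _ _ _ Dg) as Cg. revert Df Dg.
  intros (p & Hp & <- & d1 & Hd1 & Hf) (q & Hq & <- & d2 & Hd2 & Hg).
  exists (fun w => p (g w) * q w)%C. split.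
  { apply continuous_Cmult; trivial. now apply continuous_comp. }
  split; [easy|].
  apply continuous_C_eps with (eps := d1) in Cg; [|easy].
  destruct Cg as (d3 & Hd3 & Hg3).
  exists (Rmin d2 d3). split; [now apply Rmin_pos|]. intros w Hw.
  assert (w2 : Cmod (w - z) < d2) by (exact (Rmin_lt_l _ _ _ Hw)).
  assert (w3 : Cmod (w - z) < d3) by (exact (Rmin_lt_r _ _ _ Hw)).
  rewrite (Hf (g w)) by now apply Hg3. rewrite (Hg w w2) at 2. ring.
Qed.

Lemma Cder_inv f z l : Cder f z l -> f z <> 0%C -> Cder (fun w => / f w)%C z (- l / (f z * f z)).
Proof.
  intros Df H0. pose proof (Cder_continuous _ _ _ Df) as Cf. revert Df.
  intros (p & Hp & <- & d1 & Hd1 & Hf).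
  exists (fun w => - p w / (f w * f z))%C. split.
  { apply continuous_Cdiv; [now apply continuous_Copp| |now apply Cmult_neq_0].
    apply continuous_Cmult; [easy|apply continuous_Cconst]. }
  split; [easy|].
  assert (Hm : 0 < Cmod (f z)) by now apply Cmod_gt_0.
  apply continuous_C_eps with (eps := Cmod (f z)) in Cf; [|easy].
  destruct Cf as (d3 & Hd3 & Hf3).
  exists (Rmin d1 d3). split; [now apply Rmin_pos|]. intros w Hw.
  assert (w1 : Cmod (w - z) < d1) by (exact (Rmin_lt_l _ _ _ Hw)).
  assert (w3 : Cmod (w - z) < d3) by (exact (Rmin_lt_r _ _ _ Hw)).
  assert (Hw0 : f w <> 0%C).
  { intros E. specialize (Hf3 w w3). rewrite E in Hf3.
    replace (0 - f z)%C with (- f z)%C in Hf3 by ring. rewrite Cmod_opp in Hf3. lra. }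
  assert (E : (p w * (w - z) = f w - f z)%C) by (rewrite (Hf w w1); ring).
  replace (- p w / (f w * f z) * (w - z))%C with (- (p w * (w - z)) / (f w * f z))%C
    by (field; now split).
  rewrite E. field. now split.
Qed.

Lemma Cder_ext f g z l : (forall w, f w = g w) -> Cder f z l -> Cder g z l.
Proof.
  intros E (p & Hp & Hl & d1 & Hd1 & Hf). exists p. split; [easy|]. split; [easy|].
  exists d1. split; [easy|]. intros w Hw. rewrite <- !E. now apply Hf.
Qed.

(** The slope function is the difference quotient with the value [l] inserted at [z]. *)
Lemma Cder_eps (f : C -> C) (z l : C) :
  (forall eps, 0 < eps -> exists delta, 0 < delta /\
    forall w, Cmod (w - z) < delta ->
      Cmod (f w - f z - l * (w - z)) <= eps * Cmod (w - z)) -> Cder f z l.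
Proof.
  intros H.
  pose (phi := fun w : C => if Ceq_dec w z then l else ((f w - f z) / (w - z))%C).
  assert (Pz : phi z = l) by (unfold phi; destruct (Ceq_dec z z); easy).
  exists phi. split; [|split; [exact Pz|]].
  - apply continuous_C_eps. intros eps He.
    destruct (H (eps / 2)) as (dl & Hd & Hw); [lra|].
    exists dl. split; [easy|]. intros w Hw'. rewrite Pz. unfold phi.
    destruct (Ceq_dec w z) as [->|Hn].
    + replace (l - l)%C with (RtoC 0) by ring. now rewrite Cmod_0.
    + assert (Hn0 : (w - z)%C <> 0%C).
      { intros E. apply Hn. replace w with (w - z + z)%C by ring. rewrite E. ring. }
      assert (Hm : 0 < Cmod (w - z)) by now apply Cmod_gt_0.
      specialize (Hw w Hw').
      replace (f w - f z - l * (w - z))%C with (((f w - f z) / (w - z) - l) * (w - z))%C in Hw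
        by (field; easy).
      rewrite Cmod_mult in Hw. apply Rmult_le_reg_r in Hw; lra.
  - exists 1. split; [lra|]. intros w _. unfold phi.
    destruct (Ceq_dec w z) as [->|Hn]; [ring|].
    field. intros E. apply Hn. replace w with (w - z + z)%C by ring. rewrite E. ring.
Qed.

(** The entrance for the analyticity hypothesis on [f]; from here on only [Cder] is used. *)
Lemma ex_derive_Cder (f : C -> C) (z : C) : ex_derive f z -> exists l, Cder f z l.
Proof.
  intros [l [_ Hl]]. exists l. apply Cder_eps. intros eps He.
  specialize (Hl z (fun P HP => HP) (mkposreal _ He)).
  destruct Hl as [dl Hd].
  exists dl. split; [apply cond_pos|]. intros w Hw.
  specialize (Hd w Hw).
  change (norm ?x) with (Cmod x) in Hd.
  unfold minus, plus, opp, scal in Hd. simpl in Hd.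
  replace (f w - f z - l * (w - z))%C with (f w + - f z + - ((w + - z) * l))%C by ring.
  eapply Rle_trans; [exact Hd|]. apply Rle_refl.
Qed.

Lemma Cder_eq f z l m : Cder f z l -> l = m -> Cder f z m.
Proof. now intros H <-. Qed.

(** * Contour integrals and residues *)

(** A pair of real integrals, so that the fundamental theorem, substitution and Fubini can be
    applied to each component; [CI_correct] is the link to the vector-valued integral. It is total
    like [RInt], hence the companion [exCI]. *)
Definition CI (f : R -> C) (a b : R) : C :=
  (RInt (fun t => Re (f t)) a b, RInt (fun t => Im (f t)) a b).

Definition exCI (f : R -> C) (a b : R) : Prop :=
  ex_RInt (fun t => Re (f t)) a b /\ ex_RInt (fun t => Im (f t)) a b.

Lemma exCI_continuous f a b :
  (forall t, Rmin a b <= t <= Rmax a b -> continuous f t) -> exCI f a b.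
Proof.
  intros H. split; apply (ex_RInt_continuous (V := R_CompleteNormedModule)); intros t Ht.
  - now apply (continuous_Re f), H.
  - now apply (continuous_Im f), H.
Qed.

Lemma CI_correct f a b : exCI f a b ->
  is_RInt (V := C_R_CompleteNormedModule) f a b (CI f a b).
Proof.
  intros [H1 H2].
  apply (is_RInt_fct_extend_pair (U := R_NormedModule) (V := R_NormedModule) f);
    now apply (RInt_correct (V := R_CompleteNormedModule)).
Qed.

Lemma CI_unique f a b l :
  is_RInt (V := C_R_CompleteNormedModule) f a b l -> exCI f a b /\ CI f a b = l.
Proof.
  intros H.
  pose proof (is_RInt_fct_extend_fst (U := R_NormedModule) (V := R_NormedModule) f a b l H) as H1.
  pose proof (is_RInt_fct_extend_snd (U := R_NormedModule) (V := R_NormedModule) f a b l H) as H2.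
  split; [split; eexists; eassumption|].
  unfold CI. destruct l as [l1 l2]. f_equal; now apply is_RInt_unique.
Qed.

Lemma CI_ext f g a b :
  (forall t, Rmin a b < t < Rmax a b -> f t = g t) -> CI f a b = CI g a b.
Proof. intros H. unfold CI. f_equal; apply RInt_ext; intros t Ht; now rewrite H. Qed.

Lemma exCI_ext f g a b :
  (forall t, Rmin a b < t < Rmax a b -> f t = g t) -> exCI f a b -> exCI g a b.
Proof.
  intros H [H1 H2].
  split; [apply (ex_RInt_ext (fun t => Re (f t)))|apply (ex_RInt_ext (fun t => Im (f t)))]; trivial;
    intros t Ht; now rewrite H.
Qed.

Lemma CI_plus f g a b : exCI f a b -> exCI g a b ->
  CI (fun t => f t + g t)%C a b = (CI f a b + CI g a b)%C.
Proof.
  intros [H1 H2] [H3 H4]. unfold CI, Cplus. simpl. f_equal.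
  - now apply (RInt_plus (V := R_CompleteNormedModule) (fun t => Re (f t)) (fun t => Re (g t))).
  - now apply (RInt_plus (V := R_CompleteNormedModule) (fun t => Im (f t)) (fun t => Im (g t))).
Qed.

Lemma exCI_plus f g a b : exCI f a b -> exCI g a b -> exCI (fun t => f t + g t)%C a b.
Proof.
  intros [H1 H2] [H3 H4]. split.
  - now apply (ex_RInt_plus (V := R_NormedModule) (fun t => Re (f t)) (fun t => Re (g t))).
  - now apply (ex_RInt_plus (V := R_NormedModule) (fun t => Im (f t)) (fun t => Im (g t))).
Qed.

Lemma ex_RInt_Rmult (p : R -> R) k a b : ex_RInt p a b -> ex_RInt (fun t => k * p t) a b.
Proof. intros H. now apply (ex_RInt_scal (V := R_NormedModule) p). Qed.

Lemma RInt_Rmult (p : R -> R) k a b :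
  ex_RInt p a b -> RInt (fun t => k * p t) a b = k * RInt p a b.
Proof. intros H. now apply (RInt_scal (V := R_CompleteNormedModule) p). Qed.

Lemma CI_scal (c : C) f a b : exCI f a b ->
  exCI (fun t => c * f t)%C a b /\ CI (fun t => c * f t)%C a b = (c * CI f a b)%C.
Proof.
  intros [H1 H2].
  assert (R1 := ex_RInt_Rmult _ (Re c) _ _ H1). assert (R2 := ex_RInt_Rmult _ (Im c) _ _ H1).
  assert (R3 := ex_RInt_Rmult _ (Re c) _ _ H2). assert (R4 := ex_RInt_Rmult _ (Im c) _ _ H2).
  split.
  - split.
    + apply (ex_RInt_minus (V := R_NormedModule) (fun t => Re c * Re (f t)) (fun t => Im c * Im (f t))); easy.
    + apply (ex_RInt_plus (V := R_NormedModule) (fun t => Re c * Im (f t)) (fun t => Im c * Re (f t))); easy.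
  - unfold CI, Cmult. simpl. f_equal.
    + rewrite <- (RInt_Rmult _ (fst c)), <- (RInt_Rmult _ (snd c)) by easy.
      apply (RInt_minus (V := R_CompleteNormedModule) (fun t => Re c * Re (f t)) (fun t => Im c * Im (f t))); easy.
    + rewrite <- (RInt_Rmult _ (fst c)), <- (RInt_Rmult _ (snd c)) by easy.
      apply (RInt_plus (V := R_CompleteNormedModule) (fun t => Re c * Im (f t)) (fun t => Im c * Re (f t))); easy.
Qed.

Lemma CI_minus f g a b : exCI f a b -> exCI g a b ->
  exCI (fun t => f t - g t)%C a b /\ CI (fun t => f t - g t)%C a b = (CI f a b - CI g a b)%C.
Proof.
  intros Hf Hg. destruct (CI_scal (-1) g a b Hg) as [H1 H2].
  split.
  - apply (exCI_ext (fun t => f t + (-1) * g t)%C); [intros; ring|now apply exCI_plus].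
  - rewrite (CI_ext _ (fun t => f t + (-1) * g t)%C) by (intros; ring).
    rewrite CI_plus, H2 by easy. ring.
Qed.

Lemma CI_Chasles f a b c : exCI f a b -> exCI f b c -> (CI f a b + CI f b c = CI f a c)%C.
Proof.
  intros [H1 H2] [H3 H4]. unfold CI, Cplus. simpl. f_equal.
  - now apply (RInt_Chasles (V := R_CompleteNormedModule) (fun t => Re (f t))).
  - now apply (RInt_Chasles (V := R_CompleteNormedModule) (fun t => Im (f t))).
Qed.

(** Estimating the two components separately would lose a factor, so the bound goes through the
    integral in the normed space [C]. *)
Lemma CI_norm f (g : R -> R) a b : a <= b -> exCI f a b -> ex_RInt g a b ->
  (forall t, a <= t <= b -> Cmod (f t) <= g t) -> Cmod (CI f a b) <= RInt g a b.
Proof.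
  intros Hab Hf Hg H. rewrite Cmod_norm.
  apply (norm_RInt_le (V := C_R_NormedModule) f g a b (CI f a b) (RInt g a b) Hab).
  - intros t Ht. change (norm (f t : C_R_NormedModule)) with (norm (f t : C_R_NormedModule)).
    rewrite <- Cmod_norm. now apply H.
  - now apply CI_correct.
  - now apply (RInt_correct (V := R_CompleteNormedModule)).
Qed.

Lemma CI_norm_const f M a b : a <= b -> exCI f a b ->
  (forall t, a <= t <= b -> Cmod (f t) <= M) -> Cmod (CI f a b) <= (b - a) * M.
Proof.
  intros Hab Hf H. replace ((b - a) * M) with (RInt (fun _ => M) a b).
  - apply CI_norm; trivial. apply ex_RInt_const.
  - rewrite RInt_const. reflexivity.
Qed.

Lemma CI_const c a b : CI (fun _ => c) a b = (RtoC (b - a) * c)%C.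
Proof.
  unfold CI. rewrite !RInt_const. unfold Cmult, RtoC. destruct c; simpl.
  unfold scal; simpl; unfold mult; simpl. f_equal; ring.
Qed.

Lemma exCI_const c a b : exCI (fun _ => c) a b.
Proof. split; apply ex_RInt_const. Qed.

(* [oint H a b c e] is the counterclockwise integral over the boundary of [a,b] x [c,e]. *)
Definition oint (H : C -> C) (a b c e : R) : C :=
  (CI (fun x => H (x, c)) a b + Ci * CI (fun y => H (b, y)) c e
   - CI (fun x => H (x, e)) a b - Ci * CI (fun y => H (a, y)) c e)%C.

(** Only boundary points are concerned, so that poles may lie inside. *)
Definition cont_rect (H : C -> C) (a b c e : R) : Prop :=
  forall x y, a <= x <= b -> c <= y <= e ->
    (x = a \/ x = b \/ y = c \/ y = e) -> continuous H ((x, y) : C).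

Lemma continuous_horizontal (H : C -> C) x y : continuous H ((x, y) : C) -> continuous (fun t : R => H (t, y)) x.
Proof.
  intros Hc. apply (continuous_comp (U := R_UniformSpace) (V := C_UniformSpace) (W := C_UniformSpace)
    (fun t => (t, y) : C) H x); [|exact Hc].
  apply continuous_Cpair; [apply continuous_id|apply continuous_const].
Qed.

Lemma continuous_vertical (H : C -> C) x y : continuous H ((x, y) : C) -> continuous (fun t : R => H (x, t)) y.
Proof.
  intros Hc. apply (continuous_comp (U := R_UniformSpace) (V := C_UniformSpace) (W := C_UniformSpace)
    (fun t => (x, t) : C) H y); [|exact Hc].
  apply continuous_Cpair; [apply continuous_const|apply continuous_id].
Qed.

Lemma exCI_horizontal (H : C -> C) a b y : a <= b ->
  (forall x, a <= x <= b -> continuous H ((x, y) : C)) -> exCI (fun x => H (x, y)) a b.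
Proof.
  intros Hab Hc. apply exCI_continuous. rewrite Rmin_left, Rmax_right by easy.
  intros t Ht. now apply continuous_horizontal, Hc.
Qed.

Lemma exCI_vertical (H : C -> C) x c e : c <= e ->
  (forall y, c <= y <= e -> continuous H ((x, y) : C)) -> exCI (fun y => H (x, y)) c e.
Proof.
  intros Hab Hc. apply exCI_continuous. rewrite Rmin_left, Rmax_right by easy.
  intros t Ht. now apply continuous_vertical, Hc.
Qed.

Lemma cont_rect_ex H a b c e : a <= b -> c <= e -> cont_rect H a b c e ->
  exCI (fun x => H (x, c)) a b /\ exCI (fun y => H (b, y)) c e /\
  exCI (fun x => H (x, e)) a b /\ exCI (fun y => H (a, y)) c e.
Proof.
  intros Hab Hce Hc. split; [|split; [|split]].
  - apply exCI_horizontal; trivial. intros; apply Hc; (lra || auto).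
  - apply exCI_vertical; trivial. intros; apply Hc; (lra || auto).
  - apply exCI_horizontal; trivial. intros; apply Hc; (lra || auto).
  - apply exCI_vertical; trivial. intros; apply Hc; (lra || auto).
Qed.

Lemma oint_plus F G a b c e : a <= b -> c <= e ->
  cont_rect F a b c e -> cont_rect G a b c e ->
  oint (fun z => F z + G z)%C a b c e = (oint F a b c e + oint G a b c e)%C.
Proof.
  intros Hab Hce HF HG.
  destruct (cont_rect_ex F a b c e Hab Hce HF) as (F1 & F2 & F3 & F4).
  destruct (cont_rect_ex G a b c e Hab Hce HG) as (G1 & G2 & G3 & G4).
  unfold oint.
  rewrite (CI_plus (fun x => F (x, c)) (fun x => G (x, c))) by easy.
  rewrite (CI_plus (fun x => F (x, e)) (fun x => G (x, e))) by easy.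
  rewrite (CI_plus (fun x => F (a, x)) (fun x => G (a, x))) by easy.
  rewrite (CI_plus (fun x => F (b, x)) (fun x => G (b, x))) by easy.
  ring.
Qed.

Lemma oint_scal k F a b c e : a <= b -> c <= e -> cont_rect F a b c e ->
  oint (fun z => k * F z)%C a b c e = (k * oint F a b c e)%C.
Proof.
  intros Hab Hce HF.
  destruct (cont_rect_ex F a b c e Hab Hce HF) as (F1 & F2 & F3 & F4).
  unfold oint.
  rewrite (proj2 (CI_scal k _ _ _ F1)), (proj2 (CI_scal k _ _ _ F2)),
          (proj2 (CI_scal k _ _ _ F3)), (proj2 (CI_scal k _ _ _ F4)).
  ring.
Qed.

Lemma oint_norm H M a b c e : a <= b -> c <= e -> cont_rect H a b c e ->
  (forall x y, a <= x <= b -> c <= y <= e ->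
     (x = a \/ x = b \/ y = c \/ y = e) -> Cmod (H (x, y)) <= M) ->
  Cmod (oint H a b c e) <= 2 * ((b - a) + (e - c)) * M.
Proof.
  intros Hab Hce Hc HM.
  destruct (cont_rect_ex H a b c e Hab Hce Hc) as (F1 & F2 & F3 & F4).
  assert (N1 : Cmod (CI (fun x => H (x, c)) a b) <= (b - a) * M)
    by (apply CI_norm_const; trivial; intros; apply HM; (lra || auto)).
  assert (N2 : Cmod (CI (fun x => H (b, x)) c e) <= (e - c) * M)
    by (apply CI_norm_const; trivial; intros; apply HM; (lra || auto)).
  assert (N3 : Cmod (CI (fun x => H (x, e)) a b) <= (b - a) * M)
    by (apply CI_norm_const; trivial; intros; apply HM; (lra || auto)).
  assert (N4 : Cmod (CI (fun x => H (a, x)) c e) <= (e - c) * M)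
    by (apply CI_norm_const; trivial; intros; apply HM; (lra || auto)).
  unfold oint, Cminus.
  eapply Rle_trans; [apply Cmod_triangle|]. rewrite Cmod_opp, Cmod_mult, Cmod_Ci.
  eapply Rle_trans; [apply Rplus_le_compat_r, Cmod_triangle|]. rewrite Cmod_opp.
  eapply Rle_trans; [apply Rplus_le_compat_r, Rplus_le_compat_r, Cmod_triangle|].
  rewrite Cmod_mult, Cmod_Ci. lra.
Qed.

Lemma oint_split_x H a m b c e : a <= m <= b -> c <= e ->
  cont_rect H a m c e -> cont_rect H m b c e ->
  oint H a b c e = (oint H a m c e + oint H m b c e)%C.
Proof.
  intros Hm Hce H1 H2.
  destruct (cont_rect_ex H a m c e (proj1 Hm) Hce H1) as (F1 & F2 & F3 & F4).
  destruct (cont_rect_ex H m b c e (proj2 Hm) Hce H2) as (G1 & G2 & G3 & G4).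
  unfold oint.
  rewrite <- (CI_Chasles _ _ _ _ F1 G1), <- (CI_Chasles _ _ _ _ F3 G3). ring.
Qed.

Lemma oint_split_y H a b c m e : a <= b -> c <= m <= e ->
  cont_rect H a b c m -> cont_rect H a b m e ->
  oint H a b c e = (oint H a b c m + oint H a b m e)%C.
Proof.
  intros Hab Hm H1 H2.
  destruct (cont_rect_ex H a b c m Hab (proj1 Hm) H1) as (F1 & F2 & F3 & F4).
  destruct (cont_rect_ex H a b m e Hab (proj2 Hm) H2) as (G1 & G2 & G3 & G4).
  unfold oint.
  rewrite <- (CI_Chasles _ _ _ _ F2 G2), <- (CI_Chasles _ _ _ _ F4 G4). ring.
Qed.

(** Affine functions are what Goursat's argument subtracts. Their integrals along the sides are
    elementary, which spares a theory of primitives along contours. *)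
Lemma oint_affine k l a b c e : oint (fun z => k + l * z)%C a b c e = 0%C.
Proof.
  assert (Hx : forall y a b, exCI (fun x : R => (x, y) : C) a b /\
    CI (fun x : R => (x, y) : C) a b = ((b ^ 2 - a ^ 2) / 2, (b - a) * y)).
  { clear. intros y a b. apply CI_unique.
    apply (is_RInt_fct_extend_pair (U := R_NormedModule) (V := R_NormedModule)); simpl fst; simpl snd.
    - replace ((b ^ 2 - a ^ 2) / 2) with (minus (b ^ 2 / 2) (a ^ 2 / 2))
        by (unfold minus, plus, opp; simpl; field).
      apply (is_RInt_derive (fun x => x ^ 2 / 2)); intros x _.
      + auto_derive; [easy|field].
      + apply continuous_id.
    - apply (is_RInt_const (V := R_NormedModule)). }
  assert (Hy : forall x c e, exCI (fun y : R => (x, y) : C) c e /\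
    CI (fun y : R => (x, y) : C) c e = ((e - c) * x, (e ^ 2 - c ^ 2) / 2)).
  { clear. intros x a b. apply CI_unique.
    apply (is_RInt_fct_extend_pair (U := R_NormedModule) (V := R_NormedModule)); simpl fst; simpl snd.
    - apply (is_RInt_const (V := R_NormedModule)).
    - replace ((b ^ 2 - a ^ 2) / 2) with (minus (b ^ 2 / 2) (a ^ 2 / 2))
        by (unfold minus, plus, opp; simpl; field).
      apply (is_RInt_derive (fun x => x ^ 2 / 2)); intros y _.
      + auto_derive; [easy|field].
      + apply continuous_id. }
  assert (Lx : forall y, CI (fun x => k + l * (x, y))%C a b
      = (RtoC (b - a) * k + l * (((b ^ 2 - a ^ 2) / 2)%R, ((b - a) * y)%R))%C).
  { intros y. destruct (Hx y a b) as [E1 E2].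
    destruct (CI_scal l _ _ _ E1) as [E3 E4].
    rewrite (CI_plus (fun _ => k) (fun x : R => l * (x, y))%C a b (exCI_const _ _ _) E3).
    rewrite (CI_const k), E4, E2. reflexivity. }
  assert (Ly : forall x, CI (fun y => k + l * (x, y))%C c e
      = (RtoC (e - c) * k + l * (((e - c) * x)%R, ((e ^ 2 - c ^ 2) / 2)%R))%C).
  { intros x. destruct (Hy x c e) as [E1 E2].
    destruct (CI_scal l _ _ _ E1) as [E3 E4].
    rewrite (CI_plus (fun _ => k) (fun y : R => l * (x, y))%C c e (exCI_const _ _ _) E3).
    rewrite (CI_const k), E4, E2. reflexivity. }
  unfold oint. rewrite !Lx, !Ly.
  assert (E : forall (B E X1 X2 X3 X4 : C), (X1 - X2 + Ci * (X3 - X4) = 0 ->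
    B * k + l * X1 + Ci * (E * k + l * X3) - (B * k + l * X2)
      - Ci * (E * k + l * X4) = 0)%C).
  { intros B E X1 X2 X3 X4 HX.
    transitivity (l * (X1 - X2 + Ci * (X3 - X4)))%C; [ring|rewrite HX; ring]. }
  apply E. clear.
  unfold Ci, Cminus, Cplus, Cmult, Copp, RtoC; cbn [fst snd]. f_equal; ring.
Qed.

Lemma Cmod_le_sum (x y : R) : Cmod (x, y) <= Rabs x + Rabs y.
Proof.
  replace ((x, y) : C) with (RtoC x + Ci * RtoC y)%C.
  - eapply Rle_trans; [apply Cmod_triangle|].
    rewrite Cmod_mult, Cmod_Ci, !Cmod_R. lra.
  - unfold Ci, Cplus, Cmult, RtoC; simpl. f_equal; ring.
Qed.

(** * Goursat's theorem by repeated bisection *)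

Definition holo_rect (H : C -> C) (a b c e : R) : Prop :=
  forall x y, a <= x <= b -> c <= y <= e -> exists l, Cder H (x, y) l.

Lemma holo_cont_rect H a b c e a' b' c' e' : holo_rect H a b c e ->
  a <= a' -> b' <= b -> c <= c' -> e' <= e -> cont_rect H a' b' c' e'.
Proof.
  intros Hh ? ? ? ? x y Hx Hy _. destruct (Hh x y) as [l Hl]; [lra|lra|].
  eapply Cder_continuous, Hl.
Qed.

(** The four quarter integrals add up to the whole, so one of them has at least a quarter of its
    modulus. The side lengths are recorded to control the diameter along the iteration. *)
Lemma oint_quarter H a b c e : a <= b -> c <= e -> holo_rect H a b c e ->
  exists a' b' c' e', a <= a' /\ a' <= b' /\ b' <= b /\ c <= c' /\ c' <= e' /\ e' <= e /\
    b' - a' = (b - a) / 2 /\ e' - c' = (e - c) / 2 /\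
    Cmod (oint H a b c e) / 4 <= Cmod (oint H a' b' c' e').
Proof.
  intros Hab Hce Hh.
  set (m := (a + b) / 2). set (n := (c + e) / 2).
  assert (Hm : a <= m <= b) by (unfold m; lra).
  assert (Hn : c <= n <= e) by (unfold n; lra).
  assert (E : oint H a b c e = (oint H a m c n + oint H a m n e + (oint H m b c n + oint H m b n e))%C).
  { rewrite (oint_split_x H a m b c e Hm Hce) by (eapply holo_cont_rect; [exact Hh|..]; lra).
    rewrite (oint_split_y H a m c n e) by (first [easy | eapply holo_cont_rect; [exact Hh|..]; lra]).
    rewrite (oint_split_y H m b c n e) by (first [easy | eapply holo_cont_rect; [exact Hh|..]; lra]).
    reflexivity. }
  pose proof (Cmod_triangle (oint H a m c n + oint H a m n e) (oint H m b c n + oint H m b n e)) as T1.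
  pose proof (Cmod_triangle (oint H a m c n) (oint H a m n e)) as T2.
  pose proof (Cmod_triangle (oint H m b c n) (oint H m b n e)) as T3.
  rewrite <- E in T1. clear E.
  destruct (Rle_dec (Cmod (oint H a b c e) / 4) (Cmod (oint H a m c n))) as [L|L1].
  { exists a, m, c, n. unfold m, n in *. repeat split; lra. }
  destruct (Rle_dec (Cmod (oint H a b c e) / 4) (Cmod (oint H a m n e))) as [L|L2].
  { exists a, m, n, e. unfold m, n in *. repeat split; lra. }
  destruct (Rle_dec (Cmod (oint H a b c e) / 4) (Cmod (oint H m b c n))) as [L|L3].
  { exists m, b, c, n. unfold m, n in *. repeat split; lra. }
  exists m, b, n, e. unfold m, n in *. repeat split; lra.
Qed.

Lemma nested_intervals (u v : nat -> R) :
  (forall k, u k <= u (S k)) -> (forall k, v (S k) <= v k) -> (forall k, u k <= v k) ->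
  exists p, forall k, u k <= p <= v k.
Proof.
  intros Hu Hv Huv.
  assert (Mu : forall k j, u k <= u (k + j)%nat).
  { intros k j. induction j; [rewrite Nat.add_0_r; lra|].
    rewrite Nat.add_succ_r. specialize (Hu (k + j)%nat). lra. }
  assert (Mv : forall k j, v (k + j)%nat <= v k).
  { intros k j. induction j; [rewrite Nat.add_0_r; lra|].
    rewrite Nat.add_succ_r. specialize (Hv (k + j)%nat). lra. }
  assert (B : forall i k, u i <= v k).
  { intros i k. specialize (Mu i k). specialize (Mv k i). rewrite Nat.add_comm in Mv.
    specialize (Huv (i + k)%nat). lra. }
  destruct (completeness (fun r => exists k, r = u k)) as [p [P1 P2]].
  - exists (v 0%nat). intros r [k ->]. apply B.
  - exists (u 0%nat). now exists 0%nat.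
  - exists p. intros k. split.
    + apply P1. now exists k.
    + apply P2. intros r [i ->]. apply B.
Qed.

(** If the integral had modulus [eta > 0], bisection would give rectangles of size [L / 2 ^ k] with
    integral at least [eta / 4 ^ k]. Near the common point the tangent part integrates to zero and
    the rest is at most [eps] times the distance, so perimeter times maximum gives
    [2 * L ^ 2 * eps / 4 ^ k], which is too small. *)
Theorem goursat H a b c e : a <= b -> c <= e -> holo_rect H a b c e -> oint H a b c e = 0%C.
Proof.
  intros Hab Hce Hh.
  apply Cmod_eq_0. apply Rle_antisym; [|apply Cmod_ge_0].
  apply Rnot_lt_le. intros Hpos. set (eta := Cmod (oint H a b c e)) in *.
  set (good := fun q : (R * R) * (R * R) =>
    a <= fst (fst q) /\ fst (fst q) <= snd (fst q) /\ snd (fst q) <= b /\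
    c <= fst (snd q) /\ fst (snd q) <= snd (snd q) /\ snd (snd q) <= e).
  set (I := fun q : (R * R) * (R * R) => oint H (fst (fst q)) (snd (fst q)) (fst (snd q)) (snd (snd q))).
  set (rel := fun q q' : (R * R) * (R * R) =>
    fst (fst q) <= fst (fst q') /\ snd (fst q') <= snd (fst q) /\
    fst (snd q) <= fst (snd q') /\ snd (snd q') <= snd (snd q) /\
    snd (fst q') - fst (fst q') = (snd (fst q) - fst (fst q)) / 2 /\
    snd (snd q') - fst (snd q') = (snd (snd q) - fst (snd q)) / 2 /\
    Cmod (I q) / 4 <= Cmod (I q')).
  (* The quarter is only known to exist. Carrying [good] in a subset type makes the relation total,
     so that choice yields an iterable function. *)
  assert (Step : forall q : {q | good q}, exists q' : {q | good q}, rel (proj1_sig q) (proj1_sig q')).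
  { intros [[[a1 b1] [c1 e1]] (G1 & G2 & G3 & G4 & G5 & G6)]; simpl in *.
    destruct (oint_quarter H a1 b1 c1 e1) as (a2 & b2 & c2 & e2 & ? & ? & ? & ? & ? & ? & ? & ? & ?);
      trivial.
    - intros x y Hx Hy. apply Hh; lra.
    - assert (G : good ((a2, b2), (c2, e2))) by (unfold good; simpl; lra).
      exists (exist _ _ G). unfold rel; simpl. repeat split; trivial. }
  destruct (functional_choice _ Step) as [next Hnext].
  assert (G0 : good ((a, b), (c, e))) by (unfold good; simpl; lra).
  set (Q := fix Q k := match k with O => exist good _ G0 | S j => next (Q j) end).
  set (q := fun k => proj1_sig (Q k)).
  assert (Hg : forall k, good (q k)) by (intros k; apply (proj2_sig (Q k))).
  assert (Hr : forall k, rel (q k) (q (S k))) by (intros k; apply (Hnext (Q k))).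
  assert (Hw : forall k, snd (fst (q k)) - fst (fst (q k)) = (b - a) / 2 ^ k /\
                    snd (snd (q k)) - fst (snd (q k)) = (e - c) / 2 ^ k /\
                    eta / 4 ^ k <= Cmod (I (q k))).
  { induction k as [|k (I1 & I2 & I3)].
    - simpl. unfold I, eta; simpl. repeat split; lra.
    - destruct (Hr k) as (_ & _ & _ & _ & R1 & R2 & R3).
      rewrite R1, R2, I1, I2. simpl pow.
      assert (0 < 2 ^ k) by (apply pow_lt; lra). assert (0 < 4 ^ k) by (apply pow_lt; lra).
      repeat split; try (field; lra).
      replace (eta / (4 * 4 ^ k)) with (eta / 4 ^ k / 4) by (field; lra). lra. }
  destruct (nested_intervals (fun k => fst (fst (q k))) (fun k => snd (fst (q k)))) as [x Hx];
    [intros k; apply (Hr k)..|intros k; apply (Hg k)|].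
  destruct (nested_intervals (fun k => fst (snd (q k))) (fun k => snd (snd (q k)))) as [y Hy];
    [intros k; apply (Hr k)..|intros k; apply (Hg k)|].
  destruct (Hh x y) as [l Hl]; [apply (Hx 0%nat)|apply (Hy 0%nat)|].
  destruct Hl as (phi & Cphi & Pphi & dl & Hdl & Hphi).
  set (L := b - a + (e - c)).
  assert (HL : 0 <= L) by (unfold L; lra).
  (* Makes [2 * L ^ 2 * eps < eta]; the [1] keeps the quotient meaningful when [L = 0]. *)
  set (eps := eta / (4 * L ^ 2 + 1)).
  assert (Hden : 0 < 4 * L ^ 2 + 1) by nra.
  assert (Heps : 0 < eps) by (apply Rdiv_lt_0_compat; trivial).
  apply continuous_C_eps with (eps := eps) in Cphi; [|easy].
  destruct Cphi as (d2 & Hd2 & Hphi2).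
  assert (Hk : exists k, L / 2 ^ k < Rmin dl d2).
  { destruct (pow_lt_1_zero (/ 2)) with (y := Rmin dl d2 / (L + 1)) as [k Hk].
    - rewrite Rabs_pos_eq; lra.
    - apply Rdiv_lt_0_compat; [now apply Rmin_pos|lra].
    - exists k. specialize (Hk k (Nat.le_refl _)).
      assert (0 < 2 ^ k) by (apply pow_lt; lra).
      rewrite pow_inv in Hk. rewrite Rabs_pos_eq in Hk by (left; now apply Rinv_0_lt_compat).
      apply (Rmult_lt_compat_l (L + 1)) in Hk; [|lra].
      replace ((L + 1) * (Rmin dl d2 / (L + 1))) with (Rmin dl d2) in Hk by (field; lra).
      unfold Rdiv. assert (0 < / 2 ^ k) by (now apply Rinv_0_lt_compat). nra. }
  destruct Hk as [k Hk].
  destruct (Hw k) as (W1 & W2 & W3). destruct (Hg k) as (G1 & G2 & G3 & G4 & G5 & G6).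
  specialize (Hx k). specialize (Hy k). unfold I in W3.
  set (a1 := fst (fst (q k))) in *. set (b1 := snd (fst (q k))) in *.
  set (c1 := fst (snd (q k))) in *. set (e1 := snd (snd (q k))) in *.
  set (z := (x, y) : C).
  assert (P2 : 0 < 2 ^ k) by (apply pow_lt; lra).
  assert (Hdist : forall s t, a1 <= s <= b1 -> c1 <= t <= e1 -> Cmod ((s, t) - z) <= L / 2 ^ k).
  { intros s t Hs Ht. replace ((s, t) - z)%C with ((s - x, t - y) : C)
      by (unfold z, Cminus, Cplus, Copp; simpl; f_equal; ring).
    eapply Rle_trans; [apply Cmod_le_sum|].
    assert (Rabs (s - x) <= b1 - a1) by (apply Rabs_le; lra).
    assert (Rabs (t - y) <= e1 - c1) by (apply Rabs_le; lra).
    replace (L / 2 ^ k) with ((b - a) / 2 ^ k + (e - c) / 2 ^ k) by (unfold L; field; lra). lra. }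
  assert (Hc : cont_rect H a1 b1 c1 e1) by (eapply holo_cont_rect; [exact Hh|..]; lra).
  (* Minus the tangent of [H] at [z]: adding it leaves the contour integral unchanged and turns
     [H w] into [(phi w - phi z) * (w - z)]. *)
  set (lin := fun w : C => (- (H z - phi z * z) + - phi z * w)%C).
  assert (Hlin : cont_rect lin a1 b1 c1 e1).
  { intros s t _ _ _. apply continuous_Cplus; [apply continuous_Cconst|].
    apply continuous_Cmult; [apply continuous_Cconst|apply continuous_Cid]. }
  assert (E : oint H a1 b1 c1 e1 = oint (fun w => H w + lin w)%C a1 b1 c1 e1).
  { rewrite oint_plus by trivial. unfold lin at 1. rewrite oint_affine. ring. }
  rewrite E in W3.
  assert (N : Cmod (oint (fun w => H w + lin w)%C a1 b1 c1 e1)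
     <= 2 * ((b1 - a1) + (e1 - c1)) * (eps * (L / 2 ^ k))).
  { apply oint_norm; trivial.
    - intros s t Hs Ht Hb. apply continuous_Cplus; [now apply Hc|].
      apply continuous_Cplus; [apply continuous_Cconst|].
      apply continuous_Cmult; [apply continuous_Cconst|apply continuous_Cid].
    - intros s t Hs Ht _. specialize (Hdist s t Hs Ht).
      assert (Hd1 : Cmod ((s, t) - z) < dl)
        by (eapply Rle_lt_trans; [exact Hdist|exact (Rmin_lt_l _ _ _ Hk)]).
      assert (Hd3 : Cmod ((s, t) - z) < d2)
        by (eapply Rle_lt_trans; [exact Hdist|exact (Rmin_lt_r _ _ _ Hk)]).
      rewrite (Hphi (s, t)) by exact Hd1. unfold lin.
      replace (H (x, y) + phi (s, t) * ((s, t) - (x, y)) + (- (H z - phi z * z) + - phi z * (s, t)))%C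
        with ((phi (s, t) - phi z) * ((s, t) - z))%C by (unfold z; ring).
      rewrite Cmod_mult. apply Rmult_le_compat; try apply Cmod_ge_0; trivial.
      left. now apply Hphi2. }
  rewrite W1, W2 in N.
  replace (2 * ((b - a) / 2 ^ k + (e - c) / 2 ^ k) * (eps * (L / 2 ^ k)))
    with (2 * L ^ 2 * eps / 4 ^ k) in N.
  2:{ replace (4 ^ k) with (2 ^ k * 2 ^ k) by (rewrite <- Rpow_mult_distr; f_equal; lra).
      unfold L. field. lra. }
  assert (P4 : 0 < 4 ^ k) by (apply pow_lt; lra).
  assert (Hle : eta / 4 ^ k <= 2 * L ^ 2 * eps / 4 ^ k) by lra.
  apply Rmult_le_reg_r in Hle; [|now apply Rinv_0_lt_compat].
  assert (eps * (4 * L ^ 2 + 1) = eta) by (unfold eps; field; lra).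
  nra.
Qed.

(** * The residue theorem for simple poles on the real axis *)

Lemma sum_sq_neq_0 u eps : 0 < eps -> u ^ 2 + eps ^ 2 <> 0.
Proof.
  intros He. apply Rgt_not_eq. pose proof (pow2_ge_0 u). pose proof (pow_lt eps 2 He). lra.
Qed.

(** The value is the angle under which a side of the square is seen from its centre. *)
Lemma RInt_poisson_square p eps : 0 < eps ->
  is_RInt (fun x => eps / ((x - p) ^ 2 + eps ^ 2)) (p - eps) (p + eps) (PI / 2).
Proof.
  intros He.
  replace (PI / 2) with (minus (atan ((p + eps - p) / eps)) (atan ((p - eps - p) / eps))).
  2:{ unfold minus, plus, opp; simpl.
      replace ((p + eps - p) / eps) with 1 by (field; lra).
      replace ((p - eps - p) / eps) with (- (1)) by (field; lra).
      rewrite atan_opp, atan_1. field. }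
  apply (is_RInt_derive (fun x => atan ((x - p) / eps))); intros x _.
  - auto_derive; [trivial|]. field. split; [now apply sum_sq_neq_0|lra].
  - apply (ex_derive_continuous (fun x => eps / ((x - p) ^ 2 + eps ^ 2))).
    auto_derive. now apply sum_sq_neq_0.
Qed.

Lemma RC_neq (p x y : R) : x <> p \/ y <> 0 -> ((x, y) - RtoC p)%C <> 0%C.
Proof.
  intros H E. injection E. unfold RtoC; simpl. intros E1 E2. destruct H; lra.
Qed.

Lemma Cder_cauchy_kernel (p : R) (z : C) : (z - RtoC p)%C <> 0%C ->
  exists l, Cder (fun w => / (w - RtoC p))%C z l.
Proof.
  intros Hz. eexists. apply (Cder_inv (fun w => w - RtoC p)%C); [|exact Hz].
  apply Cder_minus; [apply Cder_id|apply Cder_const].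
Qed.

(** Each side contributes [Ci * (PI / 2)]. The remaining parts [A1] and [A2] occur with opposite
    signs on opposite sides, so they cancel and are never evaluated. *)
Lemma oint_cauchy_square p eps : 0 < eps ->
  oint (fun z => / (z - RtoC p))%C (p - eps) (p + eps) (- eps) eps = (2 * PI * Ci)%C.
Proof.
  intros He.
  pose proof (RInt_poisson_square p eps He) as B1.
  pose proof (RInt_poisson_square 0 eps He) as B2.
  replace (0 - eps) with (- eps) in B2 by ring. replace (0 + eps) with eps in B2 by ring.
  assert (X2 := ex_intro (is_RInt (V := R_NormedModule) _ _ _) _ B2).
  apply (is_RInt_unique (V := R_CompleteNormedModule)) in B1, B2.
  set (A1 := RInt (fun x => (x - p) / ((x - p) ^ 2 + eps ^ 2)) (p - eps) (p + eps)).
  set (A2 := RInt (fun x => x / (x ^ 2 + eps ^ 2)) (- eps) eps).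
  assert (E : forall x y : R, (x, y) <> (p, 0) ->
    (/ ((x, y) - RtoC p))%C = ((x - p) / ((x - p) ^ 2 + y ^ 2), - y / ((x - p) ^ 2 + y ^ 2))).
  { intros x y H. unfold Cinv, Cminus, Cplus, Copp, RtoC; simpl.
    replace (x + - p) with (x - p) by ring. replace (y + - 0) with y by ring. reflexivity. }
  assert (C1 : CI (fun x => / ((x, (- eps)%R) - RtoC p))%C (p - eps) (p + eps) = (A1, PI / 2)).
  { rewrite (CI_ext _ (fun x => ((x - p) / ((x - p) ^ 2 + eps ^ 2), eps / ((x - p) ^ 2 + eps ^ 2)))).
    - unfold CI, Re, Im; cbn [fst snd]. now rewrite B1.
    - intros x _. rewrite E by (intros [= _ ?]; lra). f_equal; f_equal; try ring; f_equal; ring. }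
  assert (C2 : CI (fun x => / ((x, eps) - RtoC p))%C (p - eps) (p + eps) = (A1, - (PI / 2))).
  { rewrite (CI_ext _ (fun x => ((x - p) / ((x - p) ^ 2 + eps ^ 2), - 1 * (eps / ((x - p) ^ 2 + eps ^ 2))))).
    - unfold CI, Re, Im; cbn [fst snd]. rewrite RInt_Rmult.
      + rewrite B1. f_equal. ring.
      + eexists. now apply RInt_poisson_square.
    - intros x _. rewrite E by (intros [= _ ?]; lra). f_equal. field. now apply sum_sq_neq_0. }
  assert (C3 : CI (fun y => / ((p + eps, y)%R - RtoC p))%C (- eps) eps = (PI / 2, - A2)).
  { rewrite (CI_ext _ (fun y => (eps / ((y - 0) ^ 2 + eps ^ 2), - 1 * (y / (y ^ 2 + eps ^ 2))))).
    - unfold CI, Re, Im; cbn [fst snd]. rewrite B2. rewrite RInt_Rmult.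
      + f_equal. fold A2. ring.
      + apply (ex_RInt_continuous (V := R_CompleteNormedModule)). intros z _.
        apply (ex_derive_continuous (fun y => y / (y ^ 2 + eps ^ 2))). auto_derive. now apply sum_sq_neq_0.
    - intros x _. rewrite E by (intros [= ? _]; lra).
      f_equal; field; repeat split; intros Hz; apply (sum_sq_neq_0 x eps He); rewrite <- Hz; ring. }
  assert (C4 : CI (fun y => / ((p - eps, y)%R - RtoC p))%C (- eps) eps = (- (PI / 2), - A2)).
  { rewrite (CI_ext _ (fun y => (- 1 * (eps / ((y - 0) ^ 2 + eps ^ 2)), - 1 * (y / (y ^ 2 + eps ^ 2))))).
    - unfold CI, Re, Im; cbn [fst snd]. rewrite !RInt_Rmult.
      + f_equal; [rewrite B2; ring|]. fold A2. ring.
      + apply (ex_RInt_continuous (V := R_CompleteNormedModule)). intros z _.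
        apply (ex_derive_continuous (fun y => y / (y ^ 2 + eps ^ 2))). auto_derive. now apply sum_sq_neq_0.
      + exact X2.
    - intros x _. rewrite E by (intros [= ? _]; lra).
      f_equal; field; repeat split; intros Hz; apply (sum_sq_neq_0 x eps He); rewrite <- Hz; ring. }
  unfold oint. rewrite C1, C2, C3, C4.
  unfold Ci, Cminus, Cplus, Cmult, Copp, RtoC; cbn [fst snd]. f_equal; field.
Qed.

Lemma Cminus_eq_0 (u v : C) : (u - v = 0 -> u = v)%C.
Proof. intros E. replace u with (u - v + v)%C by ring. rewrite E. ring. Qed.

(** All singularities of the interpolation kernel are real, so a list of abscissas and rectangles
    symmetric about the real axis suffice. *)
Definition holo_off (H : C -> C) (l : list R) (a b y : R) : Prop :=
  forall x t, a <= x <= b -> - y <= t <= y -> (t = 0 -> ~ In x l) -> exists m, Cder H (x, t) m.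

(* [H] has at most a simple pole at [p], of residue [r]. *)
Definition simple_pole (H : C -> C) (p : R) (r : C) : Prop :=
  forall eps, 0 < eps -> exists delta, 0 < delta /\
    forall w : C, w <> RtoC p -> Cmod (w - RtoC p) < delta -> Cmod ((w - RtoC p) * H w - r) <= eps.

(** When a rectangle is cut at a pole, both pieces keep the list of the other poles; the value [0]
    discards those that fall outside a piece. *)
Definition inside (a b q : R) (r : C) : C :=
  if Rlt_dec a q then if Rlt_dec q b then r else 0%C else 0%C.

Definition sum_inside (l : list R) (r : R -> C) (a b : R) : C :=
  fold_right (fun q s => inside a b q (r q) + s)%C 0%C l.

Lemma sum_inside_split l r a b s t : a < s -> s < t -> t < b ->
  (forall q, In q l -> q < s \/ t < q) ->
  (sum_inside l r a s + sum_inside l r t b = sum_inside l r a b)%C.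
Proof.
  intros Has Hst Htb. induction l as [|q l IH]; intros Hl; simpl.
  - ring.
  - rewrite <- IH by (intros u Hu; apply Hl; now right).
    destruct (Hl q (or_introl eq_refl)); unfold inside;
      repeat destruct Rlt_dec; try lra; ring.
Qed.

Lemma isolate_radius (l : list R) (p M : R) : ~ In p l -> 0 < M ->
  exists eps, 0 < eps /\ eps <= M /\ forall q, In q l -> q < p - eps \/ p + eps < q.
Proof.
  intros Hp HM. induction l as [|q l IH].
  - exists M. repeat split; try lra. intros q [].
  - destruct IH as (e & He & HeM & Hl); [intros Hi; apply Hp; now right|].
    assert (Hqp : q <> p) by (intros ->; apply Hp; now left).
    assert (Hd : 0 < Rabs (q - p)) by (apply Rabs_pos_lt; lra).
    exists (Rmin e (Rabs (q - p) / 2)). split; [apply Rmin_pos; lra|].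
    pose proof (Rmin_l e (Rabs (q - p) / 2)). pose proof (Rmin_r e (Rabs (q - p) / 2)).
    split; [lra|].
    intros u [<-|Hu]; [|destruct (Hl u Hu); lra].
    unfold Rabs in *. destruct Rcase_abs; lra.
Qed.

(** Subtract [r / (z - p)], whose integral is exactly [2 * PI * Ci * r]. On the boundary
    [eps <= Cmod (z - p) <= 2 * eps], so the difference is at most [eps0 / 8 / eps] there, and the
    perimeter is [8 * eps]. *)
Lemma oint_small_square H p r eps0 : simple_pole H p r ->
  0 < eps0 -> exists delta, 0 < delta /\ forall eps, 0 < eps -> eps <= delta ->
    cont_rect H (p - eps) (p + eps) (- eps) eps ->
    Cmod (oint H (p - eps) (p + eps) (- eps) eps - 2 * PI * Ci * r) <= eps0.
Proof.
  intros Hp H0. destruct (Hp (eps0 / 8)) as (d & Hd & Hw); [lra|].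
  exists (d / 3). split; [lra|]. intros eps He Hed Hc.
  assert (Hk : cont_rect (fun z => - r * / (z - RtoC p))%C (p - eps) (p + eps) (- eps) eps).
  { intros x y Hx Hy Hb. apply continuous_Cmult; [apply continuous_Cconst|].
    destruct (Cder_cauchy_kernel p (x, y)) as [l Hl].
    - apply RC_neq. destruct Hb as [|[|[|]]]; [left|left|right|right]; lra.
    - eapply Cder_continuous, Hl. }
  replace (oint H (p - eps) (p + eps) (- eps) eps - 2 * PI * Ci * r)%C
    with (oint (fun z => H z + - r * / (z - RtoC p))%C (p - eps) (p + eps) (- eps) eps).
  2:{ rewrite oint_plus by (trivial; lra).
      rewrite (oint_scal (- r) (fun z => / (z - RtoC p))%C), oint_cauchy_square; try lra; [ring|].
      intros x y Hx Hy Hb. destruct (Cder_cauchy_kernel p (x, y)) as [l Hl].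
      - apply RC_neq. destruct Hb as [|[|[|]]]; [left|left|right|right]; lra.
      - eapply Cder_continuous, Hl. }
  replace eps0 with (2 * ((p + eps - (p - eps)) + (eps - - eps)) * (eps0 / 8 / eps)) by (field; lra).
  apply oint_norm; try lra.
  - intros x y Hx Hy Hb. apply continuous_Cplus; [now apply Hc|now apply Hk].
  - intros x y Hx Hy Hb.
    assert (Hn : ((x, y) - RtoC p)%C <> 0%C)
      by (apply RC_neq; destruct Hb as [|[|[|]]]; [left|left|right|right]; lra).
    assert (Hlow : eps <= Cmod ((x, y) - RtoC p)).
    { replace ((x, y) - RtoC p)%C with ((x - p, y) : C)
        by (unfold Cminus, Cplus, Copp, RtoC; simpl; f_equal; ring).
      pose proof (Rmax_Cmod (x - p, y)) as HM. simpl in HM.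
      eapply Rle_trans; [|exact HM].
      destruct Hb as [->|[->|[->| ->]]].
      - eapply Rle_trans; [|apply Rmax_l]. rewrite Rabs_left; lra.
      - eapply Rle_trans; [|apply Rmax_l]. rewrite Rabs_right; lra.
      - eapply Rle_trans; [|apply Rmax_r]. rewrite Rabs_left; lra.
      - eapply Rle_trans; [|apply Rmax_r]. rewrite Rabs_right; lra. }
    assert (Hup : Cmod ((x, y) - RtoC p) < d).
    { replace ((x, y) - RtoC p)%C with ((x - p, y) : C)
        by (unfold Cminus, Cplus, Copp, RtoC; simpl; f_equal; ring).
      eapply Rle_lt_trans; [apply Cmod_le_sum|].
      assert (Rabs (x - p) <= eps) by (apply Rabs_le; lra).
      assert (Rabs y <= eps) by (apply Rabs_le; lra). lra. }
    specialize (Hw (x, y)). set (u := ((x, y) - RtoC p)%C) in *.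
    replace (H (x, y) + - r * / u)%C with ((u * H (x, y) - r) / u)%C by (field; trivial).
    rewrite Cmod_div by trivial.
    assert (Hw' : Cmod (u * H (x, y) - r) <= eps0 / 8).
    { apply Hw; [|exact Hup]. intros E. apply Hn. unfold u. rewrite E. ring. }
    apply Rmult_le_compat; try apply Cmod_ge_0; trivial.
    + left. apply Rinv_0_lt_compat. lra.
    + apply Rinv_le_contravar; lra.
Qed.

Lemma holo_off_cont H l a b y a' b' c' e' : holo_off H l a b y ->
  a <= a' -> b' <= b -> - y <= c' -> e' <= y ->
  (forall x t, a' <= x <= b' -> c' <= t <= e' -> (x = a' \/ x = b' \/ t = c' \/ t = e') -> t = 0 -> ~ In x l) ->
  cont_rect H a' b' c' e'.
Proof.
  intros Hh ? ? ? ? Hn x t Hx Ht Hb. destruct (Hh x t) as [m Hm]; [lra|lra| |].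
  - now apply Hn.
  eapply Cder_continuous, Hm.
Qed.

(** Induction on the poles, for all rectangles at once. Two vertical cuts isolate [p] in a narrow
    strip that contains no other pole; the induction hypothesis treats what lies left and right of
    it, Goursat the parts of the strip above and below a small square around [p]. *)
Theorem residue_theorem H r l a b y : a < b -> 0 < y -> NoDup l ->
  ~ In a l -> ~ In b l -> holo_off H l a b y ->
  (forall p, In p l -> simple_pole H p (r p)) ->
  oint H a b (- y) y = (2 * PI * Ci * sum_inside l r a b)%C.
Proof.
  intros Hab Hy Hnd. revert a b Hab. induction l as [|p l IH]; intros a b Hab Ha Hb Hh Hr.
  { simpl. rewrite goursat; [ring|lra|lra|].
    intros x t Hx Ht. apply Hh; [exact Hx|exact Ht|intros _ []]. }
  inversion_clear Hnd as [|? ? Hpl Hnd'].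
  assert (Ha' : ~ In a l) by (intros Hi; apply Ha; now right).
  assert (Hb' : ~ In b l) by (intros Hi; apply Hb; now right).
  assert (Hr' : forall q, In q l -> simple_pole H q (r q)) by (intros q Hq; apply Hr; now right).
  assert (Hpa : p <> a) by (intros ->; apply Ha; now left).
  assert (Hpb : p <> b) by (intros ->; apply Hb; now left).
  assert (Hsub : forall a1 b1, a <= a1 -> b1 <= b -> (b1 < p \/ p < a1) -> holo_off H l a1 b1 y).
  { intros a1 b1 H1 H2 Hp x t Hx Ht Hi. apply Hh; [lra|lra|].
    intros Ht0 [E|Hxl]; [lra|]. now apply (Hi Ht0). }
  simpl. unfold inside.
  destruct (Rlt_dec a p) as [Hap|]; [destruct (Rlt_dec p b) as [Hbp|]|].
  (* As [p] differs from [a] and [b], it lies strictly outside here, and [H] is regular off the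
     shorter list. *)
  2,3: rewrite (IH Hnd' a b) by (trivial; apply Hsub; lra); ring.
  (* A simple pole determines the integral over a small square only up to an error, so the equality
     is shown up to every [eps0]. *)
  apply Cminus_eq_0. apply Cmod_eq_0. apply Rle_antisym; [|apply Cmod_ge_0].
  apply le_epsilon. intros eps0 H0. rewrite Rplus_0_l.
  destruct (oint_small_square H p (r p) eps0 (Hr p (or_introl eq_refl)) H0) as (d & Hd & Hsq).
  destruct (isolate_radius l p (Rmin d (Rmin (y / 2) (Rmin ((p - a) / 2) ((b - p) / 2)))))
    as (eps & He & HeM & Hiso); [easy|repeat apply Rmin_pos; lra|].
  assert (Hed : eps <= d) by (eapply Rle_trans; [exact HeM|apply Rmin_l]).
  apply (fun HH => Rle_trans _ _ _ HH (Rmin_r _ _)) in HeM.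
  assert (Hey : eps <= y / 2) by (eapply Rle_trans; [exact HeM|apply Rmin_l]).
  apply (fun HH => Rle_trans _ _ _ HH (Rmin_r _ _)) in HeM.
  assert (Hea : eps <= (p - a) / 2) by (eapply Rle_trans; [exact HeM|apply Rmin_l]).
  assert (Heb : eps <= (b - p) / 2) by (eapply Rle_trans; [exact HeM|apply Rmin_r]).
  assert (Hnear : forall x, p - eps <= x <= p + eps -> x <> p -> ~ In x (p :: l)).
  { intros x Hx Hxp [E|Hi]; [lra|]. destruct (Hiso x Hi); lra. }
  assert (Hc : forall a1 b1 c1 e1, a <= a1 -> b1 <= b -> - y <= c1 -> e1 <= y -> a1 <= b1 ->
      (a1 = a \/ p - eps <= a1 <= p + eps /\ a1 <> p) -> (b1 = b \/ p - eps <= b1 <= p + eps /\ b1 <> p) ->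
      c1 <> 0 -> e1 <> 0 -> cont_rect H a1 b1 c1 e1).
  { intros a1 b1 c1 e1 ? ? ? ? ? H1 H2 ? ?. eapply holo_off_cont; [exact Hh|lra..|].
    intros x t Hx Ht [->|[->|[->| ->]]] Ht0; try easy.
    - destruct H1 as [->|H1]; [exact Ha|now apply Hnear].
    - destruct H2 as [->|H2]; [exact Hb|now apply Hnear]. }
  rewrite (oint_split_x H a (p - eps) b) by (first [lra | apply Hc; lra]).
  rewrite (oint_split_x H (p - eps) (p + eps) b) by (first [lra | apply Hc; lra]).
  rewrite (oint_split_y H (p - eps) (p + eps) (- y) (- eps) y) by (first [lra | apply Hc; lra]).
  rewrite (oint_split_y H (p - eps) (p + eps) (- eps) eps y) by (first [lra | apply Hc; lra]).
  rewrite (goursat H (p - eps) (p + eps) (- y) (- eps)); [|lra|lra|].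
  2:{ intros x t Hx Ht. apply Hh; [lra|lra|]. intros; lra. }
  rewrite (goursat H (p - eps) (p + eps) eps y); [|lra|lra|].
  2:{ intros x t Hx Ht. apply Hh; [lra|lra|]. intros; lra. }
  rewrite (IH Hnd' a (p - eps)); trivial; [|lra| |apply Hsub; lra].
  2:{ intros Hi. destruct (Hiso _ Hi); lra. }
  rewrite (IH Hnd' (p + eps) b); trivial; [|lra| |apply Hsub; lra].
  2:{ intros Hi. destruct (Hiso _ Hi); lra. }
  rewrite <- (sum_inside_split l r a b (p - eps) (p + eps)) by (trivial; lra).
  match goal with |- Cmod ?X <= _ =>
    replace X with (oint H (p - eps) (p + eps) (- eps) eps - 2 * PI * Ci * r p)%C by ring end.
  apply Hsq; [lra..|apply Hc; lra].
Qed.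

(** * Exchange of integrals for continuous kernels *)

Definition cont2 (k : R -> R -> R) : Prop := forall x s, continuity_2d_pt k x s.

Lemma cont2_l k s x : cont2 k -> continuous (fun u => k u s) x.
Proof.
  intros H. specialize (H x s). apply continuity_2d_pt_filterlim in H.
  apply (continuous_comp_2 (U := R_UniformSpace) (V := R_UniformSpace) (W := R_UniformSpace)
    (X := R_UniformSpace) (fun u => u) (fun _ => s) k);
    [apply continuous_id|apply continuous_const|exact H].
Qed.

Lemma cont2_r k x s : cont2 k -> continuous (fun u => k x u) s.
Proof.
  intros H. specialize (H x s). apply continuity_2d_pt_filterlim in H.
  apply (continuous_comp_2 (U := R_UniformSpace) (V := R_UniformSpace) (W := R_UniformSpace)
    (X := R_UniformSpace) (fun _ => x) (fun u => u) k);
    [apply continuous_const|apply continuous_id|exact H].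
Qed.

Lemma cont2_swap k : cont2 k -> cont2 (fun s x => k x s).
Proof.
  intros H s x eps. destruct (H x s eps) as [d Hd]. exists d. intros u v Hu Hv. now apply Hd.
Qed.

Lemma ex_RInt_cont2_r k x a b : cont2 k -> ex_RInt (fun s => k x s) a b.
Proof.
  intros H. apply (ex_RInt_continuous (V := R_CompleteNormedModule)). intros t _. now apply cont2_r.
Qed.

Lemma ex_RInt_cont2_l k s a b : cont2 k -> ex_RInt (fun x => k x s) a b.
Proof.
  intros H. apply (ex_RInt_continuous (V := R_CompleteNormedModule)). intros t _. now apply cont2_l.
Qed.

Lemma continuous_RInt_param k c e x : c <= e -> cont2 k ->
  continuous (fun u => RInt (fun s => k u s) c e) x.
Proof.
  intros Hce Hk. apply continuity_pt_filterlim. intros eps Heps.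
  (* The [1] covers the degenerate interval [c = e]. *)
  assert (H2 : 0 < eps / (e - c + 1)) by (apply Rdiv_lt_0_compat; lra).
  destruct (uniform_continuity_2d_1d' k c e x (fun t _ => Hk x t) (mkposreal _ H2)) as [d Hd].
  exists d. split; [apply cond_pos|]. intros u [_ Hu]. simpl in *. unfold R_dist in *.
  assert (E : RInt (fun s => k u s) c e - RInt (fun s => k x s) c e
    = RInt (fun s => k u s - k x s) c e).
  { symmetry. apply (RInt_minus (V := R_CompleteNormedModule) (fun s => k u s) (fun s => k x s));
      now apply ex_RInt_cont2_r. }
  rewrite E.
  assert (B : Rabs (RInt (fun s => k u s - k x s) c e) <= (e - c) * (eps / (e - c + 1))).
  { apply (abs_RInt_le_const (fun s => k u s - k x s)); trivial.
    - apply (ex_RInt_minus (V := R_NormedModule) (fun s => k u s) (fun s => k x s));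
        now apply ex_RInt_cont2_r.
    - intros t Ht. left. pose proof (cond_pos d).
      apply Rabs_lt_between in Hu.
      apply Hd; try lra. unfold Rminus. rewrite Rplus_opp_r, Rabs_R0. apply cond_pos. }
  eapply Rle_lt_trans; [exact B|].
  apply Rlt_le_trans with ((e - c + 1) * (eps / (e - c + 1))); [nra|].
  right. field. lra.
Qed.

(** Both sides are functions of the upper limit [b] that vanish at [b = a]. Differentiating the
    right side under the integral sign gives the outer integrand of the left side, and the
    fundamental theorem concludes. *)
Lemma Fubini_R k a b c e : c <= e -> cont2 k ->
  RInt (fun x => RInt (fun s => k x s) c e) a b = RInt (fun s => RInt (fun x => k x s) a b) c e.
Proof.
  intros Hce Hk.
  set (f := fun u s => RInt (fun x => k x s) a u).
  assert (Df : forall u s, is_derive (fun z => f z s) u (k u s)).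
  { intros u s. apply (is_derive_RInt (fun x => k x s) _ a).
    - apply filter_forall. intros z. apply (RInt_correct (V := R_CompleteNormedModule)).
      now apply ex_RInt_cont2_l.
    - now apply cont2_l. }
  assert (Df' : forall u s, Derive (fun z => f z s) u = k u s)
    by (intros; apply is_derive_unique, Df).
  assert (Cf : forall u s, continuous (fun t => f u t) s).
  { intros u s. unfold f. destruct (Rle_dec a u).
    - apply (continuous_RInt_param (fun t x => k x t)); [easy|now apply cont2_swap].
    - apply (continuous_ext (fun t => opp (RInt (fun x => k x t) u a))).
      + intros t. apply (opp_RInt_swap (V := R_CompleteNormedModule) (fun x => k x t)).
        now apply ex_RInt_cont2_l.
      + apply (continuous_opp (V := R_NormedModule)).
        apply (continuous_RInt_param (fun t x => k x t)); [lra|now apply cont2_swap]. }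
  assert (DP : forall u, is_derive (fun z => RInt (fun s => f z s) c e) u (RInt (fun s => k u s) c e)).
  { intros u. rewrite (RInt_ext _ (fun s => Derive (fun z => f z s) u)) by (intros; now rewrite Df').
    apply is_derive_RInt_param.
    - apply filter_forall. intros z t _. eexists. apply Df.
    - intros t _. apply (continuity_2d_pt_ext k); [intros; now rewrite Df'|apply Hk].
    - apply filter_forall. intros z. apply (ex_RInt_continuous (V := R_CompleteNormedModule)).
      intros t _. apply Cf. }
  assert (I : is_RInt (fun x => RInt (fun s => k x s) c e) a b
     (minus (RInt (fun s => f b s) c e) (RInt (fun s => f a s) c e))).
  { apply (is_RInt_derive (V := R_CompleteNormedModule) (fun z => RInt (fun s => f z s) c e)).
    - intros x _. apply DP.
    - intros x _. now apply continuous_RInt_param. }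
  rewrite (is_RInt_unique (V := R_CompleteNormedModule) _ _ _ _ I).
  unfold minus. rewrite (RInt_ext (fun s => f a s) (fun _ => 0)).
  - rewrite RInt_const. unfold scal, plus, opp; simpl. unfold mult; simpl. unfold f. ring.
  - intros s _. unfold f. apply (RInt_point (V := R_CompleteNormedModule)).
Qed.

Lemma Fubini_C (k : R -> R -> C) a b c e : a <= b -> c <= e ->
  (forall x s, continuous (fun p : R * R => k (fst p) (snd p)) (x, s)) ->
  exCI (fun x => CI (fun s => k x s) c e) a b /\ exCI (fun s => CI (fun x => k x s) a b) c e /\
  CI (fun x => CI (fun s => k x s) c e) a b = CI (fun s => CI (fun x => k x s) a b) c e.
Proof.
  intros Hab Hce Hk.
  assert (K1 : cont2 (fun x s => Re (k x s))).
  { intros x s. apply continuity_2d_pt_filterlim.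
    apply (continuous_Re (U := prod_UniformSpace R_UniformSpace R_UniformSpace)
      (fun p => k (fst p) (snd p)) (x, s)), Hk. }
  assert (K2 : cont2 (fun x s => Im (k x s))).
  { intros x s. apply continuity_2d_pt_filterlim.
    apply (continuous_Im (U := prod_UniformSpace R_UniformSpace R_UniformSpace)
      (fun p => k (fst p) (snd p)) (x, s)), Hk. }
  split; [|split].
  - split; apply (ex_RInt_continuous (V := R_CompleteNormedModule)); intros t _; simpl;
      [apply (continuous_RInt_param (fun x s => Re (k x s)))|apply (continuous_RInt_param (fun x s => Im (k x s)))];
      trivial.
  - split; apply (ex_RInt_continuous (V := R_CompleteNormedModule)); intros t _; simpl;
      [apply (continuous_RInt_param (fun s x => Re (k x s)))|apply (continuous_RInt_param (fun s x => Im (k x s)))];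
      trivial; apply (cont2_swap (fun x s => _ (k x s))); trivial.
  - unfold CI; simpl. f_equal.
    + now apply (Fubini_R (fun x s => Re (k x s))).
    + now apply (Fubini_R (fun x s => Im (k x s))).
Qed.

(** * Complex elementary functions *)

Lemma Rabs_sin_le y : Rabs (sin y) <= Rabs y.
Proof.
  assert (P : forall u, 0 <= u -> Rabs (sin u) <= u).
  { intros u Hu. destruct (Rle_dec 1 u).
    - pose proof (SIN_bound u). apply Rabs_le. lra.
    - destruct (Req_dec u 0) as [->|]; [rewrite sin_0, Rabs_R0; lra|].
      rewrite Rabs_pos_eq; [left; apply sin_lt_x; lra|].
      apply sin_ge_0; [lra|]. pose proof PI_RGT_0. pose proof PI2_1. lra. }
  destruct (Rle_dec 0 y).
  - rewrite (Rabs_pos_eq y) by easy. now apply P.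
  - rewrite (Rabs_left y) by lra. rewrite <- Rabs_Ropp, <- sin_neg. apply P. lra.
Qed.

Lemma Rabs_cos_m1_le y : Rabs (cos y - 1) <= y ^ 2 / 2.
Proof.
  replace y with (2 * (y / 2)) at 1 by field. rewrite cos_2a_sin.
  pose proof (Rabs_sin_le (y / 2)) as H. apply Rsqr_le_abs_1 in H. unfold Rsqr in H.
  apply Rabs_le. nra.
Qed.

Lemma Rabs_sin_m_le y : Rabs y <= 1 -> Rabs (sin y - y) <= y ^ 2.
Proof.
  assert (P : forall u, 0 <= u <= 1 -> - u ^ 2 <= sin u - u <= 0).
  { intros u Hu. split.
    - destruct (sin_bound u 0) as [H _]; [lra|pose proof PI2_1; lra|].
      unfold sin_approx, sin_term in H. simpl in H.
      replace (u - u ^ 3 / 6) with (1 * (u * 1 / 1) + -1 * 1 * (u * (u * (u * 1)) / (1 + 1 + 1 + 1 + 1 + 1))) in H by field.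
      nra.
    - destruct (Req_dec u 0) as [->|]; [rewrite sin_0; lra|].
      assert (sin u < u) by (apply sin_lt_x; lra). lra. }
  intros Hy. apply Rabs_le_between in Hy. apply Rabs_le.
  destruct (Rle_dec 0 y).
  - specialize (P y). nra.
  - specialize (P (- y)). rewrite sin_neg in P. nra.
Qed.

Lemma exp_m1_bounds x : Rabs x <= 1 / 2 -> 0 <= exp x - 1 - x <= 2 * x ^ 2.
Proof.
  intros Hx. apply Rabs_le_between in Hx. split.
  - pose proof (exp_ineq1_le x). lra.
  - pose proof (exp_ineq1_le (- x)) as H. rewrite exp_Ropp in H.
    pose proof (exp_pos x) as P.
    assert (E : (1 - x) * exp x <= 1).
    { apply (Rmult_le_compat_r (exp x)) in H; [|lra]. rewrite Rinv_l in H; lra. }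
    assert (0 <= (1 - x) * (1 + x + 2 * x ^ 2 - exp x)) by nra.
    apply Rnot_lt_le. intros Hlt. nra.
Qed.

(** Real estimates of [exp], [cos] and [sin] replace the power series. The constant is generous:
    differentiability of [Cexp] needs only some quadratic remainder. *)
Lemma Cexp_near_0 (w : C) : Cmod w <= 1 / 2 -> Cmod (Cexp w - 1 - w) <= 8 * Cmod w ^ 2.
Proof.
  destruct w as [x y]. intros Hw.
  pose proof (Rmax_Cmod (x, y)) as HM. simpl fst in HM; simpl snd in HM.
  assert (Hx : Rabs x <= Cmod (x, y)) by (eapply Rle_trans; [apply Rmax_l|exact HM]).
  assert (Hy : Rabs y <= Cmod (x, y)) by (eapply Rle_trans; [apply Rmax_r|exact HM]).
  assert (M2 : Cmod (x, y) ^ 2 = x ^ 2 + y ^ 2).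
  { rewrite Cmod2_alt. reflexivity. }
  pose proof (exp_m1_bounds x) as He. pose proof (Rabs_cos_m1_le y) as Hc.
  pose proof (Rabs_sin_m_le y) as Hs. pose proof (Rabs_sin_le y) as Hs1.
  assert (He' : 0 <= exp x - 1 - x <= 2 * x ^ 2) by (apply He; lra).
  assert (Hs' : Rabs (sin y - y) <= y ^ 2) by (apply Hs; lra).
  assert (Hx2 : Rabs x <= 1 / 2) by lra. assert (Hy2 : Rabs y <= 1 / 2) by lra.
  unfold Cexp, Cminus, Cplus, Copp, RtoC; simpl fst; simpl snd; simpl Re; simpl Im.
  eapply Rle_trans; [apply Cmod_le_sum|].
  replace (exp x * cos y + - (1) + - x) with ((exp x - 1 - x) * cos y + (1 + x) * (cos y - 1)) by ring.
  replace (exp x * sin y + - 0 + - y) with ((exp x - 1) * sin y + (sin y - y)) by ring.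
  rewrite M2.
  assert (T1 : Rabs ((exp x - 1 - x) * cos y + (1 + x) * (cos y - 1)) <= 2 * x ^ 2 + y ^ 2).
  { eapply Rle_trans; [apply Rabs_triang|]. rewrite !Rabs_mult.
    rewrite (Rabs_pos_eq (exp x - 1 - x)) by lra.
    assert (Rabs (cos y) <= 1) by (pose proof (COS_bound y); apply Rabs_le; lra).
    assert (0 <= Rabs (1 + x) <= 2).
    { split; [apply Rabs_pos|]. apply Rabs_le_between in Hx2. apply Rabs_le. lra. }
    pose proof (Rabs_pos (cos y)). pose proof (Rabs_pos (cos y - 1)).
    apply Rplus_le_compat; nra. }
  assert (T2 : Rabs ((exp x - 1) * sin y + (sin y - y)) <= 2 * x ^ 2 + 3 * y ^ 2).
  { eapply Rle_trans; [apply Rabs_triang|]. rewrite Rabs_mult.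
    assert (Q : Rabs (exp x - 1) <= 2 * Rabs x).
    { assert (x ^ 2 <= 1 / 2 * Rabs x).
      { rewrite <- (pow2_abs x). pose proof (Rabs_pos x). nra. }
      pose proof (Rle_abs x). pose proof (Rle_abs (- x)) as Z. rewrite Rabs_Ropp in Z.
      apply Rabs_le. lra. }
    pose proof (Rabs_pos (sin y)). pose proof (Rabs_pos (exp x - 1)). pose proof (Rabs_pos x). pose proof (Rabs_pos y).
    assert (Rabs (exp x - 1) * Rabs (sin y) <= 2 * Rabs x * Rabs y) by nra.
    assert (2 * Rabs x * Rabs y <= Rabs x ^ 2 + Rabs y ^ 2) by (pose proof (pow2_ge_0 (Rabs x - Rabs y)); lra).
    rewrite (pow2_abs x), (pow2_abs y) in *. pose proof (pow2_ge_0 x); pose proof (pow2_ge_0 y). lra. }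
  nra.
Qed.

Lemma Cexp_plus (z w : C) : Cexp (z + w) = (Cexp z * Cexp w)%C.
Proof.
  destruct z as [a b], w as [c e]. unfold Cexp, Cmult, Cplus; simpl.
  rewrite exp_plus, cos_plus, sin_plus. f_equal; ring.
Qed.

Lemma Cmod_Cexp (z : C) : Cmod (Cexp z) = exp (Re z).
Proof.
  unfold Cmod, Cexp; simpl fst; simpl snd.
  replace ((exp (Re z) * cos (Im z)) ^ 2 + (exp (Re z) * sin (Im z)) ^ 2) with (exp (Re z) ^ 2).
  - apply sqrt_pow2. left. apply exp_pos.
  - pose proof (sin2_cos2 (Im z)) as H. unfold Rsqr in H. nra.
Qed.

Lemma Cexp_RtoC (x : R) : Cexp x = exp x.
Proof. unfold Cexp, RtoC; simpl. rewrite cos_0, sin_0. f_equal; ring. Qed.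

Lemma Cder_Cexp (z : C) : Cder Cexp z (Cexp z).
Proof.
  apply Cder_eps. intros eps He.
  pose proof (exp_pos (Re z)) as P.
  exists (Rmin (1 / 2) (eps / (8 * exp (Re z)))). split.
  { apply Rmin_pos; [lra|]. apply Rdiv_lt_0_compat; lra. }
  intros w Hw.
  assert (W1 : Cmod (w - z) <= 1 / 2) by (left; exact (Rmin_lt_l _ _ _ Hw)).
  assert (W2 : Cmod (w - z) <= eps / (8 * exp (Re z))) by (left; exact (Rmin_lt_r _ _ _ Hw)).
  replace (Cexp w - Cexp z - Cexp z * (w - z))%C with (Cexp z * (Cexp (w - z) - 1 - (w - z)))%C.
  2:{ replace w with (z + (w - z))%C at 3 by ring. rewrite Cexp_plus. ring. }
  rewrite Cmod_mult, Cmod_Cexp.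
  pose proof (Cexp_near_0 _ W1) as H. pose proof (Cmod_ge_0 (w - z)).
  apply (Rmult_le_compat_l (8 * exp (Re z))) in W2; [|lra].
  replace (8 * exp (Re z) * (eps / (8 * exp (Re z)))) with eps in W2 by (field; lra).
  apply Rle_trans with (exp (Re z) * (8 * Cmod (w - z) ^ 2)); [apply Rmult_le_compat_l; lra|].
  nra.
Qed.

Lemma exp_cosh_sinh x : exp x = cosh x + sinh x.
Proof. unfold cosh, sinh. field. Qed.

Lemma exp_opp_cosh_sinh x : exp (- x) = cosh x - sinh x.
Proof. unfold cosh, sinh. field. Qed.

Lemma cosh2 x : cosh x ^ 2 = 1 + sinh x ^ 2.
Proof.
  unfold cosh, sinh. assert (exp x * exp (- x) = 1) by (rewrite <- exp_plus, Rplus_opp_r; apply exp_0).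
  nra.
Qed.

Lemma cosh_ge_1 x : 1 <= cosh x.
Proof.
  pose proof (cosh2 x) as H. pose proof (pow2_ge_0 (sinh x)).
  assert (0 < cosh x) by (unfold cosh; pose proof (exp_pos x); pose proof (exp_pos (- x)); lra).
  nra.
Qed.

(** Written in real and imaginary parts so that the modulus can be read off; the exponential form
    appears only in the proof of [Cder_Csin]. *)
Definition Csin (z : C) : C := (sin (Re z) * cosh (Im z), cos (Re z) * sinh (Im z)).
Definition Ccos (z : C) : C := (cos (Re z) * cosh (Im z), - sin (Re z) * sinh (Im z)).
Definition Ccosh (z : C) : C := (cosh (Re z) * cos (Im z), sinh (Re z) * sin (Im z)).

Lemma Cder_Csin z : Cder Csin z (Ccos z).
Proof.
  apply (Cder_ext (fun w => (- Ci / 2) * (Cexp (Ci * w) - Cexp (- Ci * w)))%C).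
  { intros [x y]. unfold Csin, Cexp, Ci; simpl.
    replace (0 * x - 1 * y) with (- y) by ring. replace (- 0 * x - - (1) * y) with y by ring.
    replace (0 * y + 1 * x) with x by ring. replace (- 0 * y + - (1) * x) with (- x) by ring.
    rewrite cos_neg, sin_neg, (exp_opp_cosh_sinh y), (exp_cosh_sinh y).
    unfold Cdiv, Cmult, Cminus, Cplus, Copp, Cinv, RtoC; simpl. f_equal; field. }
  eapply Cder_eq.
  - apply Cder_mult; [apply Cder_const|]. apply Cder_minus.
    + apply (Cder_comp Cexp (fun w => Ci * w)%C); [apply Cder_Cexp|].
      apply Cder_mult; [apply Cder_const|apply Cder_id].
    + apply (Cder_comp Cexp (fun w => - Ci * w)%C); [apply Cder_Cexp|].
      apply Cder_mult; [apply Cder_const|apply Cder_id].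
  - destruct z as [x y]. unfold Ccos, Cexp, Ci; simpl.
    replace (0 * x - 1 * y) with (- y) by ring. replace (- 0 * x - - (1) * y) with y by ring.
    replace (0 * y + 1 * x) with x by ring. replace (- 0 * y + - (1) * x) with (- x) by ring.
    rewrite cos_neg, sin_neg, (exp_opp_cosh_sinh y), (exp_cosh_sinh y).
    unfold Cdiv, Cmult, Cminus, Cplus, Copp, Cinv, RtoC; simpl. f_equal; field.
Qed.

Lemma Csinh_pair (x y : R) : Csinh (x, y) = (sinh x * cos y, cosh x * sin y).
Proof.
  unfold Csinh, Cexp; simpl. rewrite cos_neg, sin_neg, (exp_opp_cosh_sinh x), (exp_cosh_sinh x).
  unfold Cdiv, Cmult, Cminus, Cplus, Copp, Cinv, RtoC; simpl. f_equal; field.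
Qed.

Lemma Cder_Csinh z : Cder Csinh z (Ccosh z).
Proof.
  apply (Cder_ext (fun w => (/ 2) * (Cexp w - Cexp (- w)))%C).
  { intros w. unfold Csinh, Cdiv. ring. }
  eapply Cder_eq.
  - apply Cder_mult; [apply Cder_const|]. apply Cder_minus; [apply Cder_Cexp|].
    apply (Cder_comp Cexp (fun w => - w)%C); [apply Cder_Cexp|]. apply Cder_opp, Cder_id.
  - destruct z as [x y]. unfold Ccosh, Cexp; simpl.
    rewrite cos_neg, sin_neg, (exp_opp_cosh_sinh x), (exp_cosh_sinh x).
    unfold Cdiv, Cmult, Cminus, Cplus, Copp, Cinv, RtoC; simpl. f_equal; field.
Qed.

Lemma Cder_Ccosh z : Cder Ccosh z (Csinh z).
Proof.
  apply (Cder_ext (fun w => (/ 2) * (Cexp w + Cexp (- w)))%C).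
  { intros [x y]. unfold Ccosh, Cexp; simpl.
    rewrite cos_neg, sin_neg, (exp_opp_cosh_sinh x), (exp_cosh_sinh x).
    unfold Cdiv, Cmult, Cminus, Cplus, Copp, Cinv, RtoC; simpl. f_equal; field. }
  eapply Cder_eq.
  - apply Cder_mult; [apply Cder_const|]. apply Cder_plus; [apply Cder_Cexp|].
    apply (Cder_comp Cexp (fun w => - w)%C); [apply Cder_Cexp|]. apply Cder_opp, Cder_id.
  - unfold Csinh, Cdiv. ring.
Qed.

Lemma Cder_Cpsi z : Cder Cpsi z (Cpsi z * (RtoC (PI / 2) * Ccosh z)).
Proof.
  unfold Cpsi. eapply Cder_eq.
  - apply (Cder_comp Cexp (fun w => RtoC (PI / 2) * Csinh w)%C); [apply Cder_Cexp|].
    apply Cder_mult; [apply Cder_const|apply Cder_Csinh].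
  - cbv beta. ring.
Qed.

Lemma Cmod2_Csin (x y : R) : Cmod (Csin (x, y)) ^ 2 = sin x ^ 2 + sinh y ^ 2.
Proof.
  rewrite Cmod2_alt. unfold Csin; simpl Re; simpl Im.
  rewrite !Rpow_mult_distr, cosh2. pose proof (sin2_cos2 x) as H. unfold Rsqr in H. nra.
Qed.

(** For the horizontal sides of the contour, where it supplies the exponential decay in [1 / h]. *)
Lemma Cmod_Csin_ge_sinh (x y : R) : Rabs (sinh y) <= Cmod (Csin (x, y)).
Proof.
  apply Rsqr_incr_0; [|apply Rabs_pos|apply Cmod_ge_0].
  rewrite !Rsqr_pow2, Cmod2_Csin, pow2_abs. pose proof (pow2_ge_0 (sin x)). lra.
Qed.

(** For the vertical sides, which are placed where the real sine has modulus one. *)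
Lemma Cmod_Csin_ge_sin (x y : R) : Rabs (sin x) <= Cmod (Csin (x, y)).
Proof.
  apply Rsqr_incr_0; [|apply Rabs_pos|apply Cmod_ge_0].
  rewrite !Rsqr_pow2, Cmod2_Csin, pow2_abs. pose proof (pow2_ge_0 (sinh y)). lra.
Qed.

Lemma sinh_incr x y : x <= y -> sinh x <= sinh y.
Proof. intros [H| ->]; [left; now apply sinh_lt|lra]. Qed.

Lemma sinh_pos x : 0 < x -> 0 < sinh x.
Proof. intros H. rewrite <- sinh_0. now apply sinh_lt. Qed.

Lemma sinh_eq_0 x : sinh x = 0 -> x = 0.
Proof.
  intros H. destruct (Rtotal_order x 0) as [L|[E|L]]; trivial; exfalso.
  - apply sinh_lt in L. rewrite sinh_0 in L. lra.
  - apply sinh_lt in L. rewrite sinh_0 in L. lra.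
Qed.

Lemma sinh_opp x : sinh (- x) = - sinh x.
Proof. unfold sinh. rewrite Ropp_involutive. field. Qed.

Lemma cosh_opp x : cosh (- x) = cosh x.
Proof. unfold cosh. rewrite Ropp_involutive. field. Qed.

Lemma Csin_neq_0 (x y : R) : (y = 0 -> sin x <> 0) -> Csin (x, y) <> 0%C.
Proof.
  intros H E. pose proof (Cmod2_Csin x y) as M. rewrite E, Cmod_0 in M.
  pose proof (pow2_ge_0 (sin x)). pose proof (pow2_ge_0 (sinh y)).
  assert (S1 : sin x = 0) by nra. assert (S2 : sinh y = 0) by nra.
  apply sinh_eq_0 in S2. now apply H.
Qed.

(** * The sine integral *)

(* [ring] does not recognize the carrier of a normed module as [R]. *)
Ltac ring_R := match goal with |- ?a = ?b => change (@eq R a b) end; ring.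

Lemma MVT_is_derive (f f' : R -> R) a b : a < b ->
  (forall c, a <= c <= b -> is_derive f c (f' c)) ->
  exists c, f b - f a = f' c * (b - a) /\ a < c < b.
Proof.
  intros Hab H. apply MVT_cor2; [exact Hab|]. intros c Hc. now apply is_derive_Reals, H.
Qed.

Lemma exp_le x y : x <= y -> exp x <= exp y.
Proof. intros [H| ->]; [left; now apply exp_increasing|lra]. Qed.

Lemma mul_cos_le_sin a : 0 <= a <= PI -> a * cos a <= sin a.
Proof.
  intros [[Ha|<-] Hp].
  - destruct (MVT_is_derive (fun x => sin x - x * cos x) (fun x => x * sin x) 0 a Ha) as (c & Hc & Hc2).
    + intros c _. auto_derive; [easy|ring].
    + rewrite sin_0 in Hc. assert (0 <= sin c) by (apply sin_ge_0; lra).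
      assert (0 <= c * sin c) by (apply Rmult_le_pos; lra). nra.
  - rewrite sin_0. lra.
Qed.

(** Monotonicity of [sin x / x], with denominators cleared to admit [a = 0]. The function
    [x * sin a - a * sin x] has derivative [sin a - a * cos x], which is at least
    [sin a - a * cos a >= 0] on [[a, PI]]. *)
Lemma sin_div_decr a t : 0 <= a -> a <= t -> t <= PI -> a * sin t <= t * sin a.
Proof.
  intros Ha [Hat| ->] Ht; [|lra].
  destruct (MVT_is_derive (fun x => x * sin a - a * sin x) (fun x => sin a - a * cos x) a t Hat)
    as (c & Hc & Hc2).
  - intros c _. auto_derive; [easy|ring].
  - assert (cos c <= cos a) by (apply cos_decr_1; lra).
    pose proof (mul_cos_le_sin a). 
    assert (0 <= sin a - a * cos c) by nra. nra.
Qed.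

Lemma jordan u : 0 <= u <= PI / 2 -> 2 / PI * u <= sin u.
Proof.
  intros Hu. pose proof PI_RGT_0.
  pose proof (sin_div_decr u (PI / 2)) as H0. rewrite sin_PI2 in H0.
  assert (u <= PI / 2 * sin u) by lra.
  apply (Rmult_le_reg_l (PI / 2)); [lra|].
  replace (PI / 2 * (2 / PI * u)) with u by (field; lra). lra.
Qed.

(** In [Si] the quotient [sin s / s] has an arbitrary value at [0]. The repaired integrand is
    continuous and has the same integral. *)
Definition sinc0 (x : R) : R := if Req_EM_T x 0 then 1 else sin x / x.

Lemma continuous_sinc0 x : continuous sinc0 x.
Proof.
  destruct (Req_EM_T x 0) as [->|Hx].
  - apply continuity_pt_filterlim. intros eps He.
    exists (Rmin 1 eps). split; [apply Rmin_pos; lra|].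
    intros u [_ Hu]. simpl in *. unfold R_dist in *. rewrite Rminus_0_r in Hu.
    unfold sinc0. destruct (Req_EM_T 0 0) as [_|]; [|easy].
    destruct (Req_EM_T u 0) as [|Hu0]; [rewrite Rminus_diag, Rabs_R0; lra|].
    assert (U1 : Rabs u < 1) by (exact (Rmin_lt_l _ _ _ Hu)).
    assert (U2 : Rabs u < eps) by (exact (Rmin_lt_r _ _ _ Hu)).
    replace (sin u / u - 1) with ((sin u - u) / u) by (field; easy).
    rewrite Rabs_div by easy.
    assert (P : 0 < Rabs u) by now apply Rabs_pos_lt.
    apply Rle_lt_trans with (u ^ 2 / Rabs u).
    + apply Rmult_le_compat_r; [left; now apply Rinv_0_lt_compat|]. apply Rabs_sin_m_le. lra.
    + rewrite <- pow2_abs. replace (Rabs u ^ 2 / Rabs u) with (Rabs u) by (field; lra). easy.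
  - apply (continuous_ext_loc (T := R_UniformSpace) (U := R_UniformSpace) sinc0 (fun u => sin u / u)).
    + assert (P : 0 < Rabs x) by now apply Rabs_pos_lt.
      exists (mkposreal _ P). intros u Hu. unfold sinc0.
      destruct (Req_EM_T u 0) as [->|]; [|easy]. exfalso.
      change (Rabs (0 - x) < Rabs x) in Hu. rewrite Rminus_0_l, Rabs_Ropp in Hu. lra.
    + apply (ex_derive_continuous (fun u => sin u / u)). auto_derive. easy.
Qed.

Lemma ex_RInt_sinc0 a b : ex_RInt sinc0 a b.
Proof.
  apply (ex_RInt_continuous (V := R_CompleteNormedModule)). intros; apply continuous_sinc0.
Qed.

Lemma Si_RInt x : Si x = RInt sinc0 0 x.
Proof.
  unfold Si. apply RInt_ext. intros t Ht. unfold sinc0.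
  destruct (Req_EM_T t 0) as [->|]; [|easy]. exfalso.
  unfold Rmin, Rmax in Ht. destruct Rle_dec; lra.
Qed.

Lemma is_derive_Si x : is_derive Si x (sinc0 x).
Proof.
  apply (is_derive_ext (RInt sinc0 0)); [intros; symmetry; apply Si_RInt|].
  apply (is_derive_RInt sinc0 _ 0).
  - apply filter_forall. intros z. apply (RInt_correct (V := R_CompleteNormedModule)), ex_RInt_sinc0.
  - apply continuous_sinc0.
Qed.

Lemma Si_opp x : Si (- x) = - Si x.
Proof.
  rewrite !Si_RInt.
  pose proof (RInt_correct (V := R_CompleteNormedModule) sinc0 (- 0) (- x) (ex_RInt_sinc0 _ _)) as H.
  apply (is_RInt_comp_opp (V := R_NormedModule)) in H.
  apply (is_RInt_unique (V := R_CompleteNormedModule)) in H.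
  rewrite Ropp_0 in H. rewrite <- H.
  rewrite (RInt_ext _ (fun y => opp (sinc0 y))).
  - apply (RInt_opp (V := R_CompleteNormedModule)), ex_RInt_sinc0.
  - intros t _. f_equal. unfold sinc0. rewrite sin_neg.
    destruct (Req_EM_T (- t) 0), (Req_EM_T t 0); try lra. field; lra.
Qed.

(* The real part of the integral of [exp (i z)] against [dz / (i z)] over the quarter circle of radius [x]. *)
Definition Si_rem (x : R) : R := RInt (fun t => exp (- (x * cos t)) * cos (x * sin t)) 0 (PI / 2).

(** Differentiation under the integral sign gives an integrand that is the exact [t]-derivative of
    [- exp (- (x * cos t)) * sin (x * sin t) / x]. *)
Lemma is_derive_Si_rem x : is_derive Si_rem x (- sinc0 x).
Proof.
  set (f := fun x t => exp (- (x * cos t)) * cos (x * sin t)).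
  set (g := fun x t => exp (- (x * cos t)) * (- cos t * cos (x * sin t) - sin t * sin (x * sin t))).
  assert (Df : forall u t, is_derive (fun z => f z t) u (g u t)).
  { intros u t. unfold f, g. auto_derive; [easy|ring]. }
  assert (Df' : forall u t, Derive (fun z => f z t) u = g u t)
    by (intros; apply is_derive_unique, Df).
  assert (Cg : forall u t, continuity_2d_pt g u t).
  { intros u t. unfold g.
    assert (Cc : forall u t, continuity_2d_pt (fun u t => cos t) u t).
    { intros. apply (continuity_1d_2d_pt_comp cos (fun _ t => t)); [apply continuity_cos|apply continuity_2d_pt_id2]. }
    assert (Cs : forall u t, continuity_2d_pt (fun u t => sin t) u t).
    { intros. apply (continuity_1d_2d_pt_comp sin (fun _ t => t)); [apply continuity_sin|apply continuity_2d_pt_id2]. }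
    assert (Cxs : continuity_2d_pt (fun u t => u * sin t) u t)
      by (apply continuity_2d_pt_mult; [apply continuity_2d_pt_id1|apply Cs]).
    apply continuity_2d_pt_mult.
    - apply (continuity_1d_2d_pt_comp exp (fun u t => - (u * cos t))).
      + apply derivable_continuous_pt, derivable_pt_exp.
      + apply continuity_2d_pt_opp, continuity_2d_pt_mult; [apply continuity_2d_pt_id1|apply Cc].
    - apply continuity_2d_pt_minus; apply continuity_2d_pt_mult.
      + apply continuity_2d_pt_opp, Cc.
      + apply (continuity_1d_2d_pt_comp cos (fun u t => u * sin t)); [apply continuity_cos|exact Cxs].
      + apply Cs.
      + apply (continuity_1d_2d_pt_comp sin (fun u t => u * sin t)); [apply continuity_sin|exact Cxs]. }
  assert (D : is_derive Si_rem x (RInt (fun t => g x t) 0 (PI / 2))).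
  { rewrite (RInt_ext _ (fun t => Derive (fun z => f z t) x)) by (intros; now rewrite Df').
    apply (is_derive_RInt_param f).
    - apply filter_forall. intros z t _. eexists. apply Df.
    - intros t _. apply (continuity_2d_pt_ext g); [intros; now rewrite Df'|apply Cg].
    - apply filter_forall. intros z. apply (ex_RInt_continuous (V := R_CompleteNormedModule)).
      intros t _. apply (ex_derive_continuous (fun t => f z t)). unfold f. auto_derive. easy. }
  replace (- sinc0 x) with (RInt (fun t => g x t) 0 (PI / 2)); [exact D|].
  (* At [x = 0] the primitive would divide by zero, but the integrand is simply [- cos t]. *)
  unfold sinc0. destruct (Req_EM_T x 0) as [->|Hx].
  - rewrite (RInt_ext _ (fun t => - cos t)).
    + apply (is_RInt_unique (V := R_CompleteNormedModule)).
      replace (- (1)) with (minus (- sin (PI / 2)) (- sin 0))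
        by (rewrite sin_PI2, sin_0; unfold minus, plus, opp; simpl; ring).
      apply (is_RInt_derive (V := R_CompleteNormedModule) (fun t => - sin t)); intros t _.
      * auto_derive; [easy|ring].
      * apply (ex_derive_continuous (fun t => - cos t)). auto_derive. easy.
    + intros t _. unfold g. rewrite !Rmult_0_l, Ropp_0, exp_0, cos_0, sin_0.
      ring_R.
  - apply (is_RInt_unique (V := R_CompleteNormedModule)).
    set (A := fun t => - / x * (exp (- (x * cos t)) * sin (x * sin t))).
    replace (- (sin x / x)) with (minus (A (PI / 2)) (A 0)).
    + apply (is_RInt_derive (V := R_CompleteNormedModule) A); intros t _.
      * unfold A, g. auto_derive; [easy|]. field. easy.
      * apply (ex_derive_continuous (fun t => g x t)). unfold g. auto_derive. easy.
    + unfold A. rewrite sin_PI2, cos_PI2, sin_0, Rmult_0_r, Ropp_0, exp_0, sin_0, Rmult_1_r.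
      unfold minus, plus, opp; simpl. field. easy.
Qed.

(** The two sides have the same derivative and agree at [0]. This one representation yields both the
    global bound on [Si] and its limits at infinity. *)
Lemma Si_eq x : Si x = PI / 2 - Si_rem x.
Proof.
  rewrite Si_RInt.
  assert (E0 : Si_rem 0 = PI / 2).
  { unfold Si_rem. rewrite (RInt_ext _ (fun _ => 1)).
    - rewrite RInt_const. unfold scal; simpl; unfold mult; simpl. ring.
    - intros t _. rewrite !Rmult_0_l, Ropp_0, exp_0, cos_0. ring_R. }
  assert (H : is_RInt (fun t => opp (sinc0 t)) 0 x (minus (Si_rem x) (Si_rem 0))).
  { apply (is_RInt_derive (V := R_CompleteNormedModule)); intros t _.
    - apply is_derive_Si_rem.
    - apply (continuous_opp (V := R_NormedModule) sinc0), continuous_sinc0. }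
  apply (is_RInt_unique (V := R_CompleteNormedModule)) in H.
  rewrite (RInt_opp (V := R_CompleteNormedModule)) in H by apply ex_RInt_sinc0.
  rewrite E0 in H. unfold minus, plus, opp in H; simpl in H. lra.
Qed.

Lemma ex_RInt_Si_rem x : ex_RInt (fun t => exp (- (x * cos t)) * cos (x * sin t)) 0 (PI / 2).
Proof.
  apply (ex_RInt_continuous (V := R_CompleteNormedModule)). intros t _.
  apply (ex_derive_continuous (fun t => exp (- (x * cos t)) * cos (x * sin t))). auto_derive. easy.
Qed.

Lemma Si_rem_bounded x : 0 <= x -> Rabs (Si_rem x) <= PI / 2.
Proof.
  intros Hx. pose proof PI_RGT_0.
  replace (PI / 2) with ((PI / 2 - 0) * 1) by ring.
  apply abs_RInt_le_const; [lra|apply ex_RInt_Si_rem|].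
  intros t Ht. rewrite Rabs_mult, (Rabs_pos_eq (exp _)) by (left; apply exp_pos).
  assert (Hc : 0 <= cos t) by (apply cos_ge_0; lra).
  assert (exp (- (x * cos t)) <= 1) by (rewrite <- exp_0; apply exp_le; nra).
  pose proof (exp_pos (- (x * cos t))).
  assert (Rabs (cos (x * sin t)) <= 1) by (pose proof (COS_bound (x * sin t)); apply Rabs_le; lra).
  pose proof (Rabs_pos (cos (x * sin t))). nra.
Qed.

Lemma Si_rem_le x : 0 < x -> Rabs (Si_rem x) <= 2 / x.
Proof.
  intros Hx. pose proof PI_RGT_0. pose proof PI_4.
  assert (B : is_RInt (fun t => exp (- (x * ((PI / 2 - t) / 2)))) 0 (PI / 2)
     (minus (2 / x * exp (- (x * ((PI / 2 - PI / 2) / 2)))) (2 / x * exp (- (x * ((PI / 2 - 0) / 2)))))).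
  { apply (is_RInt_derive (V := R_CompleteNormedModule) (fun t => 2 / x * exp (- (x * ((PI / 2 - t) / 2)))));
      intros t _.
    - auto_derive; [easy|]. unfold Rminus, Rdiv. field. lra.
    - apply (ex_derive_continuous (fun t => exp (- (x * ((PI / 2 - t) / 2))))). auto_derive. easy. }
  apply Rle_trans with (RInt (fun t => exp (- (x * ((PI / 2 - t) / 2)))) 0 (PI / 2)).
  - apply Rle_trans with (RInt (fun t => Rabs (exp (- (x * cos t)) * cos (x * sin t))) 0 (PI / 2)).
    { apply abs_RInt_le; [lra|apply ex_RInt_Si_rem]. }
    apply RInt_le; [lra| |eexists; exact B|].
    { apply (ex_RInt_continuous (V := R_CompleteNormedModule)). intros t _.
      apply (continuous_Rabs_comp (fun t => exp (- (x * cos t)) * cos (x * sin t))).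
      apply (ex_derive_continuous (fun t => exp (- (x * cos t)) * cos (x * sin t))). auto_derive. easy. }
    intros t Ht. rewrite Rabs_mult, (Rabs_pos_eq (exp _)) by (left; apply exp_pos).
    (* Jordan's inequality with [2 / PI] weakened to [1 / 2] through [PI <= 4]; the exponent becomes
       linear in [t] and the integral explicit. *)
    assert (Hc : (PI / 2 - t) / 2 <= cos t).
    { rewrite <- sin_shift. pose proof (jordan (PI / 2 - t)).
      assert (/ 2 <= 2 / PI). { apply (Rmult_le_reg_r PI); [lra|]. replace (2 / PI * PI) with 2 by (field; lra). lra. }
      nra. }
    assert (exp (- (x * cos t)) <= exp (- (x * ((PI / 2 - t) / 2)))) by (apply exp_le; nra).
    pose proof (exp_pos (- (x * cos t))).
    assert (Rabs (cos (x * sin t)) <= 1) by (pose proof (COS_bound (x * sin t)); apply Rabs_le; lra).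
    pose proof (Rabs_pos (cos (x * sin t))). nra.
  - rewrite (is_RInt_unique (V := R_CompleteNormedModule) _ _ _ _ B).
    unfold minus, plus, opp; simpl.
    replace (- (x * ((PI / 2 - PI / 2) / 2))) with 0 by field. rewrite exp_0.
    pose proof (exp_pos (- (x * ((PI / 2 - 0) / 2)))).
    assert (0 < 2 / x) by (apply Rdiv_lt_0_compat; lra). nra.
Qed.

Lemma Rabs_Si x : Rabs (Si x) <= PI.
Proof.
  assert (P : forall u, 0 <= u -> Rabs (Si u) <= PI).
  { intros u Hu. rewrite Si_eq. pose proof (Si_rem_bounded u Hu) as H.
    apply Rabs_le_between in H. apply Rabs_le. lra. }
  destruct (Rle_dec 0 x); [now apply P|].
  rewrite <- (Ropp_involutive x), Si_opp, Rabs_Ropp. apply P. lra.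
Qed.

(** Each value of [Si] is bounded by [PI]. The resulting factor [2] is crude, but the final constant
    has room for it. *)
Lemma J_diff_bound k h x y : 0 < h -> Rabs (J k h x - J k h y) <= 2 * h.
Proof.
  intros Hh. unfold J. pose proof PI_RGT_0.
  pose proof (Rabs_Si (PI * (x / h - IZR k))) as H1. pose proof (Rabs_Si (PI * (y / h - IZR k))) as H2.
  set (s := Si (PI * (x / h - IZR k))) in *. set (t := Si (PI * (y / h - IZR k))) in *.
  replace (h * (1 / 2 + s / PI) - h * (1 / 2 + t / PI)) with (h / PI * (s - t)) by (field; lra).
  rewrite Rabs_mult, Rabs_pos_eq by (left; apply Rdiv_lt_0_compat; lra).
  apply Rle_trans with (h / PI * (PI + PI)); [|right; field; lra].
  apply Rmult_le_compat_l; [left; apply Rdiv_lt_0_compat; lra|].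
  apply Rabs_le_between in H1, H2. apply Rabs_le. lra.
Qed.

Lemma is_derive_J k h x : 0 < h -> is_derive (J k h) x (sinc0 (PI * (x / h - IZR k))).
Proof.
  intros Hh. unfold J. pose proof PI_RGT_0.
  replace (sinc0 (PI * (x / h - IZR k)))
    with (h * (plus 0 (PI / h * sinc0 (PI * (x / h - IZR k)) * / PI))) by (unfold plus; simpl; field; lra).
  apply (is_derive_scal (fun y => 1 / 2 + Si (PI * (y / h - IZR k)) / PI)).
  apply (is_derive_plus (V := R_NormedModule) (fun _ => 1 / 2) (fun y => Si (PI * (y / h - IZR k)) / PI)).
  - apply (is_derive_const (V := R_NormedModule)).
  - apply (is_derive_ext (fun y => / PI * Si (PI * (y / h - IZR k)))); [intros; unfold Rdiv; simpl; ring|].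
    rewrite Rmult_comm. apply (is_derive_scal (fun y => Si (PI * (y / h - IZR k)))).
    apply (is_derive_comp Si (fun y => PI * (y / h - IZR k))).
    + apply is_derive_Si.
    + auto_derive; [easy|]. field. lra.
Qed.

(** Towards minus infinity the limit [- PI / 2] of [Si] cancels the summand [1 / 2], and [J] becomes
    [h / PI] times a value of [Si_rem]. *)
Lemma J_lim_minus_infty k h eps : 0 < h -> 0 < eps ->
  exists X, forall x, x < X -> Rabs (J k h x) <= eps.
Proof.
  intros Hh He. pose proof PI_RGT_0.
  exists (h * IZR k - 2 * h * h / (PI * PI * eps) - h). intros x Hx.
  set (u := PI * (IZR k - x / h)).
  assert (Hu : PI * (2 * h / (PI * PI * eps) + 1) <= u).
  { unfold u. apply Rmult_le_compat_l; [lra|].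
    apply (Rmult_le_reg_l h); [lra|].
    replace (h * (2 * h / (PI * PI * eps) + 1)) with (2 * h * h / (PI * PI * eps) + h)
      by (field; repeat split; lra).
    replace (h * (IZR k - x / h)) with (h * IZR k - x) by (field; lra). lra. }
  assert (Q : 0 < 2 * h / (PI * PI * eps)).
  { apply Rdiv_lt_0_compat; [lra|]. apply Rmult_lt_0_compat; [apply Rmult_lt_0_compat|]; lra. }
  assert (Hu0 : 0 < u) by (eapply Rlt_le_trans; [|exact Hu]; apply Rmult_lt_0_compat; lra).
  unfold J. replace (PI * (x / h - IZR k)) with (- u) by (unfold u; ring).
  rewrite Si_opp, Si_eq.
  replace (h * (1 / 2 + - (PI / 2 - Si_rem u) / PI)) with (h / PI * Si_rem u) by (field; lra).
  rewrite Rabs_mult, Rabs_pos_eq by (left; apply Rdiv_lt_0_compat; lra).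
  apply Rle_trans with (h / PI * (2 / u)).
  { apply Rmult_le_compat_l; [left; apply Rdiv_lt_0_compat; lra|]. now apply Si_rem_le. }
  assert (Hu' : PI * (2 * h / (PI * PI * eps)) <= u) by lra.
  replace (PI * (2 * h / (PI * PI * eps))) with (2 * h / (PI * eps)) in Hu' by (field; split; lra).
  apply (Rmult_le_reg_r u); [easy|].
  replace (h / PI * (2 / u) * u) with (2 * h / (PI * eps) * eps) by (field; repeat split; lra).
  rewrite (Rmult_comm eps). apply Rmult_le_compat_r; lra.
Qed.

(** * Discretization error of the Sinc indefinite integration *)

Lemma Cder_Ccos z : Cder Ccos z (- Csin z).
Proof.
  assert (E : forall w, Csin (w + RtoC (PI / 2)) = Ccos w).
  { intros [x y]. unfold Csin, Ccos, Cplus, RtoC; simpl.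
    rewrite Rplus_0_r, sin_plus, cos_plus, sin_PI2, cos_PI2. f_equal; ring. }
  apply (Cder_ext (fun w => Csin (w + RtoC (PI / 2)))); [exact E|].
  eapply Cder_eq.
  - apply (Cder_comp Csin (fun w => w + RtoC (PI / 2))%C); [apply Cder_Csin|].
    apply Cder_plus; [apply Cder_id|apply Cder_const].
  - cbv beta. rewrite <- E. replace (z + RtoC (PI / 2) + RtoC (PI / 2))%C with (z + RtoC PI)%C.
    + destruct z as [x y]. unfold Ccos, Csin, Cplus, Cmult, Copp, RtoC; simpl.
      rewrite !Rplus_0_r, sin_plus, cos_plus, sin_PI, cos_PI.
      f_equal; ring.
    + destruct z as [x y]. unfold Cplus, RtoC; simpl. f_equal; field.
Qed.

Lemma Cder_is_derive f x l : Cder f (RtoC x) l ->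
  is_derive (fun t : R => Re (f (RtoC t))) x (Re l) /\ is_derive (fun t : R => Im (f (RtoC t))) x (Im l).
Proof.
  intros (phi & Hc & <- & d & Hd & Hf).
  assert (Key : forall eps, 0 < eps -> exists delta : posreal, forall u, u <> 0 -> Rabs u < delta ->
     ((f (RtoC (x + u)) - f (RtoC x)) / RtoC u = phi (RtoC (x + u)))%C /\
     Cmod (phi (RtoC (x + u)) - phi (RtoC x)) < eps).
  { intros eps He. apply continuous_C_eps with (eps := eps) in Hc; [|easy].
    destruct Hc as (d2 & Hd2 & Hphi).
    assert (P : 0 < Rmin d d2) by now apply Rmin_pos.
    exists (mkposreal _ P). intros u Hu0 Hu. simpl in Hu.
    assert (E : (RtoC (x + u) - RtoC x)%C = RtoC u) by (unfold Cminus, Cplus, Copp, RtoC; simpl; f_equal; ring).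
    split.
    - rewrite Hf.
      + rewrite E. field. intros E0. injection E0. easy.
      + rewrite E, Cmod_R. exact (Rmin_lt_l _ _ _ Hu).
    - apply Hphi. rewrite E, Cmod_R. exact (Rmin_lt_r _ _ _ Hu). }
  split; apply is_derive_Reals; intros eps He; destruct (Key eps He) as [delta Hdel];
    exists delta; intros u Hu0 Hu; destruct (Hdel u Hu0 Hu) as [E B].
  - replace ((Re (f (RtoC (x + u))) - Re (f (RtoC x))) / u) with (Re (phi (RtoC (x + u)))).
    + eapply Rle_lt_trans; [|exact B].
      replace (Re (phi (RtoC (x + u))) - Re (phi (RtoC x))) with (Re (phi (RtoC (x + u)) - phi (RtoC x))%C) by reflexivity.
      apply re_le_Cmod.
    + rewrite <- E. generalize (f (RtoC (x + u))) (f (RtoC x)). intros [p q] [p' q'].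
      unfold Cdiv, Cminus, Cplus, Copp, Cmult, Cinv, RtoC; simpl. field. easy.
  - replace ((Im (f (RtoC (x + u))) - Im (f (RtoC x))) / u) with (Im (phi (RtoC (x + u)))).
    + eapply Rle_lt_trans; [|exact B].
      replace (Im (phi (RtoC (x + u))) - Im (phi (RtoC x))) with (Im (phi (RtoC (x + u)) - phi (RtoC x))%C) by reflexivity.
      set (c := (phi (RtoC (x + u)) - phi (RtoC x))%C).
      pose proof (Rmax_Cmod c). eapply Rle_trans; [apply Rmax_r|exact H].
    + rewrite <- E. generalize (f (RtoC (x + u))) (f (RtoC x)). intros [p q] [p' q'].
      unfold Cdiv, Cminus, Cplus, Copp, Cmult, Cinv, RtoC; simpl. field. easy.
Qed.

Lemma CI_Cder f (f' : R -> C) a b : a <= b ->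
  (forall x, a <= x <= b -> Cder f (RtoC x) (f' x)) ->
  (forall x, a <= x <= b -> continuous f' x) -> CI f' a b = (f (RtoC b) - f (RtoC a))%C.
Proof.
  intros Hab Hd Hc.
  apply (CI_unique f' a b (f (RtoC b) - f (RtoC a))%C).
  apply (is_RInt_fct_extend_pair (U := R_NormedModule) (V := R_NormedModule)).
  - apply (is_RInt_derive (V := R_CompleteNormedModule) (fun t => Re (f (RtoC t)))); rewrite Rmin_left, Rmax_right by easy; intros x Hx.
    + apply Cder_is_derive. now apply Hd.
    + now apply (continuous_Re f'), Hc.
  - apply (is_RInt_derive (V := R_CompleteNormedModule) (fun t => Im (f (RtoC t)))); rewrite Rmin_left, Rmax_right by easy; intros x Hx.
    + apply Cder_is_derive. now apply Hd.
    + now apply (continuous_Im f'), Hc.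
Qed.

Lemma Cmod_sub_R (s t x : R) : Cmod ((s, t) - RtoC x) = sqrt ((s - x) ^ 2 + t ^ 2).
Proof. unfold Cmod, Cminus, Cplus, Copp, RtoC; simpl. f_equal. ring. Qed.

(** Both bounds are [sin v <= v] with [v = PI / 2 + atan u] or [v = PI / 2 - atan u]. The first
    serves the right end of the [x]-interval, the second the left end; then the arctangents cancel
    against those of the remaining integral. *)
Lemma inv_Cmod_le_atan (s t x : R) : t <> 0 ->
  / Cmod ((s, t) - RtoC x) <= (PI / 2 + atan ((s - x) / Rabs t)) / Rabs t /\
  / Cmod ((s, t) - RtoC x) <= (PI / 2 - atan ((s - x) / Rabs t)) / Rabs t.
Proof.
  intros Ht. assert (T : 0 < Rabs t) by now apply Rabs_pos_lt.
  set (u := (s - x) / Rabs t).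
  assert (E : / Cmod ((s, t) - RtoC x) = cos (atan u) / Rabs t).
  { rewrite Cmod_sub_R, cos_atan.
    replace ((s - x) ^ 2 + t ^ 2) with (Rabs t ^ 2 * (1 + u²)).
    - rewrite sqrt_mult_alt by apply pow2_ge_0. rewrite sqrt_pow2 by lra.
      field. split; [|lra]. apply Rgt_not_eq, sqrt_lt_R0. pose proof (Rle_0_sqr u). lra.
    - unfold u, Rsqr. rewrite <- (pow2_abs t). field. lra. }
  rewrite E. pose proof (atan_bound u) as B.
  assert (P : forall a, - PI / 2 < a < PI / 2 -> cos a <= PI / 2 - a).
  { intros a Ha. rewrite cos_sin. replace (PI / 2 + a) with (PI - (PI / 2 - a)) by field.
    rewrite sin_PI_x. left. apply sin_lt_x. lra. }
  split; apply Rmult_le_compat_r; try (left; now apply Rinv_0_lt_compat).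
  - rewrite <- cos_neg. replace (PI / 2 + atan u) with (PI / 2 - - atan u) by ring. apply P. lra.
  - apply P. lra.
Qed.

Lemma RC_sub_neq_0 (s t x : R) : t <> 0 -> ((s, t) - RtoC x)%C <> 0%C.
Proof. intros H. apply RC_neq. now right. Qed.

Lemma RInt_inv_sq (s t a b : R) : t <> 0 ->
  is_RInt (fun x => / ((s - x) ^ 2 + t ^ 2)) a b
    ((atan ((s - a) / Rabs t) - atan ((s - b) / Rabs t)) / Rabs t).
Proof.
  intros Ht. assert (T : 0 < Rabs t) by now apply Rabs_pos_lt.
  rewrite <- (pow2_abs t).
  replace ((atan ((s - a) / Rabs t) - atan ((s - b) / Rabs t)) / Rabs t)
    with (minus (- atan ((s - b) / Rabs t) / Rabs t) (- atan ((s - a) / Rabs t) / Rabs t))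
    by (unfold minus, plus, opp; simpl; field; lra).
  apply (is_RInt_derive (V := R_CompleteNormedModule) (fun x => - atan ((s - x) / Rabs t) / Rabs t)); intros x _.
  - auto_derive; [easy|].
    field; repeat split; try lra; intros Hz; apply (sum_sq_neq_0 (s - x) (Rabs t) T);
      rewrite <- Hz; ring.
  - apply (ex_derive_continuous (fun x => / ((s - x) ^ 2 + Rabs t ^ 2))). auto_derive.
    now apply sum_sq_neq_0.
Qed.

(* Integration by parts; the boundary terms and the remaining integral add up because
   [cos (atan u) <= PI / 2 - |atan u|]. *)
Lemma osc_integral_bound (w s t a b : R) : 0 < w -> t <> 0 -> a <= b ->
  Cmod (CI (fun x => RtoC (sin (w * x)) / ((s, t) - RtoC x))%C a b) <= PI / (w * Rabs t).
Proof.
  intros Hw Ht Hab. assert (T : 0 < Rabs t) by now apply Rabs_pos_lt.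
  set (z := (s, t) : C).
  assert (Hz : forall x : R, (z - RtoC x)%C <> 0%C) by (intros x; now apply RC_sub_neq_0).
  assert (Hw0 : RtoC w <> 0%C) by (intros E; injection E; lra).
  assert (Hd : forall x : R, continuous (fun x : R => (z - RtoC x)%C) x).
  { intros x. apply continuous_Cminus; [apply continuous_Cconst|apply continuous_RtoC, continuous_id]. }
  assert (Hsc : forall x : R, continuous (fun x : R => RtoC (sin (w * x))) x).
  { intros x. apply continuous_RtoC, (ex_derive_continuous (fun x => sin (w * x))). auto_derive. easy. }
  assert (Hcc : forall x : R, continuous (fun x : R => RtoC (cos (w * x))) x).
  { intros x. apply continuous_RtoC, (ex_derive_continuous (fun x => cos (w * x))). auto_derive. easy. }
  (* Its derivative is [p x - q x / w]: the oscillation gains the factor [1 / w], and [q] has an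
     absolutely integrable kernel. *)
  set (A := fun x : C => (- / RtoC w * (Ccos (RtoC w * x) * / (z - x)))%C).
  set (q := fun x : R => (RtoC (cos (w * x)) / ((z - RtoC x) * (z - RtoC x)))%C).
  set (p := fun x : R => (RtoC (sin (w * x)) / (z - RtoC x))%C).
  assert (Cq : forall x, continuous q x).
  { intros x. apply continuous_Cdiv; [apply Hcc|now apply continuous_Cmult|now apply Cmult_neq_0]. }
  assert (Cp : forall x, continuous p x) by (intros x; now apply continuous_Cdiv).
  assert (Eq : exCI q a b) by (apply exCI_continuous; intros; apply Cq).
  assert (Ep : exCI p a b) by (apply exCI_continuous; intros; apply Cp).
  destruct (CI_scal (/ RtoC w) q a b Eq) as [Eq1 Eq2].
  destruct (CI_minus p _ a b Ep Eq1) as [Em1 Em2]. rewrite Eq2 in Em2.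
  assert (F : CI (fun x => p x - / RtoC w * q x)%C a b = (A (RtoC b) - A (RtoC a))%C).
  { apply (CI_Cder A); [exact Hab| |].
    - intros x _. eapply Cder_eq.
      + unfold A. apply Cder_mult; [apply Cder_const|]. apply Cder_mult.
        * apply (Cder_comp Ccos (fun x => RtoC w * x)%C); [apply Cder_Ccos|].
          apply Cder_mult; [apply Cder_const|apply Cder_id].
        * apply (Cder_inv (fun x => z - x)%C); [|apply Hz].
          apply Cder_minus; [apply Cder_const|apply Cder_id].
      + unfold p, q. cbv beta. rewrite <- RtoC_mult.
        assert (C1 : Ccos (RtoC (w * x)) = RtoC (cos (w * x)))
          by (unfold Ccos, RtoC; simpl; rewrite cosh_0, sinh_0; f_equal; ring).
        assert (S1 : Csin (RtoC (w * x)) = RtoC (sin (w * x)))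
          by (unfold Csin, RtoC; simpl; rewrite cosh_0, sinh_0; f_equal; ring).
        rewrite C1, S1. field. split; [apply Hz|exact Hw0].
    - intros x _. apply continuous_Cminus; [apply Cp|].
      apply continuous_Cmult; [apply continuous_Cconst|apply Cq]. }
  assert (G : CI p a b = (A (RtoC b) - A (RtoC a) + / RtoC w * CI q a b)%C).
  { rewrite <- F, Em2. ring. }
  change (Cmod (CI p a b) <= PI / (w * Rabs t)). rewrite G.
  assert (Hwm : Cmod (/ RtoC w) = / w) by (rewrite Cmod_inv, Cmod_R, Rabs_pos_eq by (trivial; lra); reflexivity).
  assert (BA : forall x : R, Cmod (A (RtoC x)) <= / w * / Cmod (z - RtoC x)).
  { intros x. unfold A. rewrite !Cmod_mult, Cmod_opp, Hwm, Cmod_inv by apply Hz.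
    apply Rmult_le_compat_l; [left; now apply Rinv_0_lt_compat|].
    rewrite <- (Rmult_1_l (/ Cmod (z - RtoC x))) at 2.
    apply Rmult_le_compat_r; [left; apply Rinv_0_lt_compat, Cmod_gt_0, Hz|].
    rewrite <- RtoC_mult. unfold Ccos, RtoC; simpl. rewrite cosh_0, sinh_0.
    replace (cos (w * x) * 1, - sin (w * x) * 0) with (RtoC (cos (w * x))) by (unfold RtoC; f_equal; ring).
    rewrite Cmod_R. pose proof (COS_bound (w * x)). apply Rabs_le. lra. }
  assert (Bq : Cmod (CI q a b) <= (atan ((s - a) / Rabs t) - atan ((s - b) / Rabs t)) / Rabs t).
  { pose proof (RInt_inv_sq s t a b Ht) as R1.
    rewrite <- (is_RInt_unique (V := R_CompleteNormedModule) _ _ _ _ R1).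
    apply CI_norm; trivial; [eexists; exact R1|].
    intros x _. unfold q. rewrite Cmod_div by (now apply Cmult_neq_0).
    unfold z; rewrite Cmod_mult, Cmod_R, Cmod_sub_R, sqrt_sqrt by (pose proof (pow2_ge_0 (s - x)); pose proof (pow2_ge_0 t); lra).
    unfold Rdiv. rewrite <- (Rmult_1_l (/ ((s - x) ^ 2 + t ^ 2))) at 2.
    apply Rmult_le_compat_r.
    - left. apply Rinv_0_lt_compat. rewrite <- (pow2_abs t). pose proof (pow2_ge_0 (s - x)). pose proof (pow_lt _ 2 T). lra.
    - pose proof (COS_bound (w * x)). apply Rabs_le. lra. }
  destruct (inv_Cmod_le_atan s t b Ht) as [Bb _]. destruct (inv_Cmod_le_atan s t a Ht) as [_ Ba].
  eapply Rle_trans; [apply Cmod_triangle|].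
  eapply Rle_trans; [apply Rplus_le_compat_r, Cmod_triangle|].
  rewrite Cmod_opp, Cmod_mult, Hwm.
  assert (W : 0 < / w) by now apply Rinv_0_lt_compat.
  pose proof (BA a) as BA1. pose proof (BA b) as BA2. fold z in Bb, Ba.
  apply Rle_trans with (/ w * ((PI / 2 + atan ((s - b) / Rabs t)) / Rabs t
     + (PI / 2 - atan ((s - a) / Rabs t)) / Rabs t
     + (atan ((s - a) / Rabs t) - atan ((s - b) / Rabs t)) / Rabs t)).
  - rewrite !Rmult_plus_distr_l.
    apply Rplus_le_compat; [apply Rplus_le_compat|].
    + eapply Rle_trans; [exact BA2|]. apply Rmult_le_compat_l; lra.
    + eapply Rle_trans; [exact BA1|]. apply Rmult_le_compat_l; lra.
    + apply Rmult_le_compat_l; lra.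
  - right. field. split; lra.
Qed.

(** * Finite sums and the integer grid *)

Definition Csum {A} (g : A -> C) (l : list A) : C := fold_right (fun a s => g a + s)%C 0%C l.

Lemma Csum_ext {A} (g k : A -> C) l : (forall a, In a l -> g a = k a) -> Csum g l = Csum k l.
Proof.
  induction l as [|a l IH]; intros H; simpl; [easy|].
  rewrite H by now left. f_equal. apply IH. intros; apply H; now right.
Qed.

Lemma Csum_scal {A} (c : C) (g : A -> C) l : Csum (fun a => c * g a)%C l = (c * Csum g l)%C.
Proof. induction l as [|a l IH]; simpl; [ring|]. rewrite IH. ring. Qed.

Lemma Csum_zero {A} (g : A -> C) l : (forall a, In a l -> g a = 0%C) -> Csum g l = 0%C.
Proof.
  induction l as [|a l IH]; intros H; simpl; [easy|].
  rewrite H by now left. rewrite IH; [ring|]. intros; apply H; now right.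
Qed.

Lemma Csum_single {A} (g : A -> C) l j : NoDup l -> In j l ->
  (forall k, In k l -> k <> j -> g k = 0%C) -> Csum g l = g j.
Proof.
  induction l as [|a l IH]; intros Hn Hj H; simpl; [easy|].
  inversion_clear Hn as [|? ? Ha Hn']. destruct Hj as [->|Hj].
  - rewrite Csum_zero; [ring|]. intros k Hk. apply H; [now right|]. intros ->. easy.
  - rewrite IH; trivial.
    + rewrite H; [ring|now left|]. intros ->. easy.
    + intros k Hk. apply H. now right.
Qed.

Lemma continuous_Csum {U : UniformSpace} {A} (g : A -> U -> C) l u :
  (forall a, In a l -> continuous (g a) u) -> continuous (fun v => Csum (fun a => g a v) l) u.
Proof.
  induction l as [|a l IH]; intros H; simpl.
  - apply continuous_Cconst.
  - apply continuous_Cplus; [apply H; now left|]. apply IH. intros; apply H; now right.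
Qed.

Lemma CI_Csum {A} (g : A -> R -> C) l a b :
  (forall k, In k l -> exCI (g k) a b) ->
  exCI (fun x => Csum (fun k => g k x) l) a b /\
  CI (fun x => Csum (fun k => g k x) l) a b = Csum (fun k => CI (g k) a b) l.
Proof.
  induction l as [|k l IH]; intros H; simpl.
  - split; [apply exCI_const|]. rewrite CI_const. ring.
  - destruct IH as [I1 I2]; [intros; apply H; now right|].
    assert (Hk : exCI (g k) a b) by (apply H; now left).
    split; [now apply exCI_plus|]. rewrite CI_plus by easy. now rewrite I2.
Qed.

(** The nodes inside a rectangle with vertical sides at plus and minus [(m + 1 / 2) * h]. *)
Definition zrange (m : nat) : list Z := map (fun j => (Z.of_nat j - Z.of_nat m)%Z) (seq 0 (2 * m + 1)).

Lemma In_zrange m k : In k (zrange m) <-> (- Z.of_nat m <= k <= Z.of_nat m)%Z.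
Proof.
  unfold zrange. rewrite in_map_iff. split.
  - intros (j & <- & Hj). apply in_seq in Hj. lia.
  - intros Hk. exists (Z.to_nat (k + Z.of_nat m)). split; [lia|]. apply in_seq. lia.
Qed.

Lemma NoDup_zrange m : NoDup (zrange m).
Proof. apply Injective_map_NoDup; [intros i j; lia|apply seq_NoDup]. Qed.

Lemma sin_PI_Z k : sin (PI * IZR k) = 0.
Proof. rewrite Rmult_comm. apply sin_eq_0_1. now exists k. Qed.

(** The sign at a node is needed only through its square, which avoids a case distinction on
    parity. *)
Lemma cos_PI_Z k : cos (PI * IZR k) * cos (PI * IZR k) = 1.
Proof. pose proof (sin2_cos2 (PI * IZR k)) as H. rewrite sin_PI_Z in H. unfold Rsqr in H. lra. Qed.

Section Discretization.

Variables (F : C -> C) (d h : R).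
Hypothesis Hh : 0 < h.
Hypothesis HF : forall z, Rabs (Im z) < d -> exists l, Cder F z l.

Let w := PI / h.

Lemma w_pos : 0 < w.
Proof. apply Rdiv_lt_0_compat; [apply PI_RGT_0|exact Hh]. Qed.

Lemma w_grid k : w * (IZR k * h) = PI * IZR k.
Proof. unfold w. field. lra. Qed.

Definition sinpi (z : C) : C := Csin (RtoC w * z).

Lemma sinpi_pair x y : sinpi (x, y) = Csin (w * x, w * y).
Proof. unfold sinpi. f_equal. unfold Cmult, RtoC; simpl. f_equal; ring. Qed.

Lemma sinpi_R x : sinpi (RtoC x) = RtoC (sin (w * x)).
Proof.
  unfold RtoC at 1. rewrite sinpi_pair. unfold Csin, RtoC; simpl.
  rewrite Rmult_0_r, cosh_0, sinh_0. f_equal; ring.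
Qed.

Lemma Cder_sinpi z : Cder sinpi z (RtoC w * Ccos (RtoC w * z)).
Proof.
  unfold sinpi. eapply Cder_eq.
  - apply (Cder_comp Csin (fun u => RtoC w * u)%C); [apply Cder_Csin|].
    apply Cder_mult; [apply Cder_const|apply Cder_id].
  - cbv beta. ring.
Qed.

Lemma sinpi_eq_0 x y : sinpi (x, y) = 0%C -> y = 0 /\ exists k, x = IZR k * h.
Proof.
  intros E. rewrite sinpi_pair in E. pose proof w_pos.
  destruct (Req_EM_T y 0) as [->|Hy].
  - split; [easy|]. destruct (Req_EM_T (sin (w * x)) 0) as [E1|N].
    + apply sin_eq_0_0 in E1. destruct E1 as [k Hk]. exists k.
      unfold w in Hk. pose proof PI_RGT_0.
      assert (E2 : PI * (x / h) = PI * IZR k) by (unfold Rdiv in *; rewrite <- Rmult_assoc; lra).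
      apply Rmult_eq_reg_l in E2; [|lra]. rewrite <- E2. field. lra.
    + exfalso. now apply (Csin_neq_0 (w * x) (w * 0)).
  - exfalso. apply (Csin_neq_0 (w * x) (w * y)); [|exact E].
    intros E1. apply Rmult_integral in E1. destruct E1; lra.
Qed.

(** The pointwise error comes first because the residue theorem speaks about it. By [is_derive_J]
    its integral in [x] is the error of the indefinite integration. *)
Definition sincerr (m : nat) (x : R) : C :=
  (F (RtoC x) - Csum (fun k => F (RtoC (IZR k * h)) * RtoC (sinc0 (PI * (x / h - IZR k)))) (zrange m))%C.

Definition kern (x : R) (z : C) : C := (F z / ((z - RtoC x) * sinpi z))%C.

Lemma sinc0_neq_0 x : x <> 0 -> sinc0 x = sin x / x.
Proof. unfold sinc0. now destruct (Req_EM_T x 0). Qed.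

(** [G] is the continuous extension of [(u - p) * H u], so the residue is its value at [p]. *)
Lemma simple_pole_intro (H G : C -> C) (p : R) (r : C) : continuous G (RtoC p) -> G (RtoC p) = r ->
  (exists delta, 0 < delta /\ forall u : C, u <> RtoC p -> Cmod (u - RtoC p) < delta ->
     ((u - RtoC p) * H u = G u)%C) -> simple_pole H p r.
Proof.
  intros Hc <- (d1 & Hd1 & HG) eps He.
  apply continuous_C_eps with (eps := eps) in Hc; [|easy].
  destruct Hc as (d2 & Hd2 & Hc).
  exists (Rmin d1 d2). split; [now apply Rmin_pos|]. intros u Hu Hd.
  rewrite HG; trivial.
  - left. apply Hc. exact (Rmin_lt_r _ _ _ Hd).
  - exact (Rmin_lt_l _ _ _ Hd).
Qed.

Lemma continuous_neq_0 (G : C -> C) (z : C) : continuous G z -> G z <> 0%C ->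
  exists delta, 0 < delta /\ forall u, Cmod (u - z) < delta -> G u <> 0%C.
Proof.
  intros Hc H0. apply continuous_C_eps with (eps := Cmod (G z)) in Hc; [|now apply Cmod_gt_0].
  destruct Hc as (d1 & Hd1 & Hc). exists d1. split; [easy|]. intros u Hu E.
  specialize (Hc u Hu). rewrite E in Hc. replace (0 - G z)%C with (- G z)%C in Hc by ring.
  rewrite Cmod_opp in Hc. lra.
Qed.

Lemma neq_sub (u v : C) : u <> v -> (u - v)%C <> 0%C.
Proof. intros H E. apply H. now apply Cminus_eq_0. Qed.

Hypothesis Hd : 0 < d.

Lemma F_continuous_R (x : R) : continuous F (RtoC x).
Proof.
  destruct (HF (RtoC x)) as [l Hl]; [simpl; now rewrite Rabs_R0|].
  eapply Cder_continuous, Hl.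
Qed.

(** The kernel has residue [F x / sin (w * x)] at [x] and [F (k * h) / (w * cos (PI * k) * (k * h -
    x))] at a node. Multiplied by [sin (w * x)], which equals [cos (PI * k) * sin (w * x - PI * k)],
    these become [F x] and minus the sinc terms. *)
Lemma sincerr_formula m y x : 0 < y < d -> Rabs x < (INR m + 1 / 2) * h ->
  (RtoC (sin (w * x)) * oint (kern x) (- ((INR m + 1 / 2) * h)) ((INR m + 1 / 2) * h) (- y) y
   = 2 * PI * Ci * sincerr m x)%C.
Proof.
  intros Hy Hx. set (a := (INR m + 1 / 2) * h) in *.
  pose proof w_pos as Hw. pose proof PI_RGT_0 as HPI. pose proof (pos_INR m) as Hm.
  assert (Ha : 0 < a) by (unfold a; apply Rmult_lt_0_compat; lra).
  apply Rabs_lt_between in Hx.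
  (* With half-integer sides no node lies on the contour. *)
  assert (Hgrid : forall k, (- Z.of_nat m <= k <= Z.of_nat m)%Z <-> - a < IZR k * h < a).
  { intros k. unfold a. rewrite INR_IZR_INZ. split.
    - intros [H1 H2]. apply IZR_le in H1, H2. rewrite opp_IZR in H1.
      split; nra.
    - intros [H1 H2].
      assert (A1 : IZR k < IZR (Z.of_nat m) + 1 / 2) by (apply (Rmult_lt_reg_r h); lra).
      assert (A2 : - (IZR (Z.of_nat m) + 1 / 2) < IZR k) by (apply (Rmult_lt_reg_r h); lra).
      split; apply Z.lt_succ_r, lt_IZR; rewrite ?succ_IZR, ?opp_IZR; lra. }
  destruct (Req_EM_T (sin (w * x)) 0) as [E0|Hsx].
  (* When [x] is itself a node the pole would be double. The formula then reads [0 = 0]: the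
     prefactor vanishes, and the interpolant reproduces [F] at its nodes. *)
  - rewrite E0. unfold sincerr.
    destruct (sinpi_eq_0 x 0) as [_ [j Hj]]; [change (sinpi (RtoC x) = 0%C); rewrite sinpi_R, E0; easy|].
    rewrite (Csum_single _ _ j).
    + rewrite <- Hj. replace (x / h - IZR j) with 0 by (rewrite Hj; field; lra).
      rewrite Rmult_0_r. unfold sinc0. destruct (Req_EM_T 0 0); [ring|easy].
    + apply NoDup_zrange.
    + apply In_zrange, Hgrid. rewrite <- Hj. exact Hx.
    + intros k _ Hk. rewrite Hj. replace (IZR j * h / h - IZR k) with (IZR (j - k)) by (rewrite minus_IZR; field; lra).
      rewrite sinc0_neq_0, sin_PI_Z; [unfold Rdiv; rewrite Rmult_0_l; ring|].
      apply Rmult_integral_contrapositive. split; [lra|]. apply not_0_IZR. lia.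
  - assert (Hxk : forall k, x <> IZR k * h).
    { intros k E. apply Hsx. rewrite E, w_grid. apply sin_PI_Z. }
    set (r := fun p : R => if Req_EM_T p x then (F (RtoC x) / RtoC (sin (w * x)))%C
                else (F (RtoC p) / (RtoC (w * cos (w * p) * (p - x))))%C).
    set (L := x :: map (fun k => IZR k * h) (zrange m)).
    assert (HL : forall p, In p L -> - a < p < a).
    { intros p [<-|Hp]; [lra|]. apply in_map_iff in Hp. destruct Hp as (k & <- & Hk).
      now apply Hgrid, In_zrange. }
    rewrite (residue_theorem (kern x) r L); [|lra|lra| | | | |].
    + simpl sum_inside. unfold inside at 1.
      destruct (Rlt_dec (- a) x); [|lra]. destruct (Rlt_dec x a); [|lra].
      (* Every node lies inside, so [inside] keeps each residue; the claim is made for sublists to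
         allow the induction. *)
      assert (E : forall l, (forall k, In k l -> In k (zrange m)) ->
         sum_inside (map (fun k => IZR k * h) l) r (- a) a = Csum (fun k => r (IZR k * h)) l).
      { induction l as [|k l IH]; intros Hl; simpl; [easy|].
        rewrite IH by (intros; apply Hl; now right). unfold inside.
        assert (Hk : - a < IZR k * h < a) by (apply Hgrid, In_zrange, Hl; now left).
        destruct (Rlt_dec (- a) (IZR k * h)); [|lra]. destruct (Rlt_dec (IZR k * h) a); [easy|lra]. }
      rewrite E by easy. unfold sincerr.
      assert (Es : RtoC (sin (w * x)) <> 0%C) by (intros E1; injection E1; easy).
      transitivity (2 * PI * Ci * (RtoC (sin (w * x)) * r x
         + Csum (fun k => RtoC (sin (w * x)) * r (IZR k * h)%R) (zrange m)))%C.
      { rewrite Csum_scal. ring. }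
      f_equal. unfold Cminus. f_equal.
      { unfold r. destruct (Req_EM_T x x); [|easy]. field. exact Es. }
      transitivity ((-1) * Csum (fun k => F (RtoC (IZR k * h)) * RtoC (sinc0 (PI * (x / h - IZR k)))) (zrange m))%C;
        [|ring].
      rewrite <- Csum_scal. apply Csum_ext. intros k _.
      unfold r. destruct (Req_EM_T (IZR k * h) x) as [E1|Hk]; [exfalso; now apply (Hxk k)|].
      assert (Hxh : x / h - IZR k <> 0).
      { intros E1. apply Hk. replace (IZR k) with (x / h) by lra. field. lra. }
      rewrite sinc0_neq_0 by (apply Rmult_integral_contrapositive; split; lra).
      replace (PI * (x / h - IZR k)) with (w * x - PI * IZR k) by (unfold w; field; lra).
      rewrite sin_minus, sin_PI_Z, w_grid.
      (* The sign [cc] is its own inverse, so it moves from the denominator of the residue to the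
         numerator. *)
      set (cc := cos (PI * IZR k)). assert (Hcc : cc * cc = 1) by apply cos_PI_Z.
      assert (Hc0 : cc <> 0) by (intros E1; rewrite E1 in Hcc; lra).
      unfold Cdiv. rewrite <- RtoC_inv.
      2:{ apply Rmult_integral_contrapositive. split; [|lra]. apply Rmult_integral_contrapositive. split; lra. }
      transitivity (F (RtoC (IZR k * h)) * RtoC (sin (w * x) * / (w * cc * (IZR k * h - x))))%C;
        [rewrite (RtoC_mult (sin (w * x))); ring|].
      transitivity (F (RtoC (IZR k * h)) * RtoC (- ((sin (w * x) * cc - cos (w * x) * 0) / (w * x - PI * IZR k))))%C;
        [|rewrite RtoC_opp; ring].
      f_equal. f_equal.
      replace (w * x - PI * IZR k) with (- (w * (IZR k * h - x))) by (unfold w; field; lra).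
      replace (/ (w * cc * (IZR k * h - x))) with (cc * cc * / (w * cc * (IZR k * h - x))) by (rewrite Hcc; ring).
      field. repeat split; lra.
    + constructor.
      * intros Hi. apply in_map_iff in Hi. destruct Hi as (k & E & _). now apply (Hxk k).
      * apply Injective_map_NoDup; [|apply NoDup_zrange]. intros i j E.
        apply Rmult_eq_reg_r in E; [|lra]. now apply eq_IZR.
    + intros Hi. apply HL in Hi. lra.
    + intros Hi. apply HL in Hi. lra.
    + intros s t Hs Ht Hn.
      assert (N1 : ((s, t) - RtoC x)%C <> 0%C).
      { apply RC_neq. destruct (Req_EM_T t 0) as [->|]; [left|now right].
        intros ->. apply Hn; [easy|now left]. }
      assert (N2 : sinpi (s, t) <> 0%C).
      { intros E. apply sinpi_eq_0 in E. destruct E as [-> [k ->]]. apply Hn; [easy|]. right.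
        apply in_map_iff. exists k. split; [easy|]. apply In_zrange.
        assert (Hk : - a <= IZR k * h <= a) by lra.
        unfold a in Hk. rewrite INR_IZR_INZ in Hk.
        assert (A1 : IZR k <= IZR (Z.of_nat m) + 1 / 2) by (apply (Rmult_le_reg_r h); lra).
        assert (A2 : - (IZR (Z.of_nat m) + 1 / 2) <= IZR k) by (apply (Rmult_le_reg_r h); lra).
        split; apply Z.lt_succ_r, lt_IZR; rewrite ?succ_IZR, ?opp_IZR; lra. }
      destruct (HF (s, t)) as [l Hl]; [simpl; apply Rabs_lt_between; lra|].
      eexists. unfold kern. apply Cder_mult; [exact Hl|].
      apply (Cder_inv (fun z => (z - RtoC x) * sinpi z)%C); [|now apply Cmult_neq_0].
      apply Cder_mult; [|apply Cder_sinpi]. apply Cder_minus; [apply Cder_id|apply Cder_const].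
    + intros p [<-|Hp].
      * apply (simple_pole_intro _ (fun z => F z / sinpi z)%C).
        -- apply continuous_Cdiv; [apply F_continuous_R|eapply Cder_continuous, Cder_sinpi|].
           rewrite sinpi_R. intros E1; injection E1; easy.
        -- unfold r. destruct (Req_EM_T x x); [|easy]. now rewrite sinpi_R.
        -- destruct (continuous_neq_0 sinpi (RtoC x)) as (d1 & Hd1 & HS).
           { eapply Cder_continuous, Cder_sinpi. }
           { rewrite sinpi_R. intros E1; injection E1; easy. }
           exists d1. split; [easy|]. intros u Hu Hud. unfold kern. field.
           split; [now apply HS|now apply neq_sub].
      * apply in_map_iff in Hp. destruct Hp as (k & <- & Hk). set (p := IZR k * h).
        (* As [sinpi] vanishes at [p], its slope function gives the factorization
           [sinpi z = phi z * (z - p)] near [p], and [F z / ((z - x) * phi z)] is the continuous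
           extension required. *)
        destruct (Cder_sinpi (RtoC p)) as (phi & Cphi & Pphi & d1 & Hd1 & Hphi).
        assert (Sp : sinpi (RtoC p) = 0%C) by (rewrite sinpi_R; unfold p; now rewrite w_grid, sin_PI_Z).
        assert (Cp : Ccos (RtoC w * RtoC p) = RtoC (cos (w * p))).
        { rewrite <- RtoC_mult. unfold Ccos, RtoC; simpl. rewrite cosh_0, sinh_0. f_equal; ring. }
        assert (Hcp : cos (w * p) <> 0).
        { unfold p. rewrite w_grid. intros E1. pose proof (cos_PI_Z k) as H. rewrite E1 in H. lra. }
        assert (Hpx : p - x <> 0) by (intros E1; apply (Hxk k); fold p; lra).
        assert (Pne : phi (RtoC p) <> 0%C).
        { rewrite Pphi, Cp, <- RtoC_mult. intros E1; injection E1.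
          apply Rmult_integral_contrapositive. split; lra. }
        assert (Nx : (RtoC p - RtoC x)%C <> 0%C).
        { apply neq_sub. intros E1; injection E1; lra. }
        apply (simple_pole_intro _ (fun z => F z / ((z - RtoC x) * phi z))%C).
        -- apply continuous_Cdiv; [apply F_continuous_R| |now apply Cmult_neq_0].
           apply continuous_Cmult; [|exact Cphi].
           apply continuous_Cminus; [apply continuous_Cid|apply continuous_Cconst].
        -- unfold r. destruct (Req_EM_T p x); [exfalso; lra|].
           rewrite Pphi, Cp, <- RtoC_minus, <- !RtoC_mult. f_equal. f_equal. ring.
        -- destruct (continuous_neq_0 phi (RtoC p) Cphi Pne) as (d2 & Hd2 & Hp2).
           destruct (continuous_neq_0 (fun z => z - RtoC x)%C (RtoC p)) as (d3 & Hd3 & Hp3); [|exact Nx|].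
           { apply continuous_Cminus; [apply continuous_Cid|apply continuous_Cconst]. }
           exists (Rmin d1 (Rmin d2 d3)). split; [repeat apply Rmin_pos; easy|].
           intros u Hu Hud.
           assert (U1 : Cmod (u - RtoC p) < d1) by (exact (Rmin_lt_l _ _ _ Hud)).
           assert (U2 : Cmod (u - RtoC p) < Rmin d2 d3) by (exact (Rmin_lt_r _ _ _ Hud)).
           assert (N1 : phi u <> 0%C) by (apply Hp2; exact (Rmin_lt_l _ _ _ U2)).
           assert (N2 : (u - RtoC p)%C <> 0%C) by now apply neq_sub.
           assert (N3 : (u - RtoC x)%C <> 0%C) by (apply Hp3; exact (Rmin_lt_r _ _ _ U2)).
           unfold kern. rewrite (Hphi u U1), Sp.
           replace (0 + phi u * (u - RtoC p))%C with (phi u * (u - RtoC p))%C by ring.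
           field. repeat split; trivial.
Qed.

End Discretization.

(** A pointwise bound in [x] would leave the integral of [1 / Cmod (z - x)], which grows with the
    interval. After the exchange the oscillatory integral is at most [h / Rabs t], uniformly in [s],
    [xi0] and [xi], and only the integral of the modulus of [F] remains. *)
Lemma horizontal_side_bound F d h t a xi0 xi Nn :
  0 < h -> (forall z, Rabs (Im z) < d -> exists l, Cder F z l) ->
  t <> 0 -> Rabs t < d -> 0 <= a -> xi0 <= xi ->
  RInt (fun s => Cmod (F (s, t))) (- a) a <= Nn ->
  exCI (fun x => CI (fun s => RtoC (sin (PI / h * x)) * kern F h x (s, t))%C (- a) a) xi0 xi /\
  Cmod (CI (fun x => CI (fun s => RtoC (sin (PI / h * x)) * kern F h x (s, t))%C (- a) a) xi0 xi)
    <= Nn * (h / Rabs t / sinh (PI / h * Rabs t)).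
Proof.
  intros Hh HF Ht Htd Ha Hxi HN.
  pose proof (w_pos h Hh) as Hw. set (w := PI / h) in *.
  assert (T : 0 < Rabs t) by now apply Rabs_pos_lt.
  assert (CF : forall s, continuous F ((s, t) : C)).
  { intros s. destruct (HF (s, t)) as [l Hl]; [exact Htd|]. eapply Cder_continuous, Hl. }
  assert (CFs : forall s, continuous (fun s : R => F (s, t)) s) by (intros; now apply continuous_horizontal).
  assert (CS : forall z, continuous (sinpi h) z) by (intros z; eapply Cder_continuous, Cder_sinpi).
  assert (Sne : forall s, sinpi h (s, t) <> 0%C).
  { intros s E. apply sinpi_eq_0 in E; [|exact Hh]. easy. }
  assert (Nne : forall s x : R, ((s, t) - RtoC x)%C <> 0%C) by (intros; now apply RC_sub_neq_0).
  set (k := fun x s : R => (RtoC (sin (w * x)) * kern F h x (s, t))%C).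
  assert (Ck : forall x s, continuous (fun p : R * R => k (fst p) (snd p)) (x, s)).
  { intros x s. unfold k, kern.
    assert (C1 : continuous (U := prod_UniformSpace R_UniformSpace R_UniformSpace)
                  (fun p : R * R => (snd p, t) : C) (x, s)).
    { apply (continuous_Cpair (fun p : R * R => snd p)); [apply continuous_snd|apply continuous_const]. }
    assert (C2 : continuous (U := prod_UniformSpace R_UniformSpace R_UniformSpace)
                  (fun p : R * R => RtoC (fst p)) (x, s)).
    { apply (continuous_RtoC (fun p : R * R => fst p)), continuous_fst. }
    apply (continuous_Cmult (fun p : R * R => RtoC (sin (w * fst p)))).
    - apply (continuous_RtoC (fun p : R * R => sin (w * fst p))).
      apply (continuous_comp (fun p : R * R => fst p) (fun x => sin (w * x))); [apply continuous_fst|].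
      apply (ex_derive_continuous (fun x => sin (w * x))). auto_derive. easy.
    - apply (continuous_Cdiv (fun p : R * R => F (snd p, t))
        (fun p : R * R => (((snd p, t) - RtoC (fst p)) * sinpi h (snd p, t))%C)).
      + apply (continuous_comp (fun p : R * R => (snd p, t) : C) F); [exact C1|apply CF].
      + apply (continuous_Cmult (fun p : R * R => ((snd p, t) - RtoC (fst p))%C)).
        * apply (continuous_Cminus (fun p : R * R => (snd p, t) : C)); [exact C1|exact C2].
        * apply (continuous_comp (fun p : R * R => (snd p, t) : C) (sinpi h)); [exact C1|apply CS].
      + simpl. apply Cmult_neq_0; [apply Nne|apply Sne]. }
  destruct (Fubini_C k xi0 xi (- a) a Hxi) as (I1 & I2 & I3); [lra|exact Ck|].
  split; [exact I1|]. change (Cmod (CI (fun x => CI (fun s => k x s) (- a) a) xi0 xi)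
    <= Nn * (h / Rabs t / sinh (w * Rabs t))). rewrite I3.
  assert (Hsh : 0 < sinh (w * Rabs t)) by (apply sinh_pos; now apply Rmult_lt_0_compat).
  set (M := h / Rabs t / sinh (w * Rabs t)).
  assert (HM : 0 <= M) by (left; unfold M; apply Rdiv_lt_0_compat; [now apply Rdiv_lt_0_compat|exact Hsh]).
  assert (EF : ex_RInt (fun s => Cmod (F (s, t))) (- a) a).
  { apply (ex_RInt_continuous (V := R_CompleteNormedModule)). intros s _.
    now apply (continuous_Cmod (fun s : R => F (s, t))). }
  apply Rle_trans with (RInt (fun s => M * Cmod (F (s, t))) (- a) a).
  - apply CI_norm; [lra|exact I2|now apply ex_RInt_Rmult|].
    intros s _.
    set (g := fun x => (RtoC (sin (w * x)) / ((s, t) - RtoC x))%C).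
    assert (Eg : exCI g xi0 xi).
    { apply exCI_continuous. intros x _. apply continuous_Cdiv; [| |apply Nne].
      - apply continuous_RtoC, (ex_derive_continuous (fun x => sin (w * x))). auto_derive. easy.
      - apply continuous_Cminus; [apply continuous_Cconst|apply continuous_RtoC, continuous_id]. }
    rewrite (CI_ext _ (fun x => (F (s, t) / sinpi h (s, t)) * g x)%C).
    2:{ intros x _. unfold k, kern, g. field. split; [apply Nne|apply Sne]. }
    rewrite (proj2 (CI_scal _ g _ _ Eg)), Cmod_mult, Cmod_div by apply Sne.
    pose proof (osc_integral_bound w s t xi0 xi Hw Ht Hxi) as B.
    fold g in B.
    assert (HS : sinh (w * Rabs t) <= Cmod (sinpi h (s, t))).
    { rewrite sinpi_pair. eapply Rle_trans; [|apply Cmod_Csin_ge_sinh].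
      fold w. unfold Rabs at 1. destruct Rcase_abs.
      - replace (w * - t) with (- (w * t)) by ring. rewrite sinh_opp, <- Rabs_Ropp. apply Rle_abs.
      - apply Rle_abs. }
    replace (M * Cmod (F (s, t))) with (Cmod (F (s, t)) * / sinh (w * Rabs t) * (PI / (w * Rabs t))).
    2:{ unfold M, w. pose proof PI_RGT_0. field. fold w. repeat split; lra. }
    apply Rmult_le_compat; [|apply Cmod_ge_0| |exact B].
    + apply Rmult_le_pos; [apply Cmod_ge_0|]. left. apply Rinv_0_lt_compat. lra.
    + apply Rmult_le_compat_l; [apply Cmod_ge_0|]. apply Rinv_le_contravar; lra.
  - rewrite RInt_Rmult by exact EF. rewrite Rmult_comm. apply Rmult_le_compat_r; [exact HM|exact HN].
Qed.

(** The vertical sides are bounded crudely: the sine has modulus at least one there, and the margin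
    [1] between [[xi0, xi]] and the sides keeps [z - x] away from zero. Their two lengths [2 * y]
    give [4 * y * Mv], which later tends to zero. *)
Lemma discretization_bound F d h y m xi0 xi Nn Mv :
  0 < h -> (forall z, Rabs (Im z) < d -> exists l, Cder F z l) -> 0 < y < d -> xi0 <= xi ->
  let a := (INR m + 1 / 2) * h in
  - a + 1 <= xi0 -> xi <= a - 1 ->
  (forall t, - y <= t <= y -> Cmod (F (a, t)) <= Mv /\ Cmod (F (- a, t)) <= Mv) ->
  RInt (fun s => Cmod (F (s, y))) (- a) a <= Nn -> RInt (fun s => Cmod (F (s, - y))) (- a) a <= Nn ->
  Cmod (CI (sincerr F h m) xi0 xi)
    <= (2 * (Nn * (h / y / sinh (PI / h * y))) + (xi - xi0) * (4 * y * Mv)) / (2 * PI).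
Proof.
  intros Hh HF Hy Hxi a Ha0 Ha1 HM HN1 HN2.
  pose proof PI_RGT_0 as HPI. pose proof (w_pos h Hh) as Hw. pose proof (pos_INR m) as Hm.
  assert (Ha : 0 < a) by (unfold a; apply Rmult_lt_0_compat; lra).
  assert (Ay : Rabs y = y) by (apply Rabs_pos_eq; lra).
  assert (Any : Rabs (- y) = y) by (rewrite Rabs_Ropp; exact Ay).
  destruct (horizontal_side_bound F d h y a xi0 xi Nn) as [T1 T2]; trivial; [lra|rewrite Ay; lra|lra|].
  destruct (horizontal_side_bound F d h (- y) a xi0 xi Nn) as [B1 B2]; trivial; [lra|rewrite Any; lra|lra|].
  rewrite Ay in T2. rewrite Any in B2.
  set (w := PI / h) in *.
  set (kt := fun x => CI (fun s => RtoC (sin (w * x)) * kern F h x (s, y))%C (- a) a) in *.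
  set (kb := fun x => CI (fun s => RtoC (sin (w * x)) * kern F h x (s, - y)%R)%C (- a) a) in *.
  set (E := sincerr F h m).
  set (c := (2 * PI * Ci)%C).
  assert (Cc : Cmod c = 2 * PI).
  { unfold c. rewrite !Cmod_mult, Cmod_Ci, !Cmod_R, !Rabs_pos_eq by lra. ring. }
  assert (EE : exCI E xi0 xi).
  { apply exCI_continuous. intros x _. unfold E, sincerr. apply continuous_Cminus.
    - apply (continuous_comp (V := C_UniformSpace) (fun x : R => RtoC x) F);
        [apply continuous_RtoC, continuous_id|]. apply (F_continuous_R F d); [exact HF|lra].
    - apply (continuous_Csum (fun k x => F (RtoC (IZR k * h)) * RtoC (sinc0 (PI * (x / h - IZR k))))%C).
      intros k _. apply continuous_Cmult; [apply continuous_Cconst|]. apply continuous_RtoC.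
      apply (continuous_comp (fun x => PI * (x / h - IZR k)) sinc0); [|apply continuous_sinc0].
      apply (ex_derive_continuous (fun x => PI * (x / h - IZR k))). auto_derive. lra. }
  destruct (CI_scal c E xi0 xi EE) as [cE1 cE2].
  destruct (CI_minus _ _ _ _ cE1 B1) as [D1 D2].
  (* The error without its horizontal part. By the residue formula it equals the vertical part, so
     it can be bounded pointwise in [x], while the horizontal part has to be integrated first. *)
  set (V := fun x => (c * E x - kb x + kt x)%C).
  assert (V1 : exCI V xi0 xi) by now apply exCI_plus.
  assert (V2 : CI V xi0 xi = (c * CI E xi0 xi - CI kb xi0 xi + CI kt xi0 xi)%C).
  { unfold V. rewrite CI_plus by easy. now rewrite D2, cE2. }
  (* At the abscissa [(m + 1 / 2) * h] the real sine is plus or minus one. *)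
  assert (Sa : forall t, 1 <= Cmod (sinpi h (a, t)) /\ 1 <= Cmod (sinpi h (- a, t))).
  { assert (Es : Rabs (sin (w * a)) = 1).
    { replace (w * a) with (PI * IZR (Z.of_nat m) + PI / 2) by (unfold w, a; rewrite <- INR_IZR_INZ; field; lra).
      rewrite sin_plus, sin_PI_Z, sin_PI2, cos_PI2.
      replace (0 * 0 + cos (PI * IZR (Z.of_nat m)) * 1) with (cos (PI * IZR (Z.of_nat m))) by ring.
      pose proof (cos_PI_Z (Z.of_nat m)) as H. set (q := cos _) in *.
      assert (H1 : (q - 1) * (q + 1) = 0) by lra.
      apply Rmult_integral in H1. unfold Rabs. destruct Rcase_abs; destruct H1; lra. }
    intros t. rewrite !sinpi_pair. fold w. split; rewrite <- Es.
    - apply Cmod_Csin_ge_sin.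
    - replace (w * - a) with (- (w * a)) by ring.
      rewrite <- Rabs_Ropp, <- sin_neg. apply Cmod_Csin_ge_sin. }
  assert (HMv : 0 <= Mv). { destruct (HM 0) as [H _]; [lra|]. pose proof (Cmod_ge_0 (F (a, 0))). lra. }
  assert (VB : forall x, xi0 <= x <= xi -> Cmod (V x) <= 4 * y * Mv).
  { intros x Hx.
    assert (Hk : forall b, b = a \/ b = - a -> forall t, - y <= t <= y -> Cmod (kern F h x (b, t)) <= Mv).
    { intros b Hb t Ht. unfold kern.
      assert (Fb : Cmod (F (b, t)) <= Mv) by (destruct Hb as [->| ->]; apply HM; exact Ht).
      assert (Sb : 1 <= Cmod (sinpi h (b, t))) by (destruct Hb as [->| ->]; apply Sa).
      assert (Db : 1 <= Cmod ((b, t) - RtoC x)).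
      { rewrite Cmod_sub_R. rewrite <- sqrt_1. apply sqrt_le_1_alt.
        pose proof (pow2_ge_0 t). destruct Hb as [->| ->]; nra. }
      rewrite Cmod_div, Cmod_mult.
      - rewrite <- (Rmult_1_r Mv). apply Rmult_le_compat; [apply Cmod_ge_0| |exact Fb|].
        + left. apply Rinv_0_lt_compat. nra.
        + rewrite <- Rinv_1. apply Rinv_le_contravar; nra.
      - apply Cmult_neq_0; apply Cmod_gt_0; lra. }
    assert (Hkc : forall b, b = a \/ b = - a -> forall t, - y <= t <= y -> continuous (kern F h x) ((b, t) : C)).
    { intros b Hb t Ht. unfold kern. apply continuous_Cdiv.
      - destruct (HF (b, t)) as [l Hl]; [simpl; apply Rabs_lt_between; lra|]. eapply Cder_continuous, Hl.
      - apply continuous_Cmult; [|eapply Cder_continuous, Cder_sinpi].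
        apply continuous_Cminus; [apply continuous_Cid|apply continuous_Cconst].
      - apply Cmult_neq_0.
        + apply RC_neq. left. destruct Hb; lra.
        + apply Cmod_gt_0. destruct Hb as [->| ->]; destruct (Sa t); lra. }
    assert (Hside : forall b, b = a \/ b = - a ->
       exCI (fun t => kern F h x (b, t)) (- y) y /\ Cmod (CI (fun t => kern F h x (b, t)) (- y) y) <= 2 * y * Mv).
    { intros b Hb. assert (X : exCI (fun t => kern F h x (b, t)) (- y) y).
      { apply exCI_vertical; [lra|]. intros; now apply Hkc. }
      split; [exact X|]. replace (2 * y * Mv) with ((y - - y) * Mv) by ring.
      apply CI_norm_const; [lra|exact X|]. intros; now apply Hk. }
    destruct (Hside a (or_introl eq_refl)) as [_ R1].
    destruct (Hside (- a) (or_intror eq_refl)) as [_ L1].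
    assert (Hhor : forall t, t = y \/ t = - y -> exCI (fun s => kern F h x (s, t)) (- a) a).
    { intros t Ht. apply exCI_horizontal; [lra|]. intros s _. unfold kern. apply continuous_Cdiv.
      - destruct (HF (s, t)) as [l Hl]; [simpl; apply Rabs_lt_between; destruct Ht; lra|]. eapply Cder_continuous, Hl.
      - apply continuous_Cmult; [|eapply Cder_continuous, Cder_sinpi].
        apply continuous_Cminus; [apply continuous_Cid|apply continuous_Cconst].
      - apply Cmult_neq_0.
        + apply RC_neq. right. destruct Ht; lra.
        + intros E0. apply sinpi_eq_0 in E0; [|exact Hh]. destruct Ht; lra. }
    assert (Eq : V x = (RtoC (sin (w * x)) * (Ci * CI (fun t => kern F h x (a, t)) (- y) y
        - Ci * CI (fun t => kern F h x (- a, t)%R) (- y) y))%C).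
    { unfold V, E, c. rewrite <- (sincerr_formula F d h Hh HF) with (y := y); [|lra|exact Hy|apply Rabs_lt_between; fold a; lra].
      fold w a. unfold oint, kb, kt.
      rewrite (proj2 (CI_scal _ _ _ _ (Hhor y (or_introl eq_refl)))).
      rewrite (proj2 (CI_scal _ _ _ _ (Hhor (- y) (or_intror eq_refl)))). ring. }
    rewrite Eq, Cmod_mult, Cmod_R.
    assert (Rabs (sin (w * x)) <= 1) by (pose proof (SIN_bound (w * x)); apply Rabs_le; lra).
    pose proof (Rabs_pos (sin (w * x))).
    set (CR := CI (fun t => kern F h x (a, t)) (- y) y) in *.
    set (CL := CI (fun t => kern F h x (- a, t)) (- y) y) in *.
    assert (Cmod (Ci * CR - Ci * CL) <= 4 * y * Mv).
    { unfold Cminus. eapply Rle_trans; [apply Cmod_triangle|]. rewrite Cmod_opp, !Cmod_mult, Cmod_Ci. lra. }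
    pose proof (Cmod_ge_0 (Ci * CR - Ci * CL)). nra. }
  assert (VN : Cmod (CI V xi0 xi) <= (xi - xi0) * (4 * y * Mv)) by now apply CI_norm_const.
  assert (Fin : (c * CI E xi0 xi = CI V xi0 xi + (CI kb xi0 xi - CI kt xi0 xi))%C) by (rewrite V2; ring).
  assert (FN : 2 * PI * Cmod (CI E xi0 xi)
     <= 2 * (Nn * (h / y / sinh (w * y))) + (xi - xi0) * (4 * y * Mv)).
  { rewrite <- Cc, <- Cmod_mult, Fin. eapply Rle_trans; [apply Cmod_triangle|].
    assert (Cmod (CI kb xi0 xi - CI kt xi0 xi) <= Cmod (CI kb xi0 xi) + Cmod (CI kt xi0 xi)).
    { unfold Cminus. eapply Rle_trans; [apply Cmod_triangle|]. rewrite Cmod_opp. lra. }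
    lra. }
  apply (Rmult_le_reg_l (2 * PI)); [lra|].
  eapply Rle_trans; [exact FN|]. right.
  set (X := 2 * (Nn * (h / y / sinh (w * y))) + (xi - xi0) * (4 * y * Mv)).
  clear - HPI. field. lra.
Qed.

(** * Growth of the transformed integrand in the strip *)

(* With [B = q * c], [sin B ^ 2 - sin q ^ 2 = sin (B - q) * sin (B + q)].  As long as [B + q <= PI],
   [sin (B + q) <= (B + q) * sin (2 * q) / (2 * q)]; beyond that the crude bound [cos q ^ 2] is enough. *)
Lemma sin_dilate_pos q c : 0 < q < PI / 2 -> 1 <= c ->
  sin (q * c) ^ 2 <= (1 + ((PI / 2) ^ 2 - q ^ 2) * (c ^ 2 - 1)) * sin q ^ 2.
Proof.
  intros Hq Hc. pose proof PI_RGT_0 as HPI.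
  set (B := q * c). set (r := PI / 2 - q).
  assert (HB : q <= B) by (unfold B; nra).
  assert (Hr : 0 < r) by (unfold r; lra).
  assert (Hj : 2 / PI * q <= sin q) by (apply jordan; lra).
  assert (Hcos : 0 <= cos q <= r).
  { split; [apply cos_ge_0; lra|]. rewrite <- sin_shift. fold r. left. now apply sin_lt_x. }
  assert (Hs0 : 0 < sin q) by (apply sin_gt_0; lra).
  assert (HqPI : q <= PI / 2 * sin q).
  { apply (Rmult_le_compat_l (PI / 2)) in Hj; [|lra].
    replace (PI / 2 * (2 / PI * q)) with q in Hj by (field; lra). exact Hj. }
  assert (HB2 : q ^ 2 * (c ^ 2 - 1) = (B - q) * (B + q)) by (unfold B; ring).
  assert (Hp : (PI / 2) ^ 2 - q ^ 2 = r * (PI / 2 + q)) by (unfold r; ring).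
  assert (Hc2 : 0 <= c ^ 2 - 1) by nra.
  assert (Hdiff : sin B ^ 2 - sin q ^ 2 = sin (B - q) * sin (B + q)).
  { rewrite sin_minus, sin_plus. pose proof (sin2_cos2 B) as H1. pose proof (sin2_cos2 q) as H2.
    unfold Rsqr in *. apply Rminus_diag_uniq.
    transitivity (sin B ^ 2 * (1 - (sin q * sin q + cos q * cos q)) - sin q ^ 2 * (1 - (sin B * sin B + cos B * cos B)));
      [ring|rewrite H1, H2; ring]. }
  cut (sin B ^ 2 - sin q ^ 2 <= r * (PI / 2 + q) * (c ^ 2 - 1) * sin q ^ 2).
  { rewrite Hp. fold B. intros. lra. }
  destruct (Rle_dec (B + q) PI) as [Hle|Hgt].
  - rewrite Hdiff.
    assert (S1 : 0 <= sin (B - q) <= B - q).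
    { destruct HB as [HB|HB].
      - split; [apply sin_ge_0; lra|]. left. apply sin_lt_x. lra.
      - rewrite <- HB, Rminus_diag, sin_0. lra. }
    assert (S2 : 0 <= sin (B + q)) by (apply sin_ge_0; lra).
    assert (S3 : 2 * q * sin (B + q) <= (B + q) * sin (2 * q)) by (apply sin_div_decr; lra).
    rewrite sin_2a in S3.
    assert (S4 : q * sin (B + q) <= (B + q) * (sin q * cos q)) by lra.
    assert (S5 : q * (sin (B - q) * sin (B + q)) <= q * (q * (c ^ 2 - 1) * (sin q * cos q))).
    { replace (q * (q * (c ^ 2 - 1) * (sin q * cos q))) with (q ^ 2 * (c ^ 2 - 1) * (sin q * cos q)) by ring.
      rewrite HB2.
      replace (q * (sin (B - q) * sin (B + q))) with (sin (B - q) * (q * sin (B + q))) by ring.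
      replace ((B - q) * (B + q) * (sin q * cos q)) with ((B - q) * ((B + q) * (sin q * cos q))) by ring.
      apply Rmult_le_compat; try lra. apply Rmult_le_pos; lra. }
    apply Rmult_le_reg_l in S5; [|lra].
    eapply Rle_trans; [exact S5|].
    replace (q * (c ^ 2 - 1) * (sin q * cos q)) with ((c ^ 2 - 1) * sin q * (q * cos q)) by ring.
    replace (r * (PI / 2 + q) * (c ^ 2 - 1) * sin q ^ 2)
      with ((c ^ 2 - 1) * sin q * (r * (PI / 2 + q) * sin q)) by ring.
    apply Rmult_le_compat_l; [apply Rmult_le_pos; lra|].
    apply Rle_trans with (r * q).
    + rewrite (Rmult_comm r). apply Rmult_le_compat_l; lra.
    + rewrite Rmult_assoc. apply Rmult_le_compat_l; [lra|]. nra.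
  - assert (Hup : sin B ^ 2 - sin q ^ 2 <= r ^ 2).
    { pose proof (sin2_cos2 B) as H1. pose proof (sin2_cos2 q) as H2. unfold Rsqr in *.
      pose proof (pow2_ge_0 (cos B)). nra. }
    eapply Rle_trans; [exact Hup|].
    assert (Hs2 : q ^ 2 <= (PI / 2) ^ 2 * sin q ^ 2) by (rewrite <- Rpow_mult_distr; apply pow_incr; lra).
    (* Here [B + q > PI], hence also [B - q > PI - 2 * q = 2 * r]. *)
    assert (HBq : 2 * r * PI <= q ^ 2 * (c ^ 2 - 1)).
    { rewrite HB2. apply Rmult_le_compat; unfold r; lra. }
    assert (H1 : 2 * r * PI <= (PI / 2) ^ 2 * sin q ^ 2 * (c ^ 2 - 1)).
    { eapply Rle_trans; [exact HBq|]. apply Rmult_le_compat_r; lra. }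
    assert (H2 : 8 * r <= PI * (sin q ^ 2 * (c ^ 2 - 1))).
    { apply (Rmult_le_reg_l (PI / 4)); [lra|].
      replace (PI / 4 * (8 * r)) with (2 * r * PI) by field.
      replace (PI / 4 * (PI * (sin q ^ 2 * (c ^ 2 - 1)))) with ((PI / 2) ^ 2 * sin q ^ 2 * (c ^ 2 - 1)) by field.
      exact H1. }
    assert (H3 : 0 <= sin q ^ 2 * (c ^ 2 - 1)) by (apply Rmult_le_pos; [apply pow2_ge_0|lra]).
    replace (r * (PI / 2 + q) * (c ^ 2 - 1) * sin q ^ 2) with (r * ((PI / 2 + q) * (sin q ^ 2 * (c ^ 2 - 1)))) by ring.
    simpl pow at 1. rewrite Rmult_1_r. apply Rmult_le_compat_l; [lra|]. nra.
Qed.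

Lemma sin_dilate q c : Rabs q < PI / 2 -> 1 <= c ->
  sin (q * c) ^ 2 <= (1 + ((PI / 2) ^ 2 - q ^ 2) * (c ^ 2 - 1)) * sin q ^ 2.
Proof.
  intros Hq Hc. apply Rabs_lt_between in Hq. destruct (Rtotal_order q 0) as [H|[->|H]].
  - pose proof (sin_dilate_pos (- q) c) as P.
    replace (- q * c) with (- (q * c)) in P by ring. rewrite !sin_neg in P.
    replace ((- sin (q * c)) ^ 2) with (sin (q * c) ^ 2) in P by ring.
    replace ((- sin q) ^ 2) with (sin q ^ 2) in P by ring.
    replace ((- q) ^ 2) with (q ^ 2) in P by ring. apply P; lra.
  - rewrite Rmult_0_l, sin_0. lra.
  - apply sin_dilate_pos; lra.
Qed.

Lemma le_sinh u : 0 <= u -> u <= sinh u.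
Proof.
  intros [Hu|<-]; [|rewrite sinh_0; lra].
  destruct (MVT_is_derive sinh cosh 0 u Hu) as (x & Hx & _).
  - intros x _. apply is_derive_Reals, derivable_pt_lim_sinh.
  - rewrite sinh_0 in Hx. pose proof (cosh_ge_1 x). nra.
Qed.

Lemma cosh2_ge a : 1 + a ^ 2 <= cosh a ^ 2.
Proof.
  rewrite cosh2.
  destruct (Rle_dec 0 a).
  - pose proof (le_sinh a). nra.
  - pose proof (le_sinh (- a)) as P. rewrite sinh_opp in P. nra.
Qed.

Lemma sin_bound_strip y : Rabs y < PI / 2 -> Rabs (PI / 2 * sin y) < PI / 2.
Proof.
  intros Hy. pose proof PI_RGT_0. apply Rabs_lt_between in Hy.
  assert (0 < cos y) by (apply cos_gt_0; lra).
  pose proof (sin2_cos2 y) as H1. unfold Rsqr in H1.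
  rewrite Rabs_mult, Rabs_pos_eq by lra.
  assert (Rabs (sin y) < 1); [|nra].
  apply Rabs_lt_between. split; nra.
Qed.

(** Put [A = (PI / 2) * sinh x * cos y], [B = q * cosh x] and [E = exp A]. The squared right side is
    [(1 + E ^ 2) ^ 2 - 4 * E ^ 2 * sin B ^ 2], and [(1 + E ^ 2) ^ 2 = 4 * E ^ 2 * cosh A ^ 2]. What
    remains is [sin B ^ 2 <= cosh A ^ 2 * sin q ^ 2]; it follows from [sin_dilate], whose factor is
    exactly [1 + A ^ 2] here. *)
Lemma one_plus_exp_sinh x y : Rabs y < PI / 2 ->
  (1 + exp (PI * (sinh x * cos y))) * cos (PI / 2 * sin y)
   <= Cmod (1 + Cexp (PI * (sinh x * cos y), PI * (cosh x * sin y))).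
Proof.
  intros Hy. set (q := PI / 2 * sin y). set (A := PI / 2 * (sinh x * cos y)).
  pose proof (sin_bound_strip y Hy) as Hq. fold q in Hq.
  assert (Hcq : 0 < cos q) by (apply Rabs_lt_between in Hq; apply cos_gt_0; lra).
  pose proof (exp_pos (PI * (sinh x * cos y))) as HE0.
  apply Rsqr_incr_0; [|apply Rmult_le_pos; lra|apply Cmod_ge_0].
  rewrite !Rsqr_pow2, Cmod2_alt. unfold Cexp, Cplus, RtoC; simpl Re; simpl Im.
  replace (PI * (sinh x * cos y)) with (A + A) by (unfold A; field).
  replace (PI * (cosh x * sin y)) with (2 * (q * cosh x)) by (unfold q; field).
  rewrite exp_plus. set (E := exp A). assert (HE : 0 < E) by apply exp_pos.
  set (B := q * cosh x).
  rewrite cos_2a_sin.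
  replace ((1 + E * E * (1 - 2 * sin B * sin B)) ^ 2 + (0 + E * E * sin (2 * B)) ^ 2)
    with ((1 + E ^ 2) ^ 2 - 4 * E ^ 2 * sin B ^ 2).
  2:{ rewrite sin_2a. pose proof (sin2_cos2 B) as H1. unfold Rsqr in H1.
      replace ((0 + E * E * (2 * sin B * cos B)) ^ 2) with (4 * E ^ 4 * sin B ^ 2 * (cos B * cos B)) by ring.
      replace (cos B * cos B) with (1 - sin B * sin B) by lra. ring. }
  assert (Hch : (1 + E ^ 2) ^ 2 = 4 * E ^ 2 * cosh A ^ 2).
  { unfold cosh. rewrite exp_Ropp. fold E. field. lra. }
  pose proof (sin_dilate q (cosh x) Hq (cosh_ge_1 x)) as HS. fold B in HS.
  rewrite cosh2 in HS.
  assert (HA : ((PI / 2) ^ 2 - q ^ 2) * (1 + sinh x ^ 2 - 1) = A ^ 2).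
  { unfold q, A. pose proof (sin2_cos2 y) as H1. unfold Rsqr in H1.
    replace ((PI / 2 * (sinh x * cos y)) ^ 2) with ((PI / 2) ^ 2 * sinh x ^ 2 * (cos y * cos y)) by ring.
    replace (cos y * cos y) with (1 - sin y * sin y) by lra. ring. }
  rewrite HA in HS. pose proof (cosh2_ge A) as HC.
  pose proof (sin2_cos2 q) as Hq2. unfold Rsqr in Hq2.
  assert (Hsq : sin q ^ 2 = 1 - cos q ^ 2) by (simpl; lra).
  assert (HSC : sin B ^ 2 <= cosh A ^ 2 * sin q ^ 2).
  { eapply Rle_trans; [exact HS|]. apply Rmult_le_compat_r; [apply pow2_ge_0|exact HC]. }
  replace (((1 + E * E) * cos q) ^ 2) with ((1 + E ^ 2) ^ 2 * cos q ^ 2) by ring.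
  replace (cos q ^ 2) with (1 - sin q ^ 2) by lra.
  rewrite Hch.
  assert (0 < 4 * E ^ 2) by (pose proof (pow_lt E 2 HE); lra). nra.
Qed.

(** Lets constants that depend on the height [t] be replaced by their values at [d]. *)
Lemma cos_strip_mono t d : Rabs t < d -> d < PI / 2 ->
  cos d <= cos t /\ 0 < cos d /\ cos (PI / 2 * sin d) <= cos (PI / 2 * sin t) /\ 0 < cos (PI / 2 * sin d).
Proof.
  intros Ht Hd. pose proof PI_RGT_0.
  assert (Hd0 : 0 <= d) by (pose proof (Rabs_pos t); lra).
  assert (Ev : forall u, cos u = cos (Rabs u)).
  { intros u. unfold Rabs. destruct Rcase_abs; [now rewrite cos_neg|easy]. }
  assert (Es : Rabs (PI / 2 * sin t) <= PI / 2 * sin d).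
  { assert (S : Rabs (sin t) <= sin d).
    { apply Rabs_lt_between in Ht. apply Rabs_le. split.
      - rewrite <- sin_neg. left. apply sin_increasing_1; lra.
      - left. apply sin_increasing_1; lra. }
    rewrite Rabs_mult, Rabs_pos_eq by lra. nra. }
  assert (Sd : Rabs (PI / 2 * sin d) < PI / 2) by (apply sin_bound_strip; rewrite Rabs_pos_eq; lra).
  assert (Sd0 : 0 <= PI / 2 * sin d) by (apply Rmult_le_pos; [lra|apply sin_ge_0; lra]).
  rewrite Rabs_pos_eq in Sd by exact Sd0.
  split; [|split; [apply cos_gt_0; lra|split; [|apply cos_gt_0; lra]]].
  - rewrite (Ev t). pose proof (Rabs_pos t). apply cos_decr_1; lra.
  - rewrite (Ev (PI / 2 * sin t)). pose proof (Rabs_pos (PI / 2 * sin t)). apply cos_decr_1; lra.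
Qed.

Lemma Cmod_Ccosh x y : Cmod (Ccosh (x, y)) <= cosh x.
Proof.
  pose proof (cosh_ge_1 x).
  apply Rsqr_incr_0; [|apply Cmod_ge_0|lra].
  rewrite !Rsqr_pow2, Cmod2_alt. unfold Ccosh; simpl Re; simpl Im.
  pose proof (cosh2 x) as H1. pose proof (sin2_cos2 y) as H2. unfold Rsqr in H2.
  replace ((cosh x * cos y) ^ 2 + (sinh x * sin y) ^ 2)
    with (cosh x ^ 2 * (cos y * cos y) + sinh x ^ 2 * (sin y * sin y)) by ring.
  replace (cos y * cos y) with (1 - sin y * sin y) by lra.
  pose proof (Rle_0_sqr (sin y)). unfold Rsqr in *. nra.
Qed.

Definition pullback (f : C -> C) (z : C) : C := (f (Cpsi z) * (Cpsi z * (RtoC (PI / 2) * Ccosh z)))%C.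

Lemma Cmod_Cpsi x y : Cmod (Cpsi (x, y)) = exp (PI / 2 * (sinh x * cos y)).
Proof.
  unfold Cpsi. rewrite Cmod_Cexp, Csinh_pair. f_equal. simpl. ring.
Qed.

Lemma Rpower_exp a s : Rpower (exp a) s = exp (s * a).
Proof. unfold Rpower. now rewrite ln_exp. Qed.

(** With [X] the logarithm of the modulus of [Cpsi], the integrand is at most a constant times [cosh
    x * exp (alpha * X) / (1 + exp (2 * X)) ^ g], where [2 * g = alpha + beta]. Bounding the
    denominator below by [1] gives the first estimate, by [exp (2 * g * X)] the second; they decay
    to the left and to the right. *)
Lemma pullback_bound f d K alpha beta x t :
  0 < K -> 0 < alpha -> 0 < beta -> d < PI / 2 -> Rabs t < d ->
  (forall z : C, psi_strip d z ->
     Cmod (f z) <= K * (abs_cpow z (alpha - 1) / abs_cpow (1 + z * z)%C ((alpha + beta) / 2))) ->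
  let D := PI * K / 2 / Rpower (cos (PI / 2 * sin t)) ((alpha + beta) / 2) in
  Cmod (pullback f (x, t)) <= D * (cosh x * exp (alpha * (PI / 2 * (sinh x * cos t)))) /\
  Cmod (pullback f (x, t)) <= D * (cosh x * exp (- beta * (PI / 2 * (sinh x * cos t)))).
Proof.
  intros HK Ha Hb Hd Ht Hf D. pose proof PI_RGT_0 as HPI.
  destruct (cos_strip_mono t d Ht Hd) as (_ & _ & Hc1 & Hc2).
  set (cq := cos (PI / 2 * sin t)) in *. set (g := (alpha + beta) / 2) in *.
  set (X := PI / 2 * (sinh x * cos t)).
  assert (Hz : psi_strip d (Cpsi (x, t))) by (exists (x, t); split; [exact Ht|easy]).
  specialize (Hf _ Hz). unfold abs_cpow in Hf. rewrite Cmod_Cpsi in Hf. fold X in Hf.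
  rewrite Rpower_exp in Hf.
  assert (Hsq : (Cpsi (x, t) * Cpsi (x, t))%C = Cexp (PI * (sinh x * cos t), PI * (cosh x * sin t))).
  { unfold Cpsi. rewrite <- Cexp_plus, Csinh_pair. f_equal.
    unfold Cplus, Cmult, RtoC; simpl. f_equal; field. }
  rewrite Hsq in Hf.
  pose proof (one_plus_exp_sinh x t) as Hlow. fold cq in Hlow.
  assert (Hlow' : (1 + exp (X + X)) * cq <= Cmod (1 + Cexp (PI * (sinh x * cos t), PI * (cosh x * sin t)))).
  { replace (X + X) with (PI * (sinh x * cos t)) by (unfold X; field). apply Hlow. lra. }
  clear Hlow. set (P := Cmod (1 + Cexp (PI * (sinh x * cos t), PI * (cosh x * sin t)))) in *.
  pose proof (exp_pos (X + X)) as HE.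
  assert (HP : Rpower (1 + exp (X + X)) g * Rpower cq g <= Rpower P g).
  { rewrite Rpower_mult_distr by lra. apply Rle_Rpower_l; [unfold g; lra|]. split; [|exact Hlow'].
    apply Rmult_lt_0_compat; lra. }
  assert (Hcqg : 0 < Rpower cq g) by apply exp_pos.
  set (Q := Rpower (1 + exp (X + X)) g) in *.
  assert (HQ : 0 < Q) by apply exp_pos.
  assert (HQ1 : 1 <= Q).
  { replace 1 with (Rpower 1 g) by (unfold Rpower; rewrite ln_1, Rmult_0_r; apply exp_0).
    apply Rle_Rpower_l; [unfold g; lra|]. lra. }
  assert (HQ2 : exp (g * (X + X)) <= Q).
  { rewrite <- Rpower_exp. apply Rle_Rpower_l; [unfold g; lra|]. lra. }
  assert (Main : Cmod (pullback f (x, t)) <= D * (cosh x * (exp (alpha * X) / Q))).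
  { unfold pullback. rewrite !Cmod_mult, Cmod_Cpsi, Cmod_R, Rabs_pos_eq by lra. fold X.
    pose proof (Cmod_Ccosh x t) as HC. pose proof (exp_pos X) as HX.
    assert (Hf2 : Cmod (f (Cpsi (x, t))) <= K * (exp ((alpha - 1) * X) / (Q * Rpower cq g))).
    { eapply Rle_trans; [exact Hf|]. apply Rmult_le_compat_l; [lra|].
      apply Rmult_le_compat_l; [left; apply exp_pos|]. apply Rinv_le_contravar; [|exact HP].
      now apply Rmult_lt_0_compat. }
    apply Rle_trans with (K * (exp ((alpha - 1) * X) / (Q * Rpower cq g)) * (exp X * (PI / 2 * cosh x))).
    - apply Rmult_le_compat; [apply Cmod_ge_0| |exact Hf2|].
      + apply Rmult_le_pos; [lra|]. apply Rmult_le_pos; [lra|apply Cmod_ge_0].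
      + apply Rmult_le_compat_l; [lra|]. apply Rmult_le_compat_l; lra.
    - right. unfold D. replace (exp (alpha * X)) with (exp ((alpha - 1) * X) * exp X)
        by (rewrite <- exp_plus; f_equal; ring).
      field. split; lra. }
  assert (HD : 0 < D) by (unfold D; apply Rdiv_lt_0_compat; [nra|exact Hcqg]).
  pose proof (cosh_ge_1 x) as Hch. pose proof (exp_pos (alpha * X)) as HaX.
  assert (HeQ : exp (alpha * X) / Q <= exp (alpha * X) /\ exp (alpha * X) / Q <= exp (- beta * X)).
  { split.
    - apply (Rmult_le_reg_r Q); [easy|]. unfold Rdiv. rewrite Rmult_assoc, Rinv_l, Rmult_1_r by lra.
      rewrite <- (Rmult_1_r (exp (alpha * X))) at 1. apply Rmult_le_compat_l; lra.
    - apply (Rmult_le_reg_r Q); [easy|]. unfold Rdiv. rewrite Rmult_assoc, Rinv_l, Rmult_1_r by lra.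
      replace (alpha * X) with (- beta * X + g * (X + X)) by (unfold g; field).
      rewrite exp_plus. apply Rmult_le_compat_l; [left; apply exp_pos|exact HQ2]. }
  split; (eapply Rle_trans; [exact Main|]); apply Rmult_le_compat_l; try lra;
    apply Rmult_le_compat_l; try lra; apply HeQ.
Qed.

(** * Truncation error *)

Lemma Csum_app {A} (g : A -> C) l1 l2 : Csum g (l1 ++ l2) = (Csum g l1 + Csum g l2)%C.
Proof. induction l1 as [|a l IH]; simpl; [ring|]. rewrite IH. ring. Qed.

Lemma Csum_map {A B} (g : B -> C) (k : A -> B) l : Csum g (map k l) = Csum (fun a => g (k a)) l.
Proof. induction l as [|a l IH]; simpl; [easy|]. now rewrite IH. Qed.

Lemma Csum_seq_shift (g : nat -> C) a s len :
  Csum g (seq (a + s) len) = Csum (fun j => g (a + j)%nat) (seq s len).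
Proof.
  revert s. induction len as [|len IH]; intros s; simpl; [easy|].
  f_equal. rewrite <- Nat.add_succ_r. apply IH.
Qed.

Lemma Csum_seq_start (g : nat -> C) s len : Csum g (seq s len) = Csum (fun j => g (s + j)%nat) (seq 0 len).
Proof. rewrite <- (Nat.add_0_r s) at 1. apply Csum_seq_shift. Qed.

Lemma sumZ_Csum (a b : Z) g : sumZ a b g = Csum (fun j => g (a + Z.of_nat j)%Z) (seq 0 (Z.to_nat (b - a + 1))).
Proof. unfold sumZ. generalize (seq 0 (Z.to_nat (b - a + 1))). induction l as [|j l IH]; simpl; [easy|now rewrite IH]. Qed.

Lemma Csum_telescope (T : nat -> C) (b : nat -> R) len :
  (forall i, (i < len)%nat -> Cmod (T i) <= b (S i) - b i) ->
  Cmod (Csum T (seq 0 len)) <= b len - b 0%nat.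
Proof.
  induction len as [|len IH]; intros H.
  - simpl. rewrite Cmod_0. lra.
  - rewrite seq_S, Csum_app. simpl. eapply Rle_trans; [apply Cmod_triangle|].
    rewrite Cplus_0_r. specialize (H len (Nat.lt_succ_diag_r _)) as H1.
    assert (Cmod (Csum T (seq 0 len)) <= b len - b 0%nat) by (apply IH; intros; apply H; lia). lra.
Qed.

Lemma Csum_zrange_split (g : Z -> C) (M N m : nat) : (M <= m)%nat -> (N <= m)%nat ->
  (Csum g (zrange m) - sumZ (- Z.of_nat M) (Z.of_nat N) g
   = Csum (fun j => g (Z.of_nat j - Z.of_nat m)%Z) (seq 0 (m - M))
     + Csum (fun j => g (Z.of_nat N + 1 + Z.of_nat j)%Z) (seq 0 (m - N)))%C.
Proof.
  intros HM HN. unfold zrange. rewrite Csum_map.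
  (* The length is hidden behind a variable because the repeated rewriting with [seq_app] would
     otherwise also split [M + N + 1]. *)
  assert (Hlen : exists len, len = (M + N + 1)%nat) by now eexists.
  destruct Hlen as [len Hlen].
  replace (2 * m + 1)%nat with ((m - M) + (len + (m - N)))%nat by lia.
  rewrite !seq_app, !Csum_app, sumZ_Csum.
  replace (Z.to_nat (Z.of_nat N - - Z.of_nat M + 1)) with len by lia.
  rewrite (Csum_seq_start _ (0 + (m - M))), (Csum_seq_start _ (0 + (m - M) + len)).
  rewrite (Csum_ext (fun j => g (Z.of_nat (0 + (m - M) + j) - Z.of_nat m)%Z)
    (fun j => g (- Z.of_nat M + Z.of_nat j)%Z)).
  2:{ intros j _. f_equal. lia. }
  rewrite (Csum_ext (fun j => g (Z.of_nat (0 + (m - M) + len + j) - Z.of_nat m)%Z)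
    (fun j => g (Z.of_nat N + 1 + Z.of_nat j)%Z)).
  2:{ intros j _. f_equal. lia. }
  cbv beta. ring.
Qed.

Lemma exp_ge_quadratic y : 0 <= y -> 1 + y + y ^ 2 / 2 <= exp y.
Proof.
  intros Hy. pose proof (exp_ge_taylor y 2 Hy) as H. simpl in H. simpl. lra.
Qed.

(** Squared, with [dl = s2 - s1], the claim is [1 + s2 ^ 2 <= 2 * (1 + s1 ^ 2) * exp (2 * c * dl)].
    Expanding the exponential to second order, [1 <= 2 * c * s1] dominates [s1 * dl] and [dl ^ 2];
    the factor [2], source of [sqrt 2], allows a comparison term by term. *)
Lemma de_decay_quasi_decr c x1 x2 : 0 < c -> x1 <= x2 -> 1 <= 2 * c * sinh x1 ->
  cosh x2 * exp (- c * sinh x2) <= sqrt 2 * (cosh x1 * exp (- c * sinh x1)).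
Proof.
  intros Hc Hx H1. pose proof (sinh_incr _ _ Hx) as Hs.
  set (s1 := sinh x1) in *. set (s2 := sinh x2) in *. set (dl := s2 - s1).
  assert (Hdl : 0 <= dl) by (unfold dl; lra).
  assert (Hs1 : 0 < s1) by nra.
  pose proof (cosh_ge_1 x1). pose proof (cosh_ge_1 x2).
  assert (S2 : 0 <= sqrt 2) by apply sqrt_pos.
  assert (Key : cosh x2 <= sqrt 2 * cosh x1 * exp (c * dl)).
  { pose proof (exp_pos (c * dl)).
    apply Rsqr_incr_0; [|lra|apply Rmult_le_pos; [apply Rmult_le_pos|]; lra].
    rewrite !Rsqr_pow2, !Rpow_mult_distr, pow2_sqrt, !cosh2 by lra. fold s1 s2.
    replace (exp (c * dl) ^ 2) with (exp (2 * c * dl))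
      by (simpl; rewrite Rmult_1_r, <- exp_plus; f_equal; ring).
    pose proof (exp_ge_quadratic (2 * c * dl)) as HE.
    assert (HE' : 1 + 2 * c * dl + (2 * c * dl) ^ 2 / 2 <= exp (2 * c * dl)) by (apply HE; nra).
    apply Rle_trans with (2 * (1 + s1 ^ 2) * (1 + 2 * c * dl + (2 * c * dl) ^ 2 / 2)).
    - replace s2 with (s1 + dl) by (unfold dl; ring).
      assert (A1 : s1 * dl <= 2 * c * s1 ^ 2 * dl).
      { replace (2 * c * s1 ^ 2 * dl) with (2 * c * s1 * (s1 * dl)) by ring.
        assert (0 <= s1 * dl) by (apply Rmult_le_pos; lra). nra. }
      assert (A2 : dl ^ 2 <= (2 * c * s1) ^ 2 * dl ^ 2).
      { pose proof (pow2_ge_0 dl). assert (1 <= (2 * c * s1) ^ 2) by nra. nra. }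
      assert (A3 : 0 <= c * dl) by (apply Rmult_le_pos; lra).
      pose proof (pow2_ge_0 (c * dl)). pose proof (pow2_ge_0 s1).
      replace (2 * (1 + s1 ^ 2) * (1 + 2 * c * dl + (2 * c * dl) ^ 2 / 2))
        with (2 + 4 * (c * dl) + 4 * (c * dl) ^ 2 + 2 * s1 ^ 2 + 2 * (2 * c * s1 ^ 2 * dl) + (2 * c * s1) ^ 2 * dl ^ 2) by field.
      replace (1 + (s1 + dl) ^ 2) with (1 + s1 ^ 2 + 2 * (s1 * dl) + dl ^ 2) by ring. lra.
    - apply Rmult_le_compat_l; [|exact HE']. pose proof (pow2_ge_0 s1). lra. }
  replace (- c * s1) with (c * dl + - c * s2) by (unfold dl; ring). rewrite exp_plus.
  pose proof (exp_pos (- c * s2)).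
  replace (sqrt 2 * (cosh x1 * (exp (c * dl) * exp (- c * s2))))
    with (sqrt 2 * cosh x1 * exp (c * dl) * exp (- c * s2)) by ring.
  apply Rmult_le_compat_r; lra.
Qed.

(* Mean value theorem for [x |-> - exp (- c * sinh x) / c]. *)
Lemma de_decay_step c h x : 0 < c -> 0 < h -> 1 <= 2 * c * sinh x ->
  h * (cosh (x + h) * exp (- c * sinh (x + h)))
   <= sqrt 2 / c * (exp (- c * sinh x) - exp (- c * sinh (x + h))).
Proof.
  intros Hc Hh H1.
  destruct (MVT_is_derive (fun u => - exp (- c * sinh u) / c) (fun u => cosh u * exp (- c * sinh u)) x (x + h))
    as (xi & E & Hxi); [lra| |].
  - intros u _.
    assert (Ds : is_derive sinh u (cosh u)) by apply is_derive_Reals, derivable_pt_lim_sinh.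
    evar_last.
    { apply (is_derive_ext (fun u => (- / c) * exp (- c * sinh u))); [intros; match goal with |- ?a = ?b => change (@eq R a b) end; field; lra|].
      apply (is_derive_scal (fun u => exp (- c * sinh u))).
      apply (is_derive_comp exp (fun u => - c * sinh u)).
      - apply is_derive_Reals, derivable_pt_lim_exp.
      - apply (is_derive_scal sinh), Ds. }
    unfold scal; simpl; unfold mult; simpl. field. lra.
  - assert (Hs : sinh x <= sinh xi) by (apply sinh_incr; lra).
    pose proof (de_decay_quasi_decr c xi (x + h) Hc) as Q.
    assert (Q' : cosh (x + h) * exp (- c * sinh (x + h)) <= sqrt 2 * (cosh xi * exp (- c * sinh xi)))
      by (apply Q; [lra|nra]).
    replace (sqrt 2 / c * (exp (- c * sinh x) - exp (- c * sinh (x + h))))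
      with (sqrt 2 * (- exp (- c * sinh (x + h)) / c - - exp (- c * sinh x) / c)) by (field; lra).
    rewrite E. replace (x + h - x) with h by ring.
    replace (sqrt 2 * (cosh xi * exp (- c * sinh xi) * h)) with (h * (sqrt 2 * (cosh xi * exp (- c * sinh xi)))) by ring.
    apply Rmult_le_compat_l; lra.
Qed.

(** [b] is an increasing potential that tends to zero, so the bound does not depend on [len]. *)
Lemma right_tail_bound (T : Z -> C) (C0 c h : R) (N : nat) len : 0 <= C0 -> 0 < c -> 0 < h ->
  1 <= 2 * c * sinh (INR N * h) ->
  (forall k, (Z.of_nat N < k)%Z ->
     Cmod (T k) <= C0 * h * (cosh (IZR k * h) * exp (- c * sinh (IZR k * h)))) ->
  Cmod (Csum (fun j => T (Z.of_nat N + 1 + Z.of_nat j)%Z) (seq 0 len))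
    <= C0 * (sqrt 2 / c) * exp (- c * sinh (INR N * h)).
Proof.
  intros HC Hc Hh H1 HT.
  set (b := fun i : nat => - (C0 * (sqrt 2 / c)) * exp (- c * sinh ((INR N + INR i) * h))).
  assert (S2 : 0 <= sqrt 2) by apply sqrt_pos.
  assert (P : 0 <= C0 * (sqrt 2 / c)).
  { apply Rmult_le_pos; [exact HC|]. apply Rmult_le_pos; [exact S2|left; now apply Rinv_0_lt_compat]. }
  assert (Hb : Cmod (Csum (fun j => T (Z.of_nat N + 1 + Z.of_nat j)%Z) (seq 0 len)) <= b len - b 0%nat).
  { apply Csum_telescope. intros i _. eapply Rle_trans; [apply HT; lia|].
    set (x := (INR N + INR i) * h).
    replace (IZR (Z.of_nat N + 1 + Z.of_nat i) * h) with (x + h)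
      by (unfold x; rewrite !plus_IZR, <- !INR_IZR_INZ; ring).
    unfold b. replace ((INR N + INR (S i)) * h) with (x + h) by (unfold x; rewrite S_INR; ring). fold x.
    rewrite Rmult_assoc.
    replace (- (C0 * (sqrt 2 / c)) * exp (- c * sinh (x + h)) - - (C0 * (sqrt 2 / c)) * exp (- c * sinh x))
      with (C0 * (sqrt 2 / c * (exp (- c * sinh x) - exp (- c * sinh (x + h))))) by ring.
    apply Rmult_le_compat_l; [exact HC|]. apply de_decay_step; trivial.
    eapply Rle_trans; [exact H1|]. apply Rmult_le_compat_l; [lra|]. apply sinh_incr.
    unfold x. apply Rmult_le_compat_r; [lra|]. pose proof (pos_INR i). lra. }
  eapply Rle_trans; [exact Hb|]. unfold b. simpl INR. rewrite Rplus_0_r.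
  pose proof (exp_pos (- c * sinh ((INR N + INR len) * h))). nra.
Qed.

Lemma left_tail_bound (T : Z -> C) (C0 c h : R) (M m : nat) : 0 <= C0 -> 0 < c -> 0 < h -> (M <= m)%nat ->
  1 <= 2 * c * sinh (INR M * h) ->
  (forall k, (k < - Z.of_nat M)%Z ->
     Cmod (T k) <= C0 * h * (cosh (IZR k * h) * exp (c * sinh (IZR k * h)))) ->
  Cmod (Csum (fun j => T (Z.of_nat j - Z.of_nat m)%Z) (seq 0 (m - M)))
    <= C0 * (sqrt 2 / c) * exp (- c * sinh (INR M * h)).
Proof.
  intros HC Hc Hh HMm H1 HT.
  set (b := fun i : nat => C0 * (sqrt 2 / c) * exp (- c * sinh ((INR m - INR i) * h))).
  assert (S2 : 0 <= sqrt 2) by apply sqrt_pos.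
  assert (P : 0 <= C0 * (sqrt 2 / c)).
  { apply Rmult_le_pos; [exact HC|]. apply Rmult_le_pos; [exact S2|left; now apply Rinv_0_lt_compat]. }
  assert (Hb : Cmod (Csum (fun j => T (Z.of_nat j - Z.of_nat m)%Z) (seq 0 (m - M))) <= b (m - M)%nat - b 0%nat).
  { apply Csum_telescope. intros i Hi. eapply Rle_trans; [apply HT; lia|].
    (* Reflected to the positive axis, the node is [x + h]. Since [i < m - M], [x] is still at least
       [M * h], where the step estimate applies. *)
    set (x := (INR m - INR (S i)) * h).
    replace (IZR (Z.of_nat i - Z.of_nat m) * h) with (- (x + h))
      by (unfold x; rewrite minus_IZR, <- !INR_IZR_INZ, S_INR; ring).
    unfold b. replace ((INR m - INR i) * h) with (x + h) by (unfold x; rewrite S_INR; ring). fold x.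
    rewrite cosh_opp, sinh_opp, Rmult_assoc.
    replace (c * - sinh (x + h)) with (- c * sinh (x + h)) by ring.
    replace (C0 * (sqrt 2 / c) * exp (- c * sinh x) - C0 * (sqrt 2 / c) * exp (- c * sinh (x + h)))
      with (C0 * (sqrt 2 / c * (exp (- c * sinh x) - exp (- c * sinh (x + h))))) by ring.
    apply Rmult_le_compat_l; [exact HC|]. apply de_decay_step; trivial.
    eapply Rle_trans; [exact H1|]. apply Rmult_le_compat_l; [lra|]. apply sinh_incr.
    unfold x. apply Rmult_le_compat_r; [lra|]. rewrite <- minus_INR by lia. apply le_INR. lia. }
  eapply Rle_trans; [exact Hb|]. unfold b.
  rewrite minus_INR by easy. replace (INR m - (INR m - INR M)) with (INR M) by ring.
  pose proof (exp_pos (- c * sinh ((INR m - INR 0) * h))). nra.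
Qed.

(** All that is retained of [x_gamma]. In the first case the outer square root is at least [1]; in
    the second [2 * PI * g >= 1] and the hyperbolic sine is at least [1]. For [g = alpha / 2] this
    is the condition of the tail bounds with [c = (PI / 2) * alpha]. *)
Lemma x_gamma_pos_bound g x : 0 < g -> x_gamma g <= x -> 0 < x /\ 1 <= 2 * (PI * g) * sinh x.
Proof.
  intros Hg Hx. pose proof PI_RGT_0 as HPI. unfold x_gamma in Hx.
  assert (A0 : forall s, 0 < s -> 0 < arcsinh s).
  { intros s Hs. rewrite <- arcsinh_0. now apply arcsinh_lt. }
  assert (Hpg : 0 < PI * g) by now apply Rmult_lt_0_compat.
  destruct (Rlt_dec g (1 / (2 * PI))) as [Hlt|Hge].
  - set (r := sqrt (1 + sqrt (1 - (2 * PI * g) ^ 2))) in *.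
    assert (Hr : 1 <= r).
    { unfold r. rewrite <- sqrt_1 at 1. apply sqrt_le_1_alt.
      pose proof (sqrt_pos (1 - (2 * PI * g) ^ 2)). lra. }
    split.
    + eapply Rlt_le_trans; [|exact Hx]. apply A0. apply Rdiv_lt_0_compat; lra.
    + apply sinh_incr in Hx. rewrite sinh_arcsinh in Hx.
      apply (Rmult_le_compat_l (2 * (PI * g))) in Hx; [|lra].
      replace (2 * (PI * g) * (r / (2 * PI * g))) with r in Hx by (field; lra). lra.
  - apply Rnot_lt_le in Hge.
    assert (H1 : 1 <= 2 * (PI * g)).
    { apply (Rmult_le_compat_l (2 * PI)) in Hge; [|lra].
      replace (2 * PI * (1 / (2 * PI))) with 1 in Hge by (field; lra). lra. }
    split.
    + eapply Rlt_le_trans; [|exact Hx]. apply A0. lra.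
    + apply sinh_incr in Hx. rewrite sinh_arcsinh in Hx. nra.
Qed.

(** * Exponential inequalities and decay integrals *)

Lemma exp_ge_mul_e x : exp 1 * x <= exp x.
Proof.
  replace x with (1 + (x - 1)) at 2 by ring. rewrite exp_plus.
  pose proof (exp_ineq1_le (x - 1)). pose proof (exp_pos 1). nra.
Qed.

Lemma exp_1_ge_2 : 2 <= exp 1.
Proof. pose proof (exp_ineq1_le 1). lra. Qed.

(* In the variables of the theorem: [c = PI * mu / 4], [l = ln (4 * d * n / mu)], [v = PI * d / h]. *)
Lemma truncation_vs_discretization c l v : 0 < c -> 1 <= l -> v = c * exp l / l ->
  v * exp (- (v * l)) <= exp c * exp (- v).
Proof.
  intros Hc Hl Hv. pose proof (exp_pos l) as HE. pose proof exp_1_ge_2 as He.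
  assert (Hv0 : 0 < v) by (rewrite Hv; apply Rdiv_lt_0_compat; [now apply Rmult_lt_0_compat|lra]).
  assert (Ec : c = v * (l * exp (- l))).
  { rewrite Hv, exp_Ropp. field. lra. }
  (* The claim amounts to [v <= exp (c + v * (l - 1))]. Using [exp y >= exp 1 * y] and dividing by
     [v] leaves this inequality, which is sharp at [l = 1]. *)
  assert (Hone : 1 <= exp 1 * (l * exp (- l) + (l - 1))).
  { set (t := l - 1). assert (Ht : 0 <= t) by (unfold t; lra).
    replace (exp 1 * (l * exp (- l) + t)) with ((1 + t) * exp (- t) + exp 1 * t).
    2:{ replace (- t) with (1 + - l) by (unfold t; ring). rewrite exp_plus. unfold t. ring. }
    pose proof (exp_ineq1_le (- t)). pose proof (exp_pos (- t)).
    destruct (Rle_dec t 1); nra. }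
  assert (Hv1 : v <= exp (c + v * (l - 1))).
  { eapply Rle_trans; [|apply exp_ge_mul_e]. rewrite Ec at 1.
    replace (exp 1 * (v * (l * exp (- l)) + v * (l - 1))) with (v * (exp 1 * (l * exp (- l) + (l - 1)))) by ring.
    nra. }
  replace (exp c * exp (- v)) with (exp (c + v * (l - 1)) * exp (- (v * l)))
    by (rewrite <- !exp_plus; f_equal; ring).
  apply Rmult_le_compat_r; [left; apply exp_pos|exact Hv1].
Qed.

Lemma is_RInt_de_decay D k a b : k <> 0 ->
  is_RInt (fun s => D * (cosh s * exp (k * sinh s))) a b (D / k * (exp (k * sinh b) - exp (k * sinh a))).
Proof.
  intros Hk.
  assert (Ds : forall u, is_derive sinh u (cosh u)) by (intros; apply is_derive_Reals, derivable_pt_lim_sinh).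
  assert (De : forall u, is_derive (fun s => exp (k * sinh s)) u (k * cosh u * exp (k * sinh u))).
  { intros u. evar_last.
    - apply (is_derive_comp exp (fun u => k * sinh u)); [apply is_derive_Reals, derivable_pt_lim_exp|].
      apply (is_derive_scal sinh), Ds.
    - unfold scal; simpl; unfold mult; simpl. ring. }
  replace (D / k * (exp (k * sinh b) - exp (k * sinh a)))
    with (minus (D / k * exp (k * sinh b)) (D / k * exp (k * sinh a)))
    by (unfold minus, plus, opp; simpl; ring).
  apply (is_RInt_derive (V := R_CompleteNormedModule) (fun s => D / k * exp (k * sinh s))); intros x _.
  - evar_last; [apply (is_derive_scal (fun s => exp (k * sinh s))), De|].
    match goal with |- ?a = ?b => change (@eq R a b) end. field. exact Hk.
  - apply (continuous_Rmult (fun _ => D)); [apply continuous_const|].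
    apply (continuous_Rmult cosh).
    + apply (ex_derive_continuous cosh). eexists. apply is_derive_Reals, derivable_pt_lim_cosh.
    + apply (ex_derive_continuous (fun s => exp (k * sinh s))). eexists. apply De.
Qed.

(** The majorants have the primitives [exp (k * sinh x)] up to constants, and the contributions at
    the outer ends have the favourable sign. *)
Lemma RInt_de_decay_le D k1 k2 (g : R -> R) a : 0 <= D -> 0 < k1 -> 0 < k2 -> 0 <= a ->
  (forall x, continuous g x) ->
  (forall x, x <= 0 -> g x <= D * (cosh x * exp (k1 * sinh x))) ->
  (forall x, 0 <= x -> g x <= D * (cosh x * exp (- k2 * sinh x))) ->
  RInt g (- a) a <= D / k1 + D / k2.
Proof.
  intros HD H1 H2 Ha Hg G1 G2.
  assert (E : forall x y, ex_RInt g x y)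
    by (intros; apply (ex_RInt_continuous (V := R_CompleteNormedModule)); intros; apply Hg).
  rewrite <- (RInt_Chasles (V := R_CompleteNormedModule) g (- a) 0 a) by apply E.
  apply Rplus_le_compat.
  - pose proof (is_RInt_de_decay D k1 (- a) 0) as I. specialize (I (Rgt_not_eq _ _ H1)).
    apply Rle_trans with (RInt (fun s => D * (cosh s * exp (k1 * sinh s))) (- a) 0).
    + apply RInt_le; [lra|apply E|eexists; exact I|]. intros; apply G1; lra.
    + rewrite (is_RInt_unique (V := R_CompleteNormedModule) _ _ _ _ I), sinh_0, Rmult_0_r, exp_0.
      pose proof (exp_pos (k1 * sinh (- a))).
      assert (0 <= D / k1) by (apply Rmult_le_pos; [lra|left; now apply Rinv_0_lt_compat]). nra.
  - assert (Hk2 : - k2 <> 0) by lra.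
    pose proof (is_RInt_de_decay D (- k2) 0 a Hk2) as I.
    apply Rle_trans with (RInt (fun s => D * (cosh s * exp (- k2 * sinh s))) 0 a).
    + apply RInt_le; [lra|apply E|eexists; exact I|]. intros; apply G2; lra.
    + rewrite (is_RInt_unique (V := R_CompleteNormedModule) _ _ _ _ I), sinh_0, Rmult_0_r, exp_0.
      pose proof (exp_pos (- k2 * sinh a)).
      assert (0 <= D / k2) by (apply Rmult_le_pos; [lra|left; now apply Rinv_0_lt_compat]).
      replace (D / - k2) with (- (D / k2)) by (field; lra). nra.
Qed.

(** A decay like [1 / a] is enough to make the vertical sides vanish, and its explicit form tells
    how large [m] must be. *)
Lemma de_decay_pointwise k a : 0 < k -> 1 <= a -> cosh a * exp (- k * sinh a) <= 4 / k ^ 2 * / a.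
Proof.
  intros Hk Ha. pose proof (le_sinh a) as Hs. assert (Hsa : a <= sinh a) by (apply Hs; lra).
  set (s := sinh a) in *.
  assert (Hc : cosh a <= 1 + s).
  { assert (0 < cosh a) by (pose proof (cosh_ge_1 a); lra).
    pose proof (cosh2 a) as E. fold s in E. nra. }
  assert (He : (k * s) ^ 2 / 2 <= exp (k * s)).
  { pose proof (exp_ge_quadratic (k * s)). assert (0 <= k * s) by nra. lra. }
  pose proof (exp_pos (k * s)) as P.
  replace (- k * s) with (- (k * s)) by ring. rewrite exp_Ropp.
  apply (Rmult_le_reg_r (exp (k * s))); [easy|]. rewrite Rmult_assoc, Rinv_l, Rmult_1_r by lra.
  assert (Hk2 : 0 < k ^ 2) by now apply pow_lt.
  assert (Q : 0 < 4 / k ^ 2 * / a).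
  { apply Rmult_lt_0_compat; [apply Rdiv_lt_0_compat; lra|apply Rinv_0_lt_compat; lra]. }
  apply Rle_trans with (4 / k ^ 2 * / a * ((k * s) ^ 2 / 2)); [|apply Rmult_le_compat_l; lra].
  replace (4 / k ^ 2 * / a * ((k * s) ^ 2 / 2)) with (2 * s * (s * / a)) by (field; lra).
  assert (1 <= s * / a).
  { apply (Rmult_le_reg_r a); [lra|]. rewrite Rmult_assoc, Rinv_l by lra. lra. }
  nra.
Qed.

(** Contours must stay strictly inside the strip, so the bound at height [d] is a limit from
    below. *)
Lemma continuity_left_limit (phi : R -> R) d C0 : 0 < d -> continuity_pt phi d ->
  (forall y, 0 < y < d -> C0 <= phi y) -> C0 <= phi d.
Proof.
  intros Hd Hc H. apply le_epsilon. intros eps He.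
  destruct (Hc eps He) as (dl & Hdl & Hy). simpl in Hy. unfold R_dist in Hy.
  set (y := d - Rmin (dl / 2) (d / 2)).
  assert (M1 : 0 < Rmin (dl / 2) (d / 2)) by (apply Rmin_pos; lra).
  pose proof (Rmin_l (dl / 2) (d / 2)). pose proof (Rmin_r (dl / 2) (d / 2)).
  specialize (H y). specialize (Hy y).
  assert (Hy' : Rabs (phi y - phi d) < eps).
  { apply Hy. split; [split; [exact Logic.I|unfold y; lra]|].
    unfold y. rewrite Rabs_left; lra. }
  apply Rabs_lt_between in Hy'. assert (C0 <= phi y) by (apply H; unfold y; lra). lra.
Qed.

(** * The total error from a finite lower limit *)

Lemma CI_sincerr F d h m xi0 xi : 0 < h -> 0 < d ->
  (forall z, Rabs (Im z) < d -> exists l, Cder F z l) ->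
  CI (sincerr F h m) xi0 xi
   = (CI (fun x => F (RtoC x)) xi0 xi
      - Csum (fun k => F (RtoC (IZR k * h)) * RtoC (J k h xi - J k h xi0)) (zrange m))%C.
Proof.
  intros Hh Hd HF.
  assert (Hs : forall k, exCI (fun x => RtoC (sinc0 (PI * (x / h - IZR k)))) xi0 xi /\
     CI (fun x => RtoC (sinc0 (PI * (x / h - IZR k)))) xi0 xi = RtoC (J k h xi - J k h xi0)).
  { intros k. apply CI_unique.
    apply (is_RInt_fct_extend_pair (U := R_NormedModule) (V := R_NormedModule)); simpl fst; simpl snd.
    - apply (is_RInt_derive (V := R_CompleteNormedModule) (J k h)); intros x _.
      + now apply is_derive_J.
      + apply (continuous_comp (fun x => PI * (x / h - IZR k)) sinc0); [|apply continuous_sinc0].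
        apply (ex_derive_continuous (fun x => PI * (x / h - IZR k))). auto_derive. lra.
    - evar_last; [apply (is_RInt_const (V := R_NormedModule))|].
      unfold scal; simpl; unfold mult; simpl. ring_R. }
  assert (EF : exCI (fun x => F (RtoC x)) xi0 xi).
  { apply exCI_continuous. intros x _.
    apply (continuous_comp (V := C_UniformSpace) (fun x : R => RtoC x) F);
      [apply continuous_RtoC, continuous_id|]. apply (F_continuous_R F d); [exact HF|lra]. }
  unfold sincerr.
  destruct (CI_Csum (fun k x => F (RtoC (IZR k * h)) * RtoC (sinc0 (PI * (x / h - IZR k))))%C
              (zrange m) xi0 xi) as [S1 S2].
  { intros k _. apply CI_scal, Hs. }
  rewrite (proj2 (CI_minus _ _ _ _ EF S1)), S2. f_equal.
  apply Csum_ext. intros k _. now rewrite (proj2 (CI_scal _ _ _ _ (proj1 (Hs k)))), (proj2 (Hs k)).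
Qed.

(** The error over all nodes up to [m] is the discretization error; passing to the nodes from [-M]
    to [N] adds two tails bounded uniformly in [m]. The strip constants [D], [k1], [k2] enter the
    first part, the better constants [D0], [c1], [c2] of the real axis the second. *)
Theorem sinc_indefinite_error F d h D k1 k2 D0 c1 c2 (M N : nat) xi0 xi :
  0 < d -> 0 < h -> 0 <= D -> 0 < k1 -> 0 < k2 -> 0 <= D0 -> 0 < c1 -> 0 < c2 -> xi0 <= xi ->
  (forall z, Rabs (Im z) < d -> exists l, Cder F z l) ->
  (forall x t, Rabs t < d -> x <= 0 -> Cmod (F (x, t)) <= D * (cosh x * exp (k1 * sinh x))) ->
  (forall x t, Rabs t < d -> 0 <= x -> Cmod (F (x, t)) <= D * (cosh x * exp (- k2 * sinh x))) ->
  (forall x : R, Cmod (F (RtoC x)) <= D0 * (cosh x * exp (c1 * sinh x))) ->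
  (forall x : R, Cmod (F (RtoC x)) <= D0 * (cosh x * exp (- c2 * sinh x))) ->
  1 <= 2 * c1 * sinh (INR M * h) -> 1 <= 2 * c2 * sinh (INR N * h) ->
  Cmod (CI (fun x => F (RtoC x)) xi0 xi
        - sumZ (- Z.of_nat M) (Z.of_nat N)
            (fun k => F (RtoC (IZR k * h)) * RtoC (J k h xi - J k h xi0))%C)
   <= (D / k1 + D / k2) * (h / d / sinh (PI / h * d)) / PI
      + 2 * D0 * sqrt 2 * (exp (- c1 * sinh (INR M * h)) / c1 + exp (- c2 * sinh (INR N * h)) / c2).
Proof.
  intros Hd Hh HD Hk1 Hk2 HD0 Hc1 Hc2 Hxi HF B1 B2 R1 R2 HM HN.
  pose proof PI_RGT_0 as HPI. pose proof (w_pos h Hh) as Hw.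
  set (T := fun k => (F (RtoC (IZR k * h)) * RtoC (J k h xi - J k h xi0))%C).
  set (L := Cmod _). set (TR := 2 * D0 * sqrt 2 * _).
  assert (HT : forall k b, Cmod (F (RtoC (IZR k * h))) <= D0 * b -> Cmod (T k) <= 2 * D0 * h * b).
  { intros k b Hb. unfold T. rewrite Cmod_mult, Cmod_R.
    pose proof (J_diff_bound k h xi xi0 Hh) as HJ. pose proof (Cmod_ge_0 (F (RtoC (IZR k * h)))).
    replace (2 * D0 * h * b) with (D0 * b * (2 * h)) by ring.
    apply Rmult_le_compat; trivial. apply Rabs_pos. }
  assert (Main : forall y, 0 < y < d -> L <= (D / k1 + D / k2) * (h / y / sinh (PI / h * y)) / PI + TR).
  { intros y Hy. apply le_epsilon. intros eps He.
    (* The vertical sides contribute [Z0 / a], with [a] the abscissa of the right side. *)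
    set (Z0 := (xi - xi0) * (4 * y * (D * (4 / k1 ^ 2) + D * (4 / k2 ^ 2))) / (2 * PI)).
    assert (HZ0 : 0 <= Z0).
    { unfold Z0. apply Rmult_le_pos; [|left; apply Rinv_0_lt_compat; lra].
      apply Rmult_le_pos; [lra|]. apply Rmult_le_pos; [lra|].
      assert (0 < 4 / k1 ^ 2) by (apply Rdiv_lt_0_compat; [lra|now apply pow_lt]).
      assert (0 < 4 / k2 ^ 2) by (apply Rdiv_lt_0_compat; [lra|now apply pow_lt]).
      apply Rplus_le_le_0_compat; apply Rmult_le_pos; lra. }
    (* Large enough for [a] to exceed [Z0 / eps], to leave a margin [1] around [[xi0, xi]], and to
       include the nodes [-M] to [N]. *)
    destruct (INR_unbounded ((Rabs xi0 + Rabs xi + 1 + Z0 / eps) / h + INR M + INR N)) as [m Hm].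
    pose proof (pos_INR M). pose proof (pos_INR N). pose proof (Rabs_pos xi0). pose proof (Rabs_pos xi).
    assert (Hq : 0 <= (Rabs xi0 + Rabs xi + 1 + Z0 / eps) / h).
    { apply Rmult_le_pos; [|left; now apply Rinv_0_lt_compat].
      assert (0 <= Z0 / eps) by (apply Rmult_le_pos; [lra|left; now apply Rinv_0_lt_compat]). lra. }
    assert (HMm : (M <= m)%nat) by (apply INR_le; lra).
    assert (HNm : (N <= m)%nat) by (apply INR_le; lra).
    set (a := (INR m + 1 / 2) * h).
    assert (Ha : Rabs xi0 + Rabs xi + 1 + Z0 / eps <= a).
    { unfold a. apply Rle_trans with ((Rabs xi0 + Rabs xi + 1 + Z0 / eps) / h * h); [right; field; lra|].
      apply Rmult_le_compat_r; lra. }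
    assert (HZe : 0 <= Z0 / eps) by (apply Rmult_le_pos; [lra|left; now apply Rinv_0_lt_compat]).
    assert (Ha1 : 1 <= a) by lra.
    set (Mv := (D * (4 / k1 ^ 2) + D * (4 / k2 ^ 2)) * / a).
    assert (HMv : forall t, - y <= t <= y -> Cmod (F (a, t)) <= Mv /\ Cmod (F (- a, t)) <= Mv).
    { intros t Ht. assert (Td : Rabs t < d) by (apply Rabs_lt_between; lra).
      pose proof (de_decay_pointwise k1 a Hk1 Ha1) as P1.
      pose proof (de_decay_pointwise k2 a Hk2 Ha1) as P2.
      assert (Q1 : 0 <= 4 / k1 ^ 2 * / a).
      { pose proof (cosh_ge_1 a). pose proof (exp_pos (- k1 * sinh a)). nra. }
      assert (Q2 : 0 <= 4 / k2 ^ 2 * / a).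
      { pose proof (cosh_ge_1 a). pose proof (exp_pos (- k2 * sinh a)). nra. }
      unfold Mv. split.
      - eapply Rle_trans; [apply B2; [exact Td|lra]|]. nra.
      - eapply Rle_trans; [apply B1; [exact Td|lra]|]. rewrite cosh_opp, sinh_opp.
        replace (k1 * - sinh a) with (- k1 * sinh a) by ring. nra. }
    assert (Hhor : forall t, Rabs t < d -> RInt (fun s => Cmod (F (s, t))) (- a) a <= D / k1 + D / k2).
    { intros t Ht. apply RInt_de_decay_le; trivial; [lra| |now intros; apply B1|now intros; apply B2].
      intros x. apply (continuous_Cmod (fun s : R => F (s, t))).
      apply continuous_horizontal. destruct (HF (x, t)) as [l Hl]; [exact Ht|].
      eapply Cder_continuous, Hl. }
    pose proof (discretization_bound F d h y m xi0 xi (D / k1 + D / k2) Mv Hh HF Hy Hxi) as Disc.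
    cbv zeta in Disc. fold a in Disc.
    assert (Disc' : Cmod (CI (sincerr F h m) xi0 xi) <=
      (2 * ((D / k1 + D / k2) * (h / y / sinh (PI / h * y))) + (xi - xi0) * (4 * y * Mv)) / (2 * PI)).
    { apply Disc.
      - pose proof (Rle_abs (- xi0)) as X. rewrite Rabs_Ropp in X. lra.
      - pose proof (Rle_abs xi). lra.
      - exact HMv.
      - apply Hhor. rewrite Rabs_pos_eq; lra.
      - apply Hhor. rewrite Rabs_Ropp, Rabs_pos_eq; lra. }
    clear Disc. rewrite (CI_sincerr F d) in Disc' by trivial. fold T in Disc'.
    pose proof (Csum_zrange_split T M N m HMm HNm) as Sp.
    assert (RT : Cmod (Csum (fun j => T (Z.of_nat N + 1 + Z.of_nat j)%Z) (seq 0 (m - N)))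
       <= 2 * D0 * (sqrt 2 / c2) * exp (- c2 * sinh (INR N * h))).
    { apply right_tail_bound; trivial; [lra|]. intros k _. apply HT, R2. }
    assert (LT : Cmod (Csum (fun j => T (Z.of_nat j - Z.of_nat m)%Z) (seq 0 (m - M)))
       <= 2 * D0 * (sqrt 2 / c1) * exp (- c1 * sinh (INR M * h))).
    { apply left_tail_bound; trivial; [lra|]. intros k _. apply HT, R1. }
    assert (HL : L <= Cmod (CI (fun x => F (RtoC x)) xi0 xi - Csum T (zrange m))
        + (Cmod (Csum (fun j => T (Z.of_nat j - Z.of_nat m)%Z) (seq 0 (m - M)))
           + Cmod (Csum (fun j => T (Z.of_nat N + 1 + Z.of_nat j)%Z) (seq 0 (m - N))))).
    { unfold L. fold T.
      replace (CI (fun x => F (RtoC x)) xi0 xi - sumZ (- Z.of_nat M) (Z.of_nat N) T)%C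
        with ((CI (fun x => F (RtoC x)) xi0 xi - Csum T (zrange m))
              + (Csum T (zrange m) - sumZ (- Z.of_nat M) (Z.of_nat N) T))%C by ring.
      rewrite Sp. eapply Rle_trans; [apply Cmod_triangle|]. apply Rplus_le_compat_l, Cmod_triangle. }
    assert (EV : (2 * ((D / k1 + D / k2) * (h / y / sinh (PI / h * y))) + (xi - xi0) * (4 * y * Mv)) / (2 * PI)
       = (D / k1 + D / k2) * (h / y / sinh (PI / h * y)) / PI + Z0 * / a).
    { unfold Z0, Mv. generalize (D * (4 / k1 ^ 2) + D * (4 / k2 ^ 2)). intros q0.
      generalize ((D / k1 + D / k2) * (h / y / sinh (PI / h * y))). intros q1. field. split; lra. }
    assert (HV : Z0 * / a <= eps).
    { apply (Rmult_le_reg_r a); [lra|]. rewrite Rmult_assoc, Rinv_l, Rmult_1_r by lra.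
      apply Rle_trans with (eps * (Z0 / eps)); [right; field; lra|]. apply Rmult_le_compat_l; lra. }
    assert (ETR : TR = 2 * D0 * (sqrt 2 / c1) * exp (- c1 * sinh (INR M * h))
                      + 2 * D0 * (sqrt 2 / c2) * exp (- c2 * sinh (INR N * h))).
    { unfold TR. field. split; lra. }
    rewrite EV in Disc'. rewrite ETR. lra. }
  (* Passage to the limit as [y] tends to [d]. *)
  apply (continuity_left_limit (fun y => (D / k1 + D / k2) * (h / y / sinh (PI / h * y)) / PI + TR) d L Hd); [|exact Main].
  apply continuity_pt_filterlim.
  change (continuous (fun y => (D / k1 + D / k2) * (h / y / sinh (PI / h * y)) / PI + TR) d).
  apply (continuous_Rplus (fun y => (D / k1 + D / k2) * (h / y / sinh (PI / h * y)) / PI)); [|apply continuous_const].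
  apply (continuous_Rmult (fun y => (D / k1 + D / k2) * (h / y / sinh (PI / h * y)))); [|apply continuous_const].
  apply (continuous_Rmult (fun y => D / k1 + D / k2)); [apply continuous_const|].
  apply (continuous_Rmult (fun y => h / y)).
  - apply (ex_derive_continuous (fun y => h / y)). auto_derive. lra.
  - apply (continuous_Rinv_fun (fun y => sinh (PI / h * y))).
    + apply (continuous_comp (fun y => PI / h * y) sinh).
      * apply (ex_derive_continuous (fun y => PI / h * y)). auto_derive. easy.
      * apply (ex_derive_continuous sinh). eexists. apply is_derive_Reals, derivable_pt_lim_sinh.
    + apply Rgt_not_eq, sinh_pos. now apply Rmult_lt_0_compat.
Qed.

(** * The theorem *)

(** Split [sinh x] into its exponentials: [exp (- x) <= 1] costs the factor [exp (PI * a / 4)],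
    which goes into the last term of [C2]. *)
Lemma de_tail_factor a x q : 0 < a -> 0 <= x -> q <= a * exp x ->
  exp (- (PI / 2 * a) * sinh x) <= exp (PI * a / 4) * exp (- (PI * q / 4)).
Proof.
  intros Ha Hx Hq. pose proof PI_RGT_0. rewrite <- exp_plus. apply exp_le.
  assert (E : exp (- x) <= 1) by (rewrite <- exp_0; apply exp_le; lra).
  unfold sinh.
  assert (H1 : PI * q <= PI * (a * exp x)) by (apply Rmult_le_compat_l; lra).
  assert (H2 : PI * a * exp (- x) <= PI * a) by (rewrite <- (Rmult_1_r (PI * a)) at 2; apply Rmult_le_compat_l; [nra|lra]).
  replace (- (PI / 2 * a) * ((exp x - exp (- x)) / 2)) with (- (PI * (a * exp x)) / 4 + PI * a * exp (- x) / 4) by field.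
  lra.
Qed.

Lemma sqrt2_bound : 2 * sqrt 2 <= 3.
Proof.
  assert (sqrt 2 <= 3 / 2); [|lra].
  rewrite <- (sqrt_pow2 (3 / 2)) by lra. apply sqrt_le_1_alt. lra.
Qed.

Lemma PI_gt_3 : 3 < PI.
Proof. pose proof PI2_3_2. unfold PI2 in *. lra. Qed.

(** The discretization and truncation parts are matched separately with the two summands of the
    constant. *)
Lemma final_estimate d K alpha beta n xM xN : 0 < d -> d < PI / 2 -> 0 < K -> 0 < alpha -> 0 < beta -> 0 < n ->
  let mu := Rmin alpha beta in
  let l := ln (4 * d * n / mu) in
  let h := l / n in
  let D0 := PI * K / 2 in
  let D := D0 / Rpower (cos (PI / 2 * sin d)) ((alpha + beta) / 2) in
  1 <= l -> 0 <= xM -> 0 <= xN ->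
  4 * d * n <= alpha * exp xM -> 4 * d * n <= beta * exp xN ->
  (D / (PI / 2 * alpha * cos d) + D / (PI / 2 * beta * cos d)) * (h / d / sinh (PI / h * d)) / PI
  + 2 * D0 * sqrt 2 * (exp (- (PI / 2 * alpha) * sinh xM) / (PI / 2 * alpha)
                       + exp (- (PI / 2 * beta) * sinh xN) / (PI / 2 * beta))
  <= 2 * K / (mu * d) *
     (1 / ((1 - exp (- PI * mu * exp 1 / 2))
           * Rpower (cos (PI / 2 * sin d)) ((alpha + beta) / 2) * cos d)
      + exp (PI * (alpha + beta) / 4)) * (exp (- PI * d * n / l) * l / n).
Proof.
  intros Hd Hd2 HK Ha Hb Hn mu l h D0 D Hl HxM HxN HM HN.
  pose proof PI_RGT_0 as HPI. pose proof PI_gt_3 as HPI3.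
  assert (Hmu : 0 < mu) by (unfold mu; now apply Rmin_pos).
  assert (Hmua : mu <= alpha) by apply Rmin_l. assert (Hmub : mu <= beta) by apply Rmin_r.
  assert (Hh : 0 < h) by (unfold h; apply Rdiv_lt_0_compat; lra).
  assert (Hcd : 0 < cos d) by (apply cos_gt_0; lra).
  set (P := Rpower (cos (PI / 2 * sin d)) ((alpha + beta) / 2)) in *.
  assert (HP : 0 < P) by apply exp_pos.
  set (v := PI * d / h).
  assert (Hv : 0 < v) by (unfold v; apply Rdiv_lt_0_compat; [nra|exact Hh]).
  assert (Hu : 0 < 4 * d * n / mu) by (apply Rdiv_lt_0_compat; [|lra]; apply Rmult_lt_0_compat; lra).
  assert (El : exp l = 4 * d * n / mu) by (unfold l; now apply exp_ln).
  set (c := PI * mu / 4).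
  assert (Hc : 0 < c) by (unfold c; nra).
  assert (Ev : v = c * exp l / l) by (rewrite El; unfold v, c, h; field; repeat split; lra).
  assert (Evl : v * l = PI * d * n) by (unfold v, h; field; lra).
  replace (- PI * d * n / l) with (- v) by (unfold v, h; field; split; lra).
  pose proof (truncation_vs_discretization c l v Hc Hl Ev) as TD. rewrite Evl in TD.
  pose proof (exp_pos (- v)) as Hev.
  replace (exp (- v) * l / n) with (exp (- v) * h) by (unfold h; field; lra).
  rewrite (Rmult_plus_distr_l (2 * K / (mu * d))), (Rmult_plus_distr_r (2 * K / (mu * d) * _)).
  assert (Kmd : 0 < K / (mu * d)) by (apply Rdiv_lt_0_compat; [lra|now apply Rmult_lt_0_compat]).
  apply Rplus_le_compat.
  (* Twice [v] equals [(PI * mu / 2) * exp l / l], and [exp l >= exp 1 * l]. Hence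
     [1 - exp (- 2 * v)], which comes from [sinh v], is at least [1 - e0]. *)
  - set (e0 := exp (- PI * mu * exp 1 / 2)).
    assert (H2v : exp (- (v + v)) <= e0).
    { apply exp_le. pose proof (exp_ge_mul_e l) as HE.
      assert (Q : PI * mu * exp 1 / 2 <= v + v).
      { rewrite Ev. apply Rle_trans with (2 * (c * (exp 1 * l) / l)).
        - right. unfold c. field. lra.
        - replace (c * exp l / l + c * exp l / l) with (2 * (c * exp l / l)) by ring.
          apply Rmult_le_compat_l; [lra|]. apply Rmult_le_compat_r; [left; apply Rinv_0_lt_compat; lra|].
          apply Rmult_le_compat_l; lra. }
      replace (- PI * mu * exp 1 / 2) with (- (PI * mu * exp 1 / 2)) by field. lra. }
    assert (He0 : e0 < 1).
    { apply Rlt_le_trans with (exp 0); [|rewrite exp_0; lra]. apply exp_increasing. pose proof (exp_pos 1).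
      assert (X1 : 0 < PI * mu) by (apply Rmult_lt_0_compat; lra).
      assert (X2 : 0 < PI * mu * exp 1) by (apply Rmult_lt_0_compat; lra).
      lra. }
    assert (Hsh : / sinh (PI / h * d) <= 2 * exp (- v) / (1 - e0)).
    { replace (PI / h * d) with v by (unfold v; field; lra).
      assert (Es : sinh v = (1 - exp (- (v + v))) / (2 * exp (- v))).
      { unfold sinh. replace (- (v + v)) with (- v + - v) by ring. rewrite exp_plus, exp_Ropp.
        field. pose proof (exp_pos v). lra. }
      rewrite Es. rewrite <- (Rinv_inv (2 * exp (- v) / (1 - e0))).
      assert (Hd0 : 0 < 1 - e0) by lra.
      apply Rinv_le_contravar.
      - apply Rinv_0_lt_compat. apply Rdiv_lt_0_compat; lra.
      - replace (/ (2 * exp (- v) / (1 - e0))) with ((1 - e0) / (2 * exp (- v))) by (field; split; lra).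
        apply Rmult_le_compat_r; [left; apply Rinv_0_lt_compat; lra|lra]. }
    assert (HD0 : 0 < D0) by (unfold D0; nra).
    assert (HD : 0 < D) by (unfold D; now apply Rdiv_lt_0_compat).
    assert (Hsum : D / (PI / 2 * alpha * cos d) + D / (PI / 2 * beta * cos d) <= 2 * K / (mu * P * cos d)).
    { assert (Q : forall a, mu <= a -> D / (PI / 2 * a * cos d) <= K / (mu * P * cos d)).
      { intros a Hma. replace (D / (PI / 2 * a * cos d)) with (K / (a * P * cos d))
          by (unfold D, D0; field; repeat split; lra).
        apply Rmult_le_compat_l; [lra|].
        assert (0 < mu * P) by now apply Rmult_lt_0_compat.
        apply Rinv_le_contravar; [now apply Rmult_lt_0_compat|].
        apply Rmult_le_compat_r; [lra|]. apply Rmult_le_compat_r; lra. }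
      pose proof (Q alpha Hmua). pose proof (Q beta Hmub).
      replace (2 * K / (mu * P * cos d)) with (K / (mu * P * cos d) + K / (mu * P * cos d)) by (unfold Rdiv; ring). lra. }
    set (R0 := 2 * K / (mu * P * cos d)) in *.
    assert (HR0 : 0 < R0).
    { unfold R0. apply Rdiv_lt_0_compat; [lra|]. apply Rmult_lt_0_compat; [|exact Hcd]. now apply Rmult_lt_0_compat. }
    assert (Hhd : 0 < h / d) by now apply Rdiv_lt_0_compat.
    assert (Hsp : 0 < / sinh (PI / h * d)).
    { apply Rinv_0_lt_compat, sinh_pos, Rmult_lt_0_compat; [now apply Rdiv_lt_0_compat|exact Hd]. }
    assert (Hfac : 0 < 2 * exp (- v) / (1 - e0)) by (apply Rdiv_lt_0_compat; lra).
    apply Rle_trans with (R0 * (h / d * (2 * exp (- v) / (1 - e0))) / PI).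
    + apply Rmult_le_compat_r; [left; now apply Rinv_0_lt_compat|].
      apply Rmult_le_compat; [| |exact Hsum|].
      * apply Rplus_le_le_0_compat; (apply Rmult_le_pos; [lra|]; left; apply Rinv_0_lt_compat;
          apply Rmult_lt_0_compat; [nra|exact Hcd]).
      * left. now apply Rmult_lt_0_compat.
      * apply Rmult_le_compat_l; [lra|exact Hsh].
    (* The bound carries [1 / PI] where the target has [1 / 2]. *)
    + replace (2 * K / (mu * d) * (1 / ((1 - e0) * P * cos d)) * (exp (- v) * h))
        with (R0 * (h / d * (2 * exp (- v) / (1 - e0))) * / 2)
        by (unfold R0; field; repeat split; lra).
      apply Rmult_le_compat_l; [|apply Rinv_le_contravar; lra].
      left. apply Rmult_lt_0_compat; [exact HR0|]. now apply Rmult_lt_0_compat.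
  - assert (Q : forall a b x, 0 < a -> mu <= a -> mu <= b -> 0 <= x -> 4 * d * n <= a * exp x ->
       2 * D0 * sqrt 2 * (exp (- (PI / 2 * a) * sinh x) / (PI / 2 * a))
         <= K / (mu * d) * exp (PI * (a + b) / 4) * (exp (- v) * h)).
    { intros a b x Ha0 Hma Hmb Hx Hax.
      pose proof (de_tail_factor a x (4 * d * n) Ha0 Hx Hax) as T1.
      replace (PI * (4 * d * n) / 4) with (PI * d * n) in T1 by field.
      pose proof sqrt2_bound as S2. assert (S0 : 0 <= sqrt 2) by apply sqrt_pos.
      replace (2 * D0 * sqrt 2 * (exp (- (PI / 2 * a) * sinh x) / (PI / 2 * a)))
        with (K / a * (2 * sqrt 2 * exp (- (PI / 2 * a) * sinh x))) by (unfold D0; field; split; lra).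
      (* The comparison divided by [v = PI * d / h]; the factor [PI] gained here absorbs
         [2 * sqrt 2 <= 3]. *)
      assert (T2 : PI * exp (- (PI * d * n)) <= exp c * exp (- v) * (h / d)).
      { apply (Rmult_le_reg_r v); [exact Hv|].
        replace (exp c * exp (- v) * (h / d) * v) with (PI * (exp c * exp (- v))) by (unfold v; field; split; lra).
        rewrite Rmult_assoc. apply Rmult_le_compat_l; lra. }
      (* Since [c = PI * mu / 4] and [mu <= b], the other exponent supplies the missing half of
         [exp (PI * (a + b) / 4)]. *)
      assert (T3 : exp c <= exp (PI * b / 4)) by (apply exp_le; unfold c; nra).
      replace (PI * (a + b) / 4) with (PI * a / 4 + PI * b / 4) by field. rewrite exp_plus.
      pose proof (exp_pos (PI * a / 4)) as Pa. pose proof (exp_pos (- (PI * d * n))) as Pn.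
      assert (Hhd : 0 < h / d) by now apply Rdiv_lt_0_compat.
      apply Rle_trans with (K / mu * (exp (PI * a / 4) * (PI * exp (- (PI * d * n))))).
      - apply Rmult_le_compat.
        + left. apply Rdiv_lt_0_compat; lra.
        + apply Rmult_le_pos; [lra|left; apply exp_pos].
        + apply Rmult_le_compat_l; [lra|]. apply Rinv_le_contravar; lra.
        + apply Rle_trans with (2 * sqrt 2 * (exp (PI * a / 4) * exp (- (PI * d * n)))).
          * apply Rmult_le_compat_l; lra.
          * replace (exp (PI * a / 4) * (PI * exp (- (PI * d * n)))) with (PI * (exp (PI * a / 4) * exp (- (PI * d * n)))) by ring.
            apply Rmult_le_compat_r; [left; now apply Rmult_lt_0_compat|lra].
      - replace (K / (mu * d) * (exp (PI * a / 4) * exp (PI * b / 4)) * (exp (- v) * h))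
          with (K / mu * (exp (PI * a / 4) * (exp (PI * b / 4) * exp (- v) * (h / d)))) by (field; split; lra).
        apply Rmult_le_compat_l; [left; apply Rdiv_lt_0_compat; lra|].
        apply Rmult_le_compat_l; [lra|]. eapply Rle_trans; [exact T2|].
        apply Rmult_le_compat_r; [lra|]. apply Rmult_le_compat_r; lra. }
    pose proof (Q alpha beta xM Ha Hmua Hmub HxM HM) as Q1.
    pose proof (Q beta alpha xN Hb Hmub Hmua HxN HN) as Q2.
    rewrite (Rplus_comm beta alpha) in Q2.
    replace (2 * K / (mu * d) * exp (PI * (alpha + beta) / 4) * (exp (- v) * h))
      with (K / (mu * d) * exp (PI * (alpha + beta) / 4) * (exp (- v) * h)
            + K / (mu * d) * exp (PI * (alpha + beta) / 4) * (exp (- v) * h)) by (unfold Rdiv; ring).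
    rewrite Rmult_plus_distr_l. now apply Rplus_le_compat.
Qed.

(** * Substitution and the improper integral *)

Lemma Cpsi_RtoC x : Cpsi (RtoC x) = RtoC (psi x).
Proof.
  unfold Cpsi, psi, RtoC at 2. rewrite Csinh_pair, cos_0, sin_0.
  rewrite <- Cexp_RtoC. f_equal. unfold Cmult, RtoC; simpl. f_equal; ring.
Qed.

Lemma is_derive_psi x : is_derive psi x (psi x * (PI / 2 * cosh x)).
Proof.
  unfold psi. evar_last.
  - apply (is_derive_comp exp (fun t => PI / 2 * sinh t)).
    + apply is_derive_Reals, derivable_pt_lim_exp.
    + apply (is_derive_scal sinh), is_derive_Reals, derivable_pt_lim_sinh.
  - unfold scal; simpl; unfold mult; simpl. ring.
Qed.

Lemma pullback_R f x : pullback f (RtoC x) = (f (RtoC (psi x)) * RtoC (Derive psi x))%C.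
Proof.
  rewrite (is_derive_unique _ _ _ (is_derive_psi x)). unfold pullback. rewrite Cpsi_RtoC.
  f_equal. rewrite !RtoC_mult. f_equal. f_equal.
  unfold Ccosh, RtoC; simpl. rewrite cos_0, sin_0. f_equal; ring.
Qed.

Lemma psi_psi_inv x : 0 < x -> psi (psi_inv x) = x.
Proof.
  intros Hx. unfold psi, psi_inv. rewrite sinh_arcsinh.
  replace (PI / 2 * (2 / PI * ln x)) with (ln x) by (field; apply PI_neq0). now apply exp_ln.
Qed.

Lemma psi_inv_psi x : psi_inv (psi x) = x.
Proof.
  unfold psi, psi_inv. rewrite ln_exp.
  replace (2 / PI * (PI / 2 * sinh x)) with (sinh x) by (field; apply PI_neq0). apply arcsinh_sinh.
Qed.

Lemma psi_inv_incr x y : 0 < x -> x < y -> psi_inv x < psi_inv y.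
Proof.
  intros Hx Hxy. unfold psi_inv. apply arcsinh_lt. apply Rmult_lt_compat_l.
  - apply Rdiv_lt_0_compat; [lra|apply PI_RGT_0].
  - now apply ln_increasing.
Qed.

Lemma psi_pos x : 0 < psi x.
Proof. apply exp_pos. Qed.

Lemma CI_psi_substitution f a b :
  (forall x, 0 < x -> continuous (fun t : R => f (RtoC t)) x) ->
  CI (fun t => f (RtoC t)) (psi a) (psi b) = CI (fun x => pullback f (RtoC x)) a b.
Proof.
  intros Hf.
  assert (Cd : forall x, continuous (fun x => psi x * (PI / 2 * cosh x)) x).
  { intros x. apply continuous_Rmult.
    - apply (ex_derive_continuous psi). eexists. apply is_derive_psi.
    - apply (continuous_Rmult (fun _ => PI / 2)); [apply continuous_const|].
      apply (ex_derive_continuous cosh). eexists. apply is_derive_Reals, derivable_pt_lim_cosh. }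
  unfold CI. f_equal.
  - rewrite <- (RInt_comp (V := R_CompleteNormedModule) (fun t => Re (f (RtoC t))) psi (fun x => psi x * (PI / 2 * cosh x))).
    + apply RInt_ext. intros x _. rewrite pullback_R, (is_derive_unique _ _ _ (is_derive_psi x)).
      rewrite re_scal_r. unfold scal; simpl; unfold mult; simpl. ring.
    + intros x _. apply (continuous_Re (fun t : R => f (RtoC t))), Hf, psi_pos.
    + intros x _. split; [apply is_derive_psi|apply Cd].
  - rewrite <- (RInt_comp (V := R_CompleteNormedModule) (fun t => Im (f (RtoC t))) psi (fun x => psi x * (PI / 2 * cosh x))).
    + apply RInt_ext. intros x _. rewrite pullback_R, (is_derive_unique _ _ _ (is_derive_psi x)).
      rewrite im_scal_r. unfold scal; simpl; unfold mult; simpl. ring.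
    + intros x _. apply (continuous_Im (fun t : R => f (RtoC t))), Hf, psi_pos.
    + intros x _. split; [apply is_derive_psi|apply Cd].
Qed.

(** The limit is found along the points [- n] by completeness in each component. The rate [om]
    survives in the conclusion; it serves both the convergence of the improper integral and the
    passage to the limit in the error bound. *)
Lemma limit_at_minus_infinity (Phi : R -> C) (om : R -> R) X :
  (forall x y, x <= y -> y <= X -> Cmod (Phi x - Phi y) <= om y) ->
  (forall eps, 0 < eps -> exists Y, forall y, y <= Y -> om y <= eps) ->
  exists I, forall y, y <= X -> Cmod (Phi y - I) <= om y.
Proof.
  intros H1 H2.
  assert (Cau : forall eps, 0 < eps -> exists N : nat, forall m n, (n >= N)%nat -> (m >= N)%nat ->
     Cmod (Phi (- INR n)%R - Phi (- INR m)%R) < eps).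
  { intros eps He. destruct (H2 (eps / 2)) as [Y HY]; [lra|].
    destruct (INR_unbounded (Rabs X + Rabs Y)) as [N HN]. exists N.
    assert (S : forall p q, (q >= N)%nat -> (p >= q)%nat -> Cmod (Phi (- INR p)%R - Phi (- INR q)%R) < eps).
    { intros p q Hq Hp. apply le_INR in Hq, Hp.
      pose proof (Rabs_pos X). pose proof (Rabs_pos Y).
      pose proof (Rle_abs (- X)) as X1. rewrite Rabs_Ropp in X1.
      pose proof (Rle_abs (- Y)) as Y1. rewrite Rabs_Ropp in Y1.
      assert (Cmod (Phi (- INR p)%R - Phi (- INR q)%R) <= om (- INR q)) by (apply H1; lra).
      assert (om (- INR q) <= eps / 2) by (apply HY; lra). lra. }
    intros m n Hn Hm. destruct (Nat.le_ge_cases m n) as [L|L].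
    - now apply S.
    - replace (Phi (- INR n)%R - Phi (- INR m)%R)%C with (- (Phi (- INR m)%R - Phi (- INR n)%R))%C by ring.
      rewrite Cmod_opp. now apply S. }
  assert (CR : Cauchy_crit (fun n => Re (Phi (- INR n)%R))).
  { intros eps He. destruct (Cau eps He) as [N HN]. exists N. intros n m Hn Hm. unfold R_dist.
    eapply Rle_lt_trans; [|apply (HN m n Hn Hm)].
    exact (re_le_Cmod (Phi (- INR n)%R - Phi (- INR m)%R)%C). }
  assert (CIm : Cauchy_crit (fun n => Im (Phi (- INR n)%R))).
  { intros eps He. destruct (Cau eps He) as [N HN]. exists N. intros n m Hn Hm. unfold R_dist.
    eapply Rle_lt_trans; [|apply (HN m n Hn Hm)].
    pose proof (Rmax_Cmod (Phi (- INR n)%R - Phi (- INR m)%R)%C) as M.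
    eapply Rle_trans; [|exact M]. apply Rmax_r. }
  destruct (Rcomplete.R_complete _ CR) as [lr Hr]. destruct (Rcomplete.R_complete _ CIm) as [li Hi].
  exists (lr, li). intros y Hy. apply le_epsilon. intros eps He.
  destruct (Hr (eps / 2)) as [N1 HN1]; [lra|]. destruct (Hi (eps / 2)) as [N2 HN2]; [lra|].
  destruct (INR_unbounded (Rabs y + INR N1 + INR N2)) as [n Hn].
  pose proof (pos_INR N1). pose proof (pos_INR N2). pose proof (Rabs_pos y).
  assert (n >= N1)%nat by (apply INR_le; lra). assert (n >= N2)%nat by (apply INR_le; lra).
  specialize (HN1 n). specialize (HN2 n). unfold R_dist in *.
  replace (Phi y - (lr, li))%C with (- (Phi (- INR n)%R - Phi y) + (Phi (- INR n)%R - (lr, li)))%C by ring.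
  eapply Rle_trans; [apply Cmod_triangle|]. rewrite Cmod_opp.
  apply Rplus_le_compat.
  - apply H1; [|exact Hy]. pose proof (Rle_abs (- y)) as Y1. rewrite Rabs_Ropp in Y1. lra.
  - replace (Phi (- INR n)%R - (lr, li))%C with ((Re (Phi (- INR n)%R) - lr, Im (Phi (- INR n)%R) - li) : C)
      by (destruct (Phi (- INR n)%R); unfold Cminus, Cplus, Copp; simpl; f_equal; ring).
    eapply Rle_trans; [apply Cmod_le_sum|].
    assert (Rabs (Re (Phi (- INR n)%R) - lr) < eps / 2) by now apply HN1.
    assert (Rabs (Im (Phi (- INR n)%R) - li) < eps / 2) by now apply HN2. lra.
Qed.

Lemma Csum_small (g : Z -> R -> C) (l : list Z) :
  (forall k, In k l -> forall eps, 0 < eps -> exists X, forall x, x < X -> Cmod (g k x) <= eps) ->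
  forall eps, 0 < eps -> exists X, forall x, x < X -> Cmod (Csum (fun k => g k x) l) <= eps.
Proof.
  induction l as [|k l IH]; intros H eps He.
  - exists 0. intros x _. simpl. rewrite Cmod_0. lra.
  - destruct (H k (or_introl eq_refl) (eps / 2)) as [X1 HX1]; [lra|].
    destruct (IH (fun j Hj => H j (or_intror Hj)) (eps / 2)) as [X2 HX2]; [lra|].
    exists (Rmin X1 X2). intros x Hx. simpl.
    eapply Rle_trans; [apply Cmod_triangle|].
    assert (Cmod (g k x) <= eps / 2) by (apply HX1; exact (Rmin_lt_l _ _ _ Hx)).
    assert (Cmod (Csum (fun k => g k x) l) <= eps / 2) by (apply HX2; exact (Rmin_lt_r _ _ _ Hx)).
    lra.
Qed.

(** Replacing [cos t] by the smaller [cos d] weakens the decay only if the exponent is negative,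
    hence one half-line for each estimate. *)
Lemma pullback_bounds_strip f d K alpha beta :
  0 < K -> 0 < alpha -> 0 < beta -> 0 < d -> d < PI / 2 ->
  (forall z : C, psi_strip d z ->
     Cmod (f z) <= K * (abs_cpow z (alpha - 1) / abs_cpow (1 + z * z)%C ((alpha + beta) / 2))) ->
  let D := PI * K / 2 / Rpower (cos (PI / 2 * sin d)) ((alpha + beta) / 2) in
  (forall x t, Rabs t < d -> x <= 0 ->
     Cmod (pullback f (x, t)) <= D * (cosh x * exp (PI / 2 * alpha * cos d * sinh x))) /\
  (forall x t, Rabs t < d -> 0 <= x ->
     Cmod (pullback f (x, t)) <= D * (cosh x * exp (- (PI / 2 * beta * cos d) * sinh x))).
Proof.
  intros HK Ha Hb Hd Hd2 Hf D. pose proof PI_RGT_0 as HPI.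
  assert (HD : forall t, Rabs t < d ->
     0 <= PI * K / 2 / Rpower (cos (PI / 2 * sin t)) ((alpha + beta) / 2) <= D).
  { intros t Ht. destruct (cos_strip_mono t d Ht Hd2) as (_ & _ & Hc1 & Hc2).
    assert (0 < PI * K / 2) by nra. split.
    - left. apply Rdiv_lt_0_compat; [lra|apply exp_pos].
    - apply Rmult_le_compat_l; [lra|]. apply Rinv_le_contravar; [apply exp_pos|].
      apply Rle_Rpower_l; lra. }
  split; intros x t Ht Hx; destruct (HD t Ht) as [D1 D2];
    destruct (cos_strip_mono t d Ht Hd2) as (Hc & _);
    destruct (pullback_bound f d K alpha beta x t HK Ha Hb Hd2 Ht Hf) as [B1 B2];
    pose proof (cosh_ge_1 x) as Hch;
    [eapply Rle_trans; [exact B1|]|eapply Rle_trans; [exact B2|]];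
    (apply Rmult_le_compat; [exact D1| |exact D2|]);
    try (apply Rmult_le_pos; [lra|left; apply exp_pos]);
    (apply Rmult_le_compat_l; [lra|]); apply exp_le.
  - assert (Hs : sinh x <= 0) by (rewrite <- sinh_0; now apply sinh_incr).
    assert (0 < PI / 2 * alpha) by nra.
    replace (alpha * (PI / 2 * (sinh x * cos t))) with (PI / 2 * alpha * (cos t * sinh x)) by ring.
    replace (PI / 2 * alpha * cos d * sinh x) with (PI / 2 * alpha * (cos d * sinh x)) by ring.
    apply Rmult_le_compat_l; [lra|]. nra.
  - assert (Hs : 0 <= sinh x) by (rewrite <- sinh_0; now apply sinh_incr).
    assert (0 < PI / 2 * beta) by nra.
    replace (- beta * (PI / 2 * (sinh x * cos t))) with (- (PI / 2 * beta * (cos t * sinh x))) by ring.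
    replace (- (PI / 2 * beta * cos d) * sinh x) with (- (PI / 2 * beta * (cos d * sinh x))) by ring.
    apply Ropp_le_contravar. apply Rmult_le_compat_l; [lra|]. nra.
Qed.

(** At height zero both cosines equal one, so the truncation error is free of the factors that
    depend on [d]. *)
Lemma pullback_bounds_real f d K alpha beta :
  0 < K -> 0 < alpha -> 0 < beta -> 0 < d -> d < PI / 2 ->
  (forall z : C, psi_strip d z ->
     Cmod (f z) <= K * (abs_cpow z (alpha - 1) / abs_cpow (1 + z * z)%C ((alpha + beta) / 2))) ->
  forall x : R,
    Cmod (pullback f (RtoC x)) <= PI * K / 2 * (cosh x * exp (PI / 2 * alpha * sinh x)) /\
    Cmod (pullback f (RtoC x)) <= PI * K / 2 * (cosh x * exp (- (PI / 2 * beta) * sinh x)).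
Proof.
  intros HK Ha Hb Hd Hd2 Hf x.
  destruct (pullback_bound f d K alpha beta x 0 HK Ha Hb Hd2) as [B1 B2]; [rewrite Rabs_R0; lra|exact Hf|].
  assert (E : PI * K / 2 / Rpower (cos (PI / 2 * sin 0)) ((alpha + beta) / 2) = PI * K / 2).
  { rewrite sin_0, Rmult_0_r, cos_0. unfold Rpower. rewrite ln_1, Rmult_0_r, exp_0. field. }
  rewrite E, cos_0 in B1, B2.
  replace (PI / 2 * alpha * sinh x) with (alpha * (PI / 2 * (sinh x * 1))) by ring.
  replace (- (PI / 2 * beta) * sinh x) with (- beta * (PI / 2 * (sinh x * 1))) by ring.
  now split.
Qed.

Lemma Cder_pullback f d z : (forall z : C, psi_strip d z -> ex_derive f z) ->
  Rabs (Im z) < d -> exists l, Cder (pullback f) z l.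
Proof.
  intros Hf Hz. destruct (ex_derive_Cder f (Cpsi z)) as [l Hl]; [apply Hf; now exists z|].
  eexists. unfold pullback. apply Cder_mult.
  - apply (Cder_comp f Cpsi); [exact Hl|apply Cder_Cpsi].
  - apply Cder_mult; [apply Cder_Cpsi|]. apply Cder_mult; [apply Cder_const|apply Cder_Ccosh].
Qed.

Lemma sumZ_ext a b g k : (forall j, g j = k j) -> sumZ a b g = sumZ a b k.
Proof. intros H. rewrite !sumZ_Csum. apply Csum_ext. intros; apply H. Qed.

Lemma sumZ_plus a b g k : sumZ a b (fun j => g j + k j)%C = (sumZ a b g + sumZ a b k)%C.
Proof.
  rewrite !sumZ_Csum. generalize (seq 0 (Z.to_nat (b - a + 1))).
  induction l as [|j l IH]; simpl; [ring|]. rewrite IH. ring.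
Qed.

Lemma pos_Z_of_nat (z : Z) : 0 < IZR z -> exists n, z = Z.of_nat n.
Proof. intros H. apply lt_IZR in H. exists (Z.to_nat z). lia. Qed.

(* The reason for the choice of [M] and [N]: both tails then decay like [exp (- PI * d * n)]. *)
Lemma exp_shifted_endpoint a b h (n : nat) q : 0 < a -> 0 < b -> 0 < h ->
  exp (INR n * h) = q / a ->
  q <= b * exp (IZR (Z.of_nat n - floorZ (ln (b / a) / h)) * h).
Proof.
  intros Ha Hb Hh Hq.
  destruct (base_Int_part (ln (b / a) / h)) as [H1 _].
  apply (Rmult_le_compat_r h) in H1; [|lra].
  replace (ln (b / a) / h * h) with (ln (b / a)) in H1 by (field; lra).
  rewrite minus_IZR, <- INR_IZR_INZ. unfold floorZ.
  apply Rle_trans with (b * exp (INR n * h - ln (b / a))).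
  - right. unfold Rminus. rewrite exp_plus, exp_Ropp, exp_ln by (now apply Rdiv_lt_0_compat).
    rewrite Hq. field. split; lra.
  - apply Rmult_le_compat_l; [lra|]. apply exp_le. lra.
Qed.

Theorem theorem13 (d K alpha beta : R) (f : C -> C) (n : nat) :
  0 < d -> d < PI / 2 ->
  (forall z : C, psi_strip d z -> ex_derive f z) ->
  0 < K -> 0 < alpha -> 0 < beta ->
  (forall z : C, psi_strip d z ->
     Cmod (f z) <= K * (abs_cpow z (alpha - 1)
                        / abs_cpow (1 + z * z)%C ((alpha + beta) / 2))) ->
  (0 < n)%nat ->
  let mu := Rmin alpha beta in
  let nu := Rmax alpha beta in
  let h := ln (4 * d * INR n / mu) / INR n in
  let M : Z := if Rle_dec alpha beta then Z.of_nat n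
               else (Z.of_nat n - floorZ (ln (alpha / beta) / h))%Z in
  let N : Z := if Rle_dec alpha beta
               then (Z.of_nat n - floorZ (ln (beta / alpha) / h))%Z
               else Z.of_nat n in
  INR n >= nu * exp 1 / (4 * d) ->
  IZR M * h >= x_gamma (alpha / 2) ->
  IZR N * h >= x_gamma (beta / 2) ->
  let C2 := 2 * K / (mu * d) *
     (1 / ((1 - exp (- PI * mu * exp 1 / 2))
           * Rpower (cos (PI / 2 * sin d)) ((alpha + beta) / 2) * cos d)
      + exp (PI * (alpha + beta) / 4)) in
  forall tau : R, 0 < tau ->
    exists I : C,
      is_RInt_gen (V := C_R_CompleteNormedModule) (fun t => f (RtoC t))
        (at_right 0) (at_point tau) I /\
      Cmod (I - sumZ (- M) N (fun k =>
              (f (RtoC (psi (IZR k * h)))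
               * RtoC (Derive psi (IZR k * h))
               * RtoC (J k h (psi_inv tau)))%C)%C)
      <= C2 * (exp (- PI * d * INR n / ln (4 * d * INR n / mu))
               * ln (4 * d * INR n / mu) / INR n).
Proof.
  intros Hd Hd2 Hf HK Ha Hb Hbound Hn0 mu nu h M N Hn1 HM HN C2 tau Htau.
  pose proof PI_RGT_0 as HPI.
  assert (Hn : 0 < INR n) by now apply lt_0_INR.
  assert (Hmu : 0 < mu) by (unfold mu; now apply Rmin_pos).
  assert (Hmunu : mu <= nu) by (unfold mu, nu; eapply Rle_trans; [apply Rmin_l|apply Rmax_l]).
  set (l := ln (4 * d * INR n / mu)) in *.
  (* The hypothesis on [n] is stated with [nu >= mu]; it yields [l >= 1], on which the final
     estimate rests. *)
  assert (Hu : exp 1 <= 4 * d * INR n / mu).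
  { apply (Rmult_le_reg_r mu); [exact Hmu|].
    replace (4 * d * INR n / mu * mu) with (4 * d * INR n) by (field; lra).
    apply Rge_le in Hn1. apply (Rmult_le_compat_l (4 * d)) in Hn1; [|lra].
    replace (4 * d * (nu * exp 1 / (4 * d))) with (nu * exp 1) in Hn1 by (field; lra).
    pose proof (exp_pos 1). nra. }
  assert (Hl : 1 <= l).
  { unfold l. rewrite <- (ln_exp 1). apply ln_le; [apply exp_pos|exact Hu]. }
  assert (Hh : 0 < h) by (unfold h; apply Rdiv_lt_0_compat; lra).
  assert (Enh : exp (INR n * h) = 4 * d * INR n / mu).
  { replace (INR n * h) with l by (unfold h; field; lra). apply exp_ln.
    pose proof (exp_pos 1). lra. }
  destruct (x_gamma_pos_bound (alpha / 2) (IZR M * h)) as [HM0 HM1]; [lra|lra|].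
  destruct (x_gamma_pos_bound (beta / 2) (IZR N * h)) as [HN0 HN1]; [lra|lra|].
  assert (HMe : 4 * d * INR n <= alpha * exp (IZR M * h)).
  { unfold M, mu in *. unfold Rmin in *. destruct (Rle_dec alpha beta) as [L|L].
    - rewrite <- INR_IZR_INZ, Enh. right. field. lra.
    - apply exp_shifted_endpoint; trivial. }
  assert (HNe : 4 * d * INR n <= beta * exp (IZR N * h)).
  { unfold N, mu in *. unfold Rmin in *. destruct (Rle_dec alpha beta) as [L|L].
    - apply exp_shifted_endpoint; trivial.
    - rewrite <- INR_IZR_INZ, Enh. right. field. lra. }
  (* From here on [M] and [N] matter only through these inequalities. Their positivity, a
     consequence of [x_gamma > 0], makes them natural numbers. *)
  clearbody M N. clear HM HN.
  destruct (pos_Z_of_nat M) as [M' ->]; [nra|]. destruct (pos_Z_of_nat N) as [N' ->]; [nra|].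
  rewrite <- INR_IZR_INZ in HM0, HM1, HN0, HN1, HMe, HNe.
  set (F := pullback f).
  assert (HF : forall z, Rabs (Im z) < d -> exists m, Cder F z m) by (intros z; now apply Cder_pullback).
  destruct (pullback_bounds_strip f d K alpha beta HK Ha Hb Hd Hd2 Hbound) as [S1 S2].
  pose proof (pullback_bounds_real f d K alpha beta HK Ha Hb Hd Hd2 Hbound) as R12.
  fold F in S1, S2, R12.
  set (D := PI * K / 2 / Rpower (cos (PI / 2 * sin d)) ((alpha + beta) / 2)) in *.
  set (D0 := PI * K / 2) in *.
  set (xi := psi_inv tau).
  assert (Hcd : 0 < cos d) by (apply cos_gt_0; lra).
  assert (HD0 : 0 < D0) by (unfold D0; nra).
  assert (HD : 0 < D) by (unfold D; apply Rdiv_lt_0_compat; [exact HD0|apply exp_pos]).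
  assert (Hc1 : 0 < PI / 2 * alpha) by nra. assert (Hc2 : 0 < PI / 2 * beta) by nra.
  set (RHS := C2 * _).
  (* Uniform in [xi0], so it survives the limit at minus infinity. *)
  assert (Err : forall xi0, xi0 <= xi ->
    Cmod (CI (fun x => F (RtoC x)) xi0 xi
        - sumZ (- Z.of_nat M') (Z.of_nat N')
            (fun k => F (RtoC (IZR k * h)) * RtoC (J k h xi - J k h xi0))%C) <= RHS).
  { intros xi0 Hxi0.
    eapply Rle_trans;
      [apply (sinc_indefinite_error F d h D (PI / 2 * alpha * cos d) (PI / 2 * beta * cos d) D0
         (PI / 2 * alpha) (PI / 2 * beta) M' N' xi0 xi); trivial; try lra|].
    - now apply Rmult_lt_0_compat.
    - now apply Rmult_lt_0_compat.
    - intros x. apply R12.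
    - intros x. apply R12.
    - exact (final_estimate d K alpha beta (INR n) (INR M' * h) (INR N' * h) Hd Hd2 HK Ha Hb Hn
        Hl (Rlt_le _ _ HM0) (Rlt_le _ _ HN0) HMe HNe). }
  assert (CF : forall x : R, continuous (fun x : R => F (RtoC x)) x).
  { intros x. apply (continuous_comp (V := C_UniformSpace) (fun x : R => RtoC x) F);
      [apply continuous_RtoC, continuous_id|]. now apply (F_continuous_R F d). }
  assert (EF : forall a b, exCI (fun x => F (RtoC x)) a b) by (intros; apply exCI_continuous; intros; apply CF).
  assert (Cf : forall x, 0 < x -> continuous (fun t : R => f (RtoC t)) x).
  { intros x Hx. apply (continuous_comp (V := C_UniformSpace) (fun t : R => RtoC t) f);
      [apply continuous_RtoC, continuous_id|].
    destruct (ex_derive_Cder f (RtoC x)) as [m Hm]; [|eapply Cder_continuous, Hm].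
    apply Hf. exists (RtoC (psi_inv x)). split.
    - unfold strip. simpl. now rewrite Rabs_R0.
    - now rewrite Cpsi_RtoC, psi_psi_inv. }
  (* The integral of the left majorant from minus infinity to [y]. *)
  set (om := fun y => D0 / (PI / 2 * alpha) * exp (PI / 2 * alpha * sinh y)).
  set (Phi := fun x => CI (fun t => F (RtoC t)) x xi).
  assert (Hom : forall eps, 0 < eps -> exists Y, forall y, y <= Y -> om y <= eps).
  { intros eps He.
    set (q := eps * (PI / 2 * alpha) / D0).
    assert (Hq : 0 < q) by (unfold q; apply Rdiv_lt_0_compat; [now apply Rmult_lt_0_compat|exact HD0]).
    exists (Rmin 0 (ln q / (PI / 2 * alpha))). intros y Hy.
    assert (Y0 : y <= 0) by (eapply Rle_trans; [exact Hy|apply Rmin_l]).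
    assert (Y1 : y <= ln q / (PI / 2 * alpha)) by (eapply Rle_trans; [exact Hy|apply Rmin_r]).
    assert (Hs : sinh y <= y).
    { pose proof (le_sinh (- y)) as Q. rewrite sinh_opp in Q. lra. }
    assert (He2 : exp (PI / 2 * alpha * sinh y) <= q).
    { rewrite <- (exp_ln q Hq). apply exp_le.
      apply Rle_trans with (PI / 2 * alpha * (ln q / (PI / 2 * alpha))); [|right; field; lra].
      apply Rmult_le_compat_l; lra. }
    unfold om. apply Rle_trans with (D0 / (PI / 2 * alpha) * q); [|right; unfold q; field; repeat split; lra].
    apply Rmult_le_compat_l; [left; now apply Rdiv_lt_0_compat|exact He2]. }
  destruct (limit_at_minus_infinity Phi om xi) as [I HI].
  { intros x y Hxy Hy. unfold Phi.
    rewrite <- (CI_Chasles _ x y xi) by apply EF.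
    replace (CI (fun x => F (RtoC x)) x y + CI (fun x => F (RtoC x)) y xi - CI (fun t => F (RtoC t)) y xi)%C
      with (CI (fun x => F (RtoC x)) x y) by ring.
    pose proof (is_RInt_de_decay D0 (PI / 2 * alpha) x y (Rgt_not_eq _ _ Hc1)) as I0.
    apply Rle_trans with (RInt (fun s => D0 * (cosh s * exp (PI / 2 * alpha * sinh s))) x y).
    - apply CI_norm; [exact Hxy|apply EF|eexists; exact I0|]. intros t _. apply R12.
    - rewrite (is_RInt_unique (V := R_CompleteNormedModule) _ _ _ _ I0). unfold om.
      apply Rmult_le_compat_l; [left; now apply Rdiv_lt_0_compat|].
      pose proof (exp_pos (PI / 2 * alpha * sinh x)). lra. }
  { exact Hom. }
  exists I. split.
  (* The substitution turns the integral over [[e, tau]] into [Phi (psi_inv e)], and [e < psi Y']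
     forces [psi_inv e <= Y'], where [om] is at most [eps / 2]. *)
  - intros P [eps HP].
    destruct (Hom (eps / 2)) as [Y HY]; [apply is_pos_div_2|].
    set (Y' := Rmin Y xi).
    apply (Filter_prod _ _ _ (fun e => 0 < e /\ e < psi Y') (fun t => t = tau)).
    + exists (mkposreal _ (psi_pos Y')). intros e He He0. split; [exact He0|].
      change (Rabs (e - 0) < psi Y') in He. rewrite Rminus_0_r, Rabs_pos_eq in He; lra.
    + reflexivity.
    + intros e t [He0 He] ->. simpl.
      set (y := psi_inv e).
      assert (Hy : y <= Y').
      { left. unfold y. rewrite <- (psi_inv_psi Y'). now apply psi_inv_incr. }
      assert (E : CI (fun t => f (RtoC t)) e tau = Phi y).
      { unfold Phi, F. rewrite <- (psi_psi_inv e He0), <- (psi_psi_inv tau Htau).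
        apply CI_psi_substitution. exact Cf. }
      exists (CI (fun t => f (RtoC t)) e tau). split.
      * apply CI_correct, exCI_continuous. intros s Hs. apply Cf.
        eapply Rlt_le_trans; [|apply Hs]. now apply Rmin_pos.
      * rewrite E. apply HP. apply C_NormedModule_mixin_compat1.
        assert (Hyx : y <= xi) by (eapply Rle_trans; [exact Hy|apply Rmin_r]).
        assert (HyY : y <= Y) by (eapply Rle_trans; [exact Hy|apply Rmin_l]).
        pose proof (HI y Hyx). pose proof (HY y HyY). pose proof (cond_pos eps).
        change (minus (Phi y) I) with (Phi y - I)%C. lra.
  (* Now [xi0] is taken so far left that [Phi xi0] is within [eps / 2] of [I] and the finite sum
     with [J k h xi0] is at most [eps / 2]. *)
  - apply le_epsilon. intros eps He.
    destruct (Hom (eps / 2)) as [Y HY]; [lra|].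
    destruct (Csum_small (fun j x => F (RtoC (IZR (- Z.of_nat M' + j) * h)) * RtoC (J (- Z.of_nat M' + j) h x))%C
      (map Z.of_nat (seq 0 (Z.to_nat (Z.of_nat N' - - Z.of_nat M' + 1))))) with (eps := eps / 2) as [X HX]; [|lra|].
    { intros k _ e He'. set (w := F (RtoC (IZR (- Z.of_nat M' + k) * h))).
      pose proof (Cmod_ge_0 w).
      destruct (J_lim_minus_infty (- Z.of_nat M' + k) h (e / (Cmod w + 1))) as [X HX];
        [exact Hh|apply Rdiv_lt_0_compat; lra|].
      exists X. intros x Hx. rewrite Cmod_mult, Cmod_R.
      apply Rle_trans with ((Cmod w + 1) * (e / (Cmod w + 1))); [|right; field; lra].
      apply Rmult_le_compat; [lra|apply Rabs_pos|lra|now apply HX]. }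
    set (xi0 := Rmin (X - 1) (Rmin Y xi)).
    assert (X1 : xi0 <= X - 1) by apply Rmin_l.
    assert (X2 : xi0 <= Rmin Y xi) by apply Rmin_r.
    assert (X3 : xi0 <= Y) by (eapply Rle_trans; [exact X2|apply Rmin_l]).
    assert (X4 : xi0 <= xi) by (eapply Rle_trans; [exact X2|apply Rmin_r]).
    rewrite (sumZ_ext _ _ _ (fun k => F (RtoC (IZR k * h)) * RtoC (J k h xi - J k h xi0)
                                       + F (RtoC (IZR k * h)) * RtoC (J k h xi0))%C).
    2:{ intros k. unfold F. rewrite pullback_R, RtoC_minus. ring. }
    rewrite sumZ_plus.
    rewrite (sumZ_Csum _ _ (fun k => F (RtoC (IZR k * h)) * RtoC (J k h xi0))%C).
    specialize (HX xi0). rewrite Csum_map in HX.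
    specialize (Err xi0 X4). fold (Phi xi0) in Err.
    match type of Err with Cmod (_ - ?A) <= _ => set (SA := A) in * end.
    match type of HX with _ -> Cmod ?B <= _ => set (SB := B) in * end.
    assert (HX' : Cmod SB <= eps / 2) by (apply HX; lra).
    replace (I - (SA + SB))%C with ((Phi xi0 - SA) + (- (Phi xi0 - I) + - SB))%C by ring.
    eapply Rle_trans; [apply Cmod_triangle|]. apply Rplus_le_compat; [exact Err|].
    eapply Rle_trans; [apply Cmod_triangle|]. rewrite !Cmod_opp.
    pose proof (HI xi0 X4). pose proof (HY xi0 X3). lra.
Qed.
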